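(* Let $1<p<\infty$ and let $\alpha,\beta\in[L^p(\Sigma)]^3$. There exists $u\in\mathcal A^p(\Omega)$ satisfying $$\int_\Omega u\cdot Ew\,dx=\int_\Sigma(\alpha\cdot Tw-\beta\cdot w)\,d\sigma\qquad\forall\, w\in[C^\infty(\mathbb R^3)]^3$$ (with these given $\alpha,\beta$) if and only if $$\int_\Sigma(\alpha\cdot Tp_k-\beta\cdot p_k)\,d\sigma=0,\qquad k=0,1,2,\ldots.$$
   Context: $\Omega\subset\mathbb R^3$ is a bounded domain such that $\mathbb R^3\setminus\Omega$ is connected and its boundary $\Sigma$ is a $C^{2,\theta}$ manifold for some $0<\theta\leq1$; $\nu$ is the outward unit normal to $\Sigma$ and $d\sigma$ is surface measure. $\lambda,\mu$ are real constants (Lamé constants) with $\mu>0$, $3\lambda+2\mu>0$. The elasticity operator is $Eu=\mu\Delta u+(\lambda+\mu)\nabla\operatorname{div}u$ for $u=(u_1,u_2,u_3)$, and the stress operator on $\Sigma$ is $Tu=2\mu\frac{\partial u}{\partial\nu}+\lambda(\operatorname{div}u)\nu+\mu(\nu\wedge\operatorname{curl}u)$, where $\wedge$ is the vector product. $\mathcal A^p(\Omega)$ is the set of $u\in[L^1(\Omega)]^3$ for which there exist $\alpha,\beta\in[L^p(\Sigma)]^3$ such that $\int_\Omega u\cdot Ew\,dx=\int_\Sigma(\alpha\cdot Tw-\beta\cdot w)\,d\sigma$ for all $w\in[C^\infty(\mathbb R^3)]^3$. $\{p_k\}_{k\ge 0}$ is the system of polynomial vector solutions of $Eu=0$ obtained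 as follows: for each $k\ge0$ let $\omega_{ks}(x)=|x|^kY_{ks}(x/|x|)$, $s=1,\ldots,2k+1$, be a basis of the homogeneous harmonic polynomials of degree $k$ ($Y_{ks}$ spherical harmonics), let $\Lambda_k=-\frac{\lambda+\mu}{2(\lambda(k-1)+\mu(3k-2))}$, and let $e_1,e_2,e_3$ be the standard basis; the vectors $\omega_{ks}e_j+\Lambda_k|x|^2\nabla(\partial_j\omega_{ks})$ ($j=1,2,3$; $s=1,\ldots,2k+1$; $k=0,1,\ldots$), ordered in one sequence, are the $p_k$. Every polynomial vector solution of $Eu=0$ is a finite linear combination of the $p_k$. *)

(* Defs.v *)
From HB Require Import structures.
From mathcomp Require Import all_boot all_order all_algebra.
From mathcomp Require Import all_classical all_reals all_analysis.

Set Implicit Arguments.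
Unset Strict Implicit.
Unset Printing Implicit Defensive.

Import Order.TTheory GRing.Theory Num.Theory.
Import numFieldNormedType.Exports.

Local Open Scope classical_set_scope.
Local Open Scope ring_scope.

(* Points and vectors of R^n are row vectors
   'rV[R]_n; a vector field is a map 'rV[R]_3 -> 'rV[R]_3. The library norm
   `|x| on 'rV[R]_n is the max norm; Euclidean lengths are written with dot. *)

(* R^n carries the sigma-algebra generated by the coordinates, like
   n.-tuple in the library; it is the Borel sigma-algebra. *)
Definition rV_display : measure_display.
Proof. exact: default_measure_display. Qed.

Section measurable_rV.
Context {R : realType} {n : nat}.

Let coors : 'I_n -> 'rV[R]_n -> measurableTypeR R := fun i x => x ord0 i.

Let rV_set0 : g_sigma_preimage coors set0.
Proof. exact: sigma_algebra0. Qed.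

Let rV_setC A : g_sigma_preimage coors A -> g_sigma_preimage coors (~` A).
Proof. exact: sigma_algebraC. Qed.

Let rV_bigcup (F : _^nat) : (forall i, g_sigma_preimage coors (F i)) ->
  g_sigma_preimage coors (\bigcup_i (F i)).
Proof. exact: sigma_algebra_bigcup. Qed.

HB.instance Definition _ := @isMeasurable.Build rV_display
  'rV[R]_n (g_sigma_preimage coors) rV_set0 rV_setC rV_bigcup.

Lemma measurable_to_rV d (T : measurableType d) (f : T -> 'rV[R]_n) :
  (forall i, measurable_fun [set: T]
    (fun t => f t ord0 i : measurableTypeR R)) ->
  measurable_fun [set: T] f.
Proof.
move=> mf _ A mA; rewrite setTI.
pose G := [set B : set 'rV[R]_n | d.-measurable (f @^-1` B)].
suff : g_sigma_preimage coors `<=` G by exact.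
apply: smallest_sub.
  split => [|B GB|F GF].
  - by rewrite /G /= preimage_set0; exact: measurable0.
  - by rewrite /G /= setTD preimage_setC; exact: measurableC.
  - by rewrite /G /= preimage_bigcup; exact: bigcupT_measurable.
move=> B; rewrite -bigcup_seq => -[i _ [C mC <-]].
by rewrite /G /= setTI; have := mf i measurableT C mC; rewrite setTI.
Qed.

End measurable_rV.

Section lebesgue_rV.
Context {R : realType}.

Local Notation leb := (@lebesgue_measure R).
Local Notation mR := (measurableTypeR R).

Definition rV2 (q : mR * mR) : 'rV[R]_2 := \row_(i < 2) [:: q.1; q.2]`_i.

Definition rV3 (q : mR * mR * mR) : 'rV[R]_3 :=
  \row_(i < 3) [:: q.1.1; q.1.2; q.2]`_i.

Lemma measurable_rV2 : measurable_fun [set: mR * mR] rV2.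
Proof.
apply: measurable_to_rV => -[[|[|i]] // Hi]; rewrite /rV2.
- by under eq_fun do rewrite mxE /=; exact: measurable_fst.
- by under eq_fun do rewrite mxE /=; exact: measurable_snd.
Qed.

Lemma measurable_rV3 : measurable_fun [set: mR * mR * mR] rV3.
Proof.
apply: measurable_to_rV => -[[|[|[|i]]] // Hi]; rewrite /rV3;
  under eq_fun do rewrite mxE /=.
- exact: measurableT_comp measurable_fst measurable_fst.
- exact: measurableT_comp measurable_snd measurable_fst.
- exact: measurable_snd.
Qed.

Definition leb2 : set 'rV[R]_2 -> \bar R := pushforward (leb \x leb)%E rV2.

Let leb2_0 : leb2 set0 = 0%E.
Proof. by rewrite /leb2 /pushforward preimage_set0 measure0. Qed.

Let leb2_ge0 A : (0 <= leb2 A)%E.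
Proof. by rewrite /leb2 /pushforward; exact: measure_ge0. Qed.

Let leb2_sigma_additive : semi_sigma_additive leb2.
Proof.
move=> F mF tF mUF; rewrite /leb2 /pushforward preimage_bigcup.
apply: measure_semi_sigma_additive.
- by move=> k; rewrite -[X in measurable X]setTI; exact: measurable_rV2.
- apply/trivIsetP => /= i j _ _ ij; rewrite -preimage_setI.
  by move/trivIsetP : tF => /(_ _ _ _ _ ij) ->//; rewrite preimage_set0.
- rewrite -preimage_bigcup -[X in measurable X]setTI.
  exact: measurable_rV2.
Qed.

HB.instance Definition _ :=
  isMeasure.Build _ _ _ leb2 leb2_0 leb2_ge0 leb2_sigma_additive.

Definition leb3 : set 'rV[R]_3 -> \bar R := pushforward ((leb \x leb) \x leb)%E rV3.

Let leb3_0 : leb3 set0 = 0%E.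
Proof. by rewrite /leb3 /pushforward preimage_set0 measure0. Qed.

Let leb3_ge0 A : (0 <= leb3 A)%E.
Proof. by rewrite /leb3 /pushforward; exact: measure_ge0. Qed.

Let leb3_sigma_additive : semi_sigma_additive leb3.
Proof.
move=> F mF tF mUF; rewrite /leb3 /pushforward preimage_bigcup.
apply: measure_semi_sigma_additive.
- by move=> k; rewrite -[X in measurable X]setTI; exact: measurable_rV3.
- apply/trivIsetP => /= i j _ _ ij; rewrite -preimage_setI.
  by move/trivIsetP : tF => /(_ _ _ _ _ ij) ->//; rewrite preimage_set0.
- rewrite -preimage_bigcup -[X in measurable X]setTI.
  exact: measurable_rV3.
Qed.

HB.instance Definition _ :=
  isMeasure.Build _ _ _ leb3 leb3_0 leb3_ge0 leb3_sigma_additive.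

End lebesgue_rV.

Section calculus.
Context {R : realType}.

Definition dot n (a b : 'rV[R]_n) : R := \sum_i a ord0 i * b ord0 i.

(* Indices are taken modulo 3, using the cyclic addition of 'I_3. *)
Definition cross (a b : 'rV[R]_3) : 'rV[R]_3 :=
  \row_(i < 3) (a ord0 (i + 1) * b ord0 (i + 2)
                - a ord0 (i + 2) * b ord0 (i + 1)).

Definition partial n (j : 'I_n.+1) (f : 'rV[R]_n.+1 -> R) (x : 'rV[R]_n.+1) : R :=
  'D_(delta_mx ord0 j) f x.

Definition grad n (f : 'rV[R]_n.+1 -> R) (x : 'rV[R]_n.+1) : 'rV[R]_n.+1 :=
  \row_j partial j f x.

Definition laplacian n (f : 'rV[R]_n.+1 -> R) (x : 'rV[R]_n.+1) : R :=
  \sum_j partial j (partial j f) x.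

Definition component (w : 'rV[R]_3 -> 'rV[R]_3) (i : 'I_3) (x : 'rV[R]_3) : R :=
  w x ord0 i.

Definition divergence (w : 'rV[R]_3 -> 'rV[R]_3) (x : 'rV[R]_3) : R :=
  \sum_i partial i (component w i) x.

Definition curl (w : 'rV[R]_3 -> 'rV[R]_3) (x : 'rV[R]_3) : 'rV[R]_3 :=
  \row_(i < 3) (partial (i + 1) (component w (i + 2)) x
                - partial (i + 2) (component w (i + 1)) x).

Fixpoint class_C n (k : nat) (f : 'rV[R]_n.+1 -> R) : Prop :=
  continuous f /\
  if k is k'.+1 then
    forall j, (forall x, derivable f x (delta_mx ord0 j)) /\
              class_C k' (partial j f)
  else True.

Definition smooth_field (w : 'rV[R]_3 -> 'rV[R]_3) : Prop :=
  forall i k, class_C k (component w i).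

(* Over a bounded set of y's, every local C^{2,theta} function extends (after
   multiplication by a cut-off) to a function with these global bounds. *)
Definition class_C2_holder n (theta : R) (f : 'rV[R]_n.+1 -> R) : Prop :=
  class_C 2 f /\
  exists C : R, forall i j x y,
    `|partial i (partial j f) x - partial i (partial j f) y|
      <= C * `|x - y| `^ theta.

End calculus.

Section surfaces.
Context {R : realType}.
Implicit Types (Omega Sigma U : set 'rV[R]_3) (phi : 'rV[R]_2 -> R).

Definition boundary Omega : set 'rV[R]_3 := closure Omega `\` interior Omega.

(* The point (y_1, y_2, phi y) of a graph, in the orthonormal frame formed by
   the rows of Q. *)
Definition graph_point (Q : 'M[R]_3) phi (y : 'rV[R]_2) : 'rV[R]_3 :=
  (row_mx y (phi y)%:M : 'rV[R]_(2 + 1)) *m Q.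

Definition graph_on Sigma U (Q : 'M[R]_3) phi : Prop :=
  [/\ open U, Q *m Q^T = 1%:M &
      Sigma `&` U = range (graph_point Q phi) `&` U].

Definition C2_holder_surface (theta : R) Sigma : Prop :=
  forall x, Sigma x -> exists U Q phi,
    [/\ U x, graph_on Sigma U Q phi & class_C2_holder theta phi].

(* d sigma = sqrt (1 + |grad phi|^2) dy on every piece of Sigma which is a C^1
   graph.  If Sigma is a compact C^1 surface, there is exactly one such Borel
   measure. *)
Definition surface_measure Sigma
    (sigma : {measure set 'rV[R]_3 -> \bar R}) : Prop :=
  sigma (~` Sigma) = 0%E /\
  forall U Q phi, graph_on Sigma U Q phi -> class_C 1 phi ->
    forall A, measurable A -> A `<=` U ->
      sigma A = (\int[leb2]_(y in graph_point Q phi @^-1` A)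
        (Num.sqrt (1 + dot (grad phi y) (grad phi y)))%:E)%E.

Definition tangent Sigma (x tau : 'rV[R]_3) : Prop :=
  exists gamma : R -> 'rV[R]_3,
    [/\ gamma 0 = x, \forall t \near (0 : R), Sigma (gamma t) &
        is_derive (0 : R) (1 : R) gamma tau].

Definition outward_unit_normal Omega (nu : 'rV[R]_3 -> 'rV[R]_3) : Prop :=
  forall x, boundary Omega x ->
    [/\ dot (nu x) (nu x) = 1,
        forall tau, tangent (boundary Omega) x tau -> dot (nu x) tau = 0 &
        \forall t \near (0 : R)^'+,
          Omega (x - t *: nu x) /\ ~ Omega (x + t *: nu x)].

End surfaces.

Section elasticity.
Context {R : realType}.
Implicit Types (Omega : set 'rV[R]_3) (lambda mu : R)
  (nu w u alpha beta : 'rV[R]_3 -> 'rV[R]_3)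
  (sigma : {measure set 'rV[R]_3 -> \bar R}).

Definition elasticity lambda mu w (x : 'rV[R]_3) : 'rV[R]_3 :=
  mu *: (\row_i laplacian (component w i) x)
  + (lambda + mu) *: grad (divergence w) x.

Definition stress lambda mu nu w (x : 'rV[R]_3) : 'rV[R]_3 :=
  (2 * mu) *: 'D_(nu x) w x + (lambda * divergence w x) *: nu x
  + mu *: cross (nu x) (curl w x).

Definition Lp_field (m : {measure set 'rV[R]_3 -> \bar R}) (D : set 'rV[R]_3)
    (p : R) (f : 'rV[R]_3 -> 'rV[R]_3) : Prop :=
  forall i, component f i \_ D \in Lfun m p%:E.

Definition boundary_integral Omega sigma lambda mu nu alpha beta w : \bar R :=
  (\int[sigma]_(x in boundary Omega)
    (dot (alpha x) (stress lambda mu nu w x) - dot (beta x) (w x))%:E)%E.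

Definition betti_identity Omega sigma lambda mu nu u alpha beta : Prop :=
  forall w, smooth_field w ->
    (\int[leb3]_(x in Omega) (dot (u x) (elasticity lambda mu w x))%:E)%E
    = boundary_integral Omega sigma lambda mu nu alpha beta w.

Definition class_A Omega sigma lambda mu nu (p : R) :
    set ('rV[R]_3 -> 'rV[R]_3) :=
  [set u | Lp_field leb3 Omega 1 u /\
    exists alpha beta,
      [/\ Lp_field sigma (boundary Omega) p alpha,
          Lp_field sigma (boundary Omega) p beta &
          betti_identity Omega sigma lambda mu nu u alpha beta]].

End elasticity.

Section polynomial_solutions.
Context {R : realType}.

Definition homogeneous_poly (k : nat) (f : 'rV[R]_3 -> R) : Prop :=
  exists c : {ffun 'I_3 -> 'I_k.+1} -> R, forall x,
    f x = \sum_(a : {ffun 'I_3 -> 'I_k.+1} | (\sum_i a i)%N == k)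
            c a * \prod_i x ord0 i ^+ a i.

Definition harmonic_poly (k : nat) (f : 'rV[R]_3 -> R) : Prop :=
  homogeneous_poly k f /\ forall x, laplacian f x = 0.

Definition harmonic_basis (k : nat)
    (omega : 'I_(k.*2.+1) -> 'rV[R]_3 -> R) : Prop :=
  [/\ forall s, harmonic_poly k (omega s),
      forall c : 'I_(k.*2.+1) -> R,
        (forall x, \sum_s c s * omega s x = 0) -> forall s, c s = 0 &
      forall f, harmonic_poly k f -> exists c : 'I_(k.*2.+1) -> R,
        forall x, f x = \sum_s c s * omega s x].

Definition Lambda (lambda mu : R) (k : nat) : R :=
  - ((lambda + mu) / (2 * (lambda * (k%:R - 1) + mu * (3 * k%:R - 2)))).

(* The index (k, s, j) of a member of the polynomial system. *)
Definition pindex : Type := {k : nat & ('I_(k.*2.+1) * 'I_3)%type}.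

Definition poly_solution (lambda mu : R)
    (omega : forall k, 'I_(k.*2.+1) -> 'rV[R]_3 -> R) (m : pindex)
    (x : 'rV[R]_3) : 'rV[R]_3 :=
  let: existT k (s, j) := m in
  omega k s x *: delta_mx ord0 j
  + (Lambda lambda mu k * dot x x) *: grad (partial j (omega k s)) x.

End polynomial_solutions.

(* Main.v *)
(* Necessity holds because the polynomials p_k are smooth and E p_k = 0.
   For sufficiency let K be Kelvin's fundamental matrix (up to a factor) and
   let u be the combination of single and double layer potentials of beta and
   alpha with kernel K(x - y).  Since K reproduces compactly supported fields w
   from E w, Fubini's theorem gives the required identity with Omega replaced
   by R^3, so it suffices that u vanishes outside the closure of Omega.
   For large |x| the homogeneous parts of the Taylor expansion of
   y |-> K(x - y) at 0 are polynomial solutions of E, hence linear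
   combinations of the p_k, and the orthogonality conditions give u(x) = 0.
   The Taylor expansions of the derivatives of K at z converge on a ball of
   radius proportional to |z|; hence, if u vanishes near x, it vanishes on a
   ball around x of radius proportional to the distance from x to the boundary.
   As the boundary is locally a graph with Omega on at least one side, and the
   complement of Omega is connected, the zero set of u exhausts the exterior. *)

Require Import Defs.
From HB Require Import structures.
From mathcomp Require Import all_boot all_order all_algebra.
From mathcomp Require Import all_classical all_reals all_analysis.
From mathcomp Require Import measurable_realfun.
From mathcomp Require Import ring lra zify.
Set Implicit Arguments.
Unset Strict Implicit.
Unset Printing Implicit Defensive.
Import Order.TTheory GRing.Theory Num.Theory.
Import numFieldNormedType.Exports.
Local Open Scope classical_set_scope.
Local Open Scope ring_scope.

(** * Derivatives along lines and functions of class C^k *)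

Section calculus_basics.
Context {R : realType}.

(** No jump relation and no regularity of potentials up to the boundary enters: the potential is
    only ever integrated against E w, so its values on the boundary, a null set, do not matter, and
    Fubini's theorem asks only for integrable kernels. The reproducing property comes from replacing
    |x| by sqrt(|x|^2 + e^2) in Kelvin's matrix: E of the regularised matrix is exactly -15 mu e^4
    (|x|^2 + e^2)^(-7/2) times the identity, and all integrations by parts take place at e <> 0. The
    limiting mass of this approximate identity is not computed; its positivity suffices, since u can
    be divided by it. Local integrability of |x|^-2 is read off from the divergence of x / (|x|^2 +
    e^2). Analyticity is used in quantitative form only: n-th derivatives of the kernels at z are at
    most A^n n! |z|^(-d-n), which serves both the expansion at infinity and the continuation.
    Connectedness is that of the closed set complementary to Omega, so the zero set has to be
    carried through boundary points as well; this is where the graph charts decide. *)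

Lemma MVT0 (f df : R -> R) (h : R) :
  (forall t : R, `|t| <= `|h| -> is_derive t (1 : R) f (df t)) ->
  exists2 t, `|t| <= `|h| & f h - f 0 = df t * h.
Proof.
move=> dfP.
have cf a b : (forall t, t \in `[a, b] -> `|t| <= `|h|) ->
    {within `[a, b], continuous f}.
  move=> ab; apply: derivable_within_continuous => t tab.
  by have [] := dfP t (ab _ tab).
have sub a b : (forall t, t \in `[a, b] -> `|t| <= `|h|) ->
    forall t : R, t \in `]a, b[ -> is_derive t (1 : R) f (df t).
  move=> ab t tab; apply: dfP; apply: ab; move: tab.
  by rewrite !in_itv/= => /andP[/ltW-> /ltW->].
have [h0|h0|->] := ltgtP h 0.
- have hh t : t \in `[h, 0] -> `|t| <= `|h|.
    by rewrite in_itv/= => /andP[ht t0]; rewrite !ler0_norm ?lerN2// ltW.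
  have [t tI E] := MVT h0 (sub _ _ hh) (cf _ _ hh); exists t; last by lra.
  by apply: hh; move: tI; rewrite !in_itv/= => /andP[/ltW-> /ltW->].
- have hh t : t \in `[0, h] -> `|t| <= `|h|.
    by rewrite in_itv/= => /andP[ht t0]; rewrite !ger0_norm// ltW.
  have [t tI E] := MVT h0 (sub _ _ hh) (cf _ _ hh); exists t; last by lra.
  by apply: hh; move: tI; rewrite !in_itv/= => /andP[/ltW-> /ltW->].
- by exists 0; rewrite ?subrr ?mulr0.
Qed.

Section normed.
Context {V : normedModType R}.
Implicit Types (f : V -> R) (x u v : V).

Lemma is_derive_line f x v t d :
  is_derive (x + t *: v) v f d -> is_derive t (1 : R) (fun s => f (x + s *: v)) d.
Proof.
have E : (fun h : R => h^-1 *: (((fun s => f (x + s *: v)) \o shift t) (h *: (1:R)) - f (x + t *: v)))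
  = (fun h : R => h^-1 *: ((f \o shift (x + t *: v)) (h *: v) - f (x + t *: v))).
  apply/funext => h /=; congr (_ *: (f _ - _)).
  by rewrite scalerDl -[h *: 1]/(h * 1) mulr1 addrCA.
case=> D1 D2; split; first by rewrite /derivable E.
by rewrite /derive E.
Qed.

Lemma line_is_derive f x v d :
  is_derive (0 : R) (1 : R) (fun s => f (x + s *: v)) d -> is_derive x v f d.
Proof.
have E : (fun h : R => h^-1 *: (((fun s => f (x + s *: v)) \o shift 0) (h *: (1:R)) - f (x + 0 *: v)))
  = (fun h : R => h^-1 *: ((f \o shift x) (h *: v) - f x)).
  apply/funext => h /=; congr (_ *: (f _ - f _)).
    by rewrite addr0 -[h *: 1]/(h * 1) mulr1 addrC.
  by rewrite scale0r addr0.
case=> D1 D2; split; first by move: D1; rewrite /derivable E.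
by move: D2; rewrite /derive E.
Qed.

(** The mean value theorem produces intermediate points in the parallelogram spanned by h u and h v;
    for small h all of it lies in the given neighbourhood, whatever the signs of the parameters. *)
Lemma nbhs_seg (P : V -> Prop) x u v : (\forall y \near x, P y) ->
  \forall h \near (0 : R), forall s t : R, `|s| <= `|h| -> `|t| <= `|h| ->
     P (x + (s *: u + t *: v)).
Proof.
move=> /nbhs_ballP[e /= e0 eP]; exists (e / (`|u| + `|v| + 1)) => /=.
  by rewrite divr_gt0// ltr_wpDl// addr_ge0.
move=> h; rewrite /= sub0r normrN ltr_pdivlMr ?ltr_wpDl ?addr_ge0// => he s t sh th.
apply: eP; rewrite -ball_normE /= opprD addrA subrr sub0r normrN.
apply: le_lt_trans he; rewrite (le_trans (ler_normD _ _))// !normrZ !mulrDr.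
rewrite -[leLHS]addr0 lerD ?mulr_ge0// lerD// ler_wpM2r//.
Qed.

(** The increment along u + w is split at x + h u. The first part gives the derivative along u; the
    second is, by the mean value theorem, h times a value of ['D_w f] at a point tending to x.
    Continuity of this one derivative replaces total differentiability. *)
Lemma is_derive_add f x u w a :
  is_derive x u f a -> (\forall y \near x, derivable f y w) ->
  {for x, continuous ('D_w f)} -> is_derive x (u + w) f (a + 'D_w f x).
Proof.
move=> fu fw cw.
suff H : (fun h : R => h^-1 *: ((f \o shift x) (h *: (u + w)) - f x)) @ 0^'
    --> a + 'D_w f x.
  split; last exact: cvg_lim.
  by apply/cvg_ex; exists (a + 'D_w f x).
have [d1 d2] := fu.
have H1 : (fun h : R => h^-1 *: ((f \o shift x) (h *: u) - f x)) @ 0^' --> a.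
  by rewrite -d2; exact: d1.
have H2 : (fun h : R => h^-1 *: ((f \o shift x) (h *: (u + w)) - (f \o shift x) (h *: u))) @ 0^'
    --> 'D_w f x.
  apply/cvgrPdist_le => e e0.
  have cwe : \forall y \near x, derivable f y w /\ `|'D_w f x - 'D_w f y| <= e.
    by apply: filterI => //; move/cvgrPdist_le : cw => /(_ _ e0).
  have := nbhs_seg u w cwe.
  move=> /nbhs_dnbhs; apply: filterS2; last exact: (nbhs_dnbhs_neq (0:R)).
  move=> h h0 P.
  have [t th E] : exists2 t, `|t| <= `|h| &
      f (x + h *: u + h *: w) - f (x + h *: u + 0 *: w) = 'D_w f (x + h *: u + t *: w) * h.
    apply: (@MVT0 (fun s => f (x + h *: u + s *: w)) (fun s => 'D_w f (x + h *: u + s *: w)) h) => s sh.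
    apply: is_derive_line; apply/derivableP.
    by have [] := P h s (lexx _) sh; rewrite addrA.
  have {}E : (f \o shift x) (h *: (u + w)) - (f \o shift x) (h *: u) = 'D_w f (x + h *: u + t *: w) * h.
    by rewrite -E /= scale0r addr0 scalerDr [_ + x]addrC addrA [h *: u + x]addrC.
  rewrite E -[_ *: _]/(_ * _) mulrC mulfK//.
  by have [] := P h t (lexx _) th; rewrite addrA.
have -> : (fun h : R => h^-1 *: ((f \o shift x) (h *: (u + w)) - f x)) =
   (fun h => h^-1 *: ((f \o shift x) (h *: u) - f x)) +
   (fun h : R => h^-1 *: ((f \o shift x) (h *: (u + w)) - (f \o shift x) (h *: u))).
  by apply/funext => h; rewrite !fctE -scalerDr; congr (_ *: _); rewrite [RHS]addrC addrA subrK.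
exact: cvgD.
Qed.

Lemma is_deriveZv f x v c d : is_derive x v f d -> is_derive x (c *: v) f (c * d).
Proof.
have [->|c0] := eqVneq c 0.
  by move=> _; rewrite scale0r mul0r; exact: is_derive0.
move=> fd; apply: line_is_derive.
have H : is_derive (0 * c) (1 : R) (fun s => f (x + s *: v)) d.
  by rewrite mul0r; apply: is_derive_line; rewrite scale0r addr0.
have -> : (fun s : R => f (x + s *: (c *: v))) = (fun s => f (x + s *: v)) \o (fun s => s * c).
  by apply/funext => s /=; rewrite scalerA.
have := @is_derive1_comp _ (fun s => f (x + s *: v)) (fun s => s * c) 0 d c H.
rewrite mulrC; apply.
have -> : (fun s : R => s * c) = (fun s => c *: s) by apply/funext => s; rewrite mulrC.
by have := @is_deriveZ _ _ _ (@id R) c 0 1 1 _; rewrite -[c *: 1]/(c * 1) mulr1; apply.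
Qed.

(** The mean value theorem is used twice: along u for the difference of f on two parallel segments,
    then along v for ['D_u f]. The second difference is symmetric in u and v, which is what allows
    derivatives to be interchanged. *)
Lemma second_difference f x u v :
  (\forall y \near x, derivable f y u) ->
  (\forall y \near x, derivable ('D_u f) y v) ->
  {for x, continuous ('D_v ('D_u f))} ->
  forall e, 0 < e -> \forall h \near 0^', 
   `| (f (x + h *: u + h *: v) - f (x + h *: u) - (f (x + h *: v) - f x)) / h ^+ 2
     - 'D_v ('D_u f) x| <= e.
Proof.
move=> fu fuv cuv e e0.
have P0 : \forall y \near x, [/\ derivable f y u, derivable ('D_u f) y v &
    `|'D_v ('D_u f) x - 'D_v ('D_u f) y| <= e].
  have c : \forall y \near x, `|'D_v ('D_u f) x - 'D_v ('D_u f) y| <= e.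
    by move/cvgrPdist_le : cuv => /(_ _ e0).
  by apply: filterS3 fu fuv c => y ? ? ?; split.
have := nbhs_seg u v P0.
move=> /nbhs_dnbhs; apply: filterS2; last exact: (nbhs_dnbhs_neq (0:R)).
move=> h h0 P.
pose g s := f (x + h *: v + s *: u) - f (x + s *: u).
have [s sh Es] : exists2 s, `|s| <= `|h| &
   g h - g 0 = ('D_u f (x + h *: v + s *: u) - 'D_u f (x + s *: u)) * h.
  apply: (@MVT0 g (fun s => 'D_u f (x + h *: v + s *: u) - 'D_u f (x + s *: u))) => s sh.
  have H1 : is_derive s (1 : R) (fun s => f (x + h *: v + s *: u)) ('D_u f (x + h *: v + s *: u)).
    apply: is_derive_line; apply/derivableP.
    have := P s h sh (lexx _); rewrite [s *: u + _]addrC addrA => -[+ _ _].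
    exact.
  have H2 : is_derive s (1 : R) (fun s => f (x + s *: u)) ('D_u f (x + s *: u)).
    apply: is_derive_line; apply/derivableP.
    have := P s 0 sh; rewrite normr0 scale0r addr0 => /(_ (normr_ge0 _))[+ _ _].
    exact.
  exact: (is_deriveB H1 H2).
have [t th Et] : exists2 t, `|t| <= `|h| &
   'D_u f (x + s *: u + h *: v) - 'D_u f (x + s *: u + 0 *: v) =
   'D_v ('D_u f) (x + s *: u + t *: v) * h.
  apply: (@MVT0 (fun t => 'D_u f (x + s *: u + t *: v)) (fun t => 'D_v ('D_u f) (x + s *: u + t *: v))) => t th.
  apply: (@is_derive_line ('D_u f) (x + s *: u) v); apply/derivableP.
  have := P s t sh th; rewrite addrA => -[_ + _]; exact.
have -> : f (x + h *: u + h *: v) - f (x + h *: u) - (f (x + h *: v) - f x) =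
   'D_v ('D_u f) (x + s *: u + t *: v) * h ^+ 2.
  rewrite scale0r addr0 [x + s *: u + h *: v]addrAC in Et.
  by rewrite expr2 mulrA -Et -Es /g scale0r !addr0 [x + h *: v + _]addrAC.
rewrite mulfK ?expf_neq0// distrC.
have := P s t sh th; rewrite addrA => -[_ _]; exact.
Qed.

Lemma schwarz f x u v :
  (\forall y \near x, derivable f y u) -> (\forall y \near x, derivable f y v) ->
  (\forall y \near x, derivable ('D_u f) y v) ->
  (\forall y \near x, derivable ('D_v f) y u) ->
  {for x, continuous ('D_v ('D_u f))} -> {for x, continuous ('D_u ('D_v f))} ->
  'D_v ('D_u f) x = 'D_u ('D_v f) x.
Proof.
have E (a b c : R) : b - c = (a - c) - (a - b) by lra.
move=> fu fv fuv fvu cuv cvu.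
apply/eqP; rewrite -subr_eq0 -normr_le0; apply/ler_addgt0Pr => e e0; rewrite add0r.
have e2 : 0 < e / 2 by rewrite divr_gt0.
have [h []] := @filter_ex _ _ (Proper_dnbhs_numFieldType (0:R)) _ (filterI
  (second_difference fu fuv cuv e2) (second_difference fv fvu cvu e2)).
have -> : f (x + h *: v + h *: u) - f (x + h *: v) - (f (x + h *: u) - f x) =
  f (x + h *: u + h *: v) - f (x + h *: u) - (f (x + h *: v) - f x).
  have sym (a b c d : R) : a - b - (c - d) = a - c - (b - d) by lra.
  by rewrite [x + h *: v + _]addrAC; exact: sym.
set A := (_ / _) => H1 H2.
rewrite (E A); apply: (le_trans (ler_normB _ _)); rewrite [leRHS]splitr.
exact: lerD H2 H1.
Qed.

End normed.
End calculus_basics.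

Lemma nearT (T : topologicalType) (x : T) (P : T -> Prop) :
  (forall y, P y) -> \forall y \near x, P y.
Proof. by move=> H; exact: (filterE (F := nbhs x)). Qed.

Lemma contD {R : realType} (T : topologicalType) (f g : T -> R) :
  continuous f -> continuous g -> continuous (fun x => f x + g x).
Proof. by move=> cf cg x; exact: (cvgD (cf x) (cg x)). Qed.

Lemma contM {R : realType} (T : topologicalType) (f g : T -> R) :
  continuous f -> continuous g -> continuous (fun x => f x * g x).
Proof. by move=> cf cg x; exact: (cvgM (cf x) (cg x)). Qed.

Lemma is_derive_affine {R : realType} (a c t : R) :
  is_derive t (1 : R) (fun s : R => a + s * c) c.
Proof.
have -> : (fun s : R => a + s * c) = cst a + c *: id.
  by apply/funext => s; rewrite !fctE /= mulrC.
have H1 : is_derive t (1 : R) (cst a) 0 by exact: is_derive_cst.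
have H2 : is_derive t (1 : R) (c *: id) (c *: 1) by exact: is_deriveZ.
by apply: (is_derive_eq (is_deriveD H1 H2)); rewrite add0r -[c *: 1]/(c * 1) mulr1.
Qed.

Section class_C_theory.
Context {R : realType} {n : nat}.
Notation V := 'rV[R]_n.+1.
Implicit Types (f g : V -> R) (x y v : V) (i j : 'I_n.+1) (k : nat).

Local Notation "''e_' j" := (delta_mx ord0 j : V) (at level 8, j at level 2).

Lemma row_deltaE v : v = \sum_j v ord0 j *: 'e_ j.
Proof. exact: row_sum_delta. Qed.

Lemma is_derive_partial x f j d : is_derive x 'e_j f d -> partial j f x = d.
Proof. by move=> fd; rewrite /partial derive_val. Qed.

Lemma partial_ext f g j : (forall x, is_derive x 'e_j f (g x)) -> partial j f = g.
Proof. by move=> H; apply/funext => x; exact/is_derive_partial. Qed.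

Lemma class_C_cont k f : class_C k f -> continuous f.
Proof. by case: k => [|k] []. Qed.

Lemma class_C_is_derive k f j x : class_C k.+1 f ->
  is_derive x 'e_j f (partial j f x).
Proof. by case=> _ /(_ j)[/(_ x)/derivableP]. Qed.

Lemma class_C_partial k f j : class_C k.+1 f -> class_C k (partial j f).
Proof. by case=> _ /(_ j)[]. Qed.

Lemma class_CW k f : class_C k.+1 f -> class_C k f.
Proof.
elim: k f => [|k IH] f [cf H]; first by split.
by split => // j; have [H1 H2] := H j; split => //; exact: IH.
Qed.

Lemma class_C_le k l f : (k <= l)%N -> class_C l f -> class_C k f.
Proof.
move/subnKC <-; elim: (l - k)%N => [|m IH]; first by rewrite addn0.
by rewrite addnS => /class_CW/IH.
Qed.

Lemma class_C_intro k f (g : 'I_n.+1 -> V -> R) : continuous f ->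
  (forall j x, is_derive x 'e_j f (g j x)) -> (forall j, class_C k (g j)) ->
  class_C k.+1 f.
Proof.
move=> cf fg gC; split=> // j; split; first by move=> x; have [] := fg j x.
by rewrite (partial_ext (fg j)).
Qed.

(** The vector v is built up one coordinate at a time with [is_derive_add], using continuity of the
    partial derivative in the coordinate being added. *)
Lemma class_C1_is_derive x v f : class_C 1 f ->
  is_derive x v f (\sum_j v ord0 j * partial j f x).
Proof.
move=> fC; rewrite {1}(row_deltaE v).
elim: (index_enum _) => [|j s IH].
  by rewrite !big_nil; exact: is_derive0.
rewrite !big_cons addrC [X in is_derive _ _ _ X]addrC.
have D y : is_derive y (v ord0 j *: 'e_j) f (v ord0 j * partial j f y).
  by apply: is_deriveZv; exact: class_C_is_derive fC.
have E : 'D_(v ord0 j *: 'e_j) f = (fun y => v ord0 j * partial j f y).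
  by apply/funext => y; have H := D y; rewrite derive_val.
have -> : v ord0 j * partial j f x = 'D_(v ord0 j *: 'e_j) f x
  by have H := D x; rewrite derive_val.
apply: is_derive_add => //.
  by apply: nearT => y; have [] := D y.
rewrite E.
have c : partial j f y @[y --> x] --> partial j f x.
  exact: (class_C_cont (class_C_partial j fC)).
exact: (cvgM (cvg_cst (v ord0 j)) c).
Qed.

Lemma class_C1_derive x v f : class_C 1 f ->
  'D_v f x = \sum_j v ord0 j * partial j f x.
Proof. by move=> /(class_C1_is_derive x v) H; rewrite derive_val. Qed.

Lemma class_C2_schwarz i j f : class_C 2 f ->
  partial i (partial j f) = partial j (partial i f).
Proof.
move=> fC; apply/funext => x.
have C1 l : class_C 1 (partial l f) by exact: class_C_partial.
have D l : \forall y \near x, derivable f y 'e_l.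
  by apply: nearT => y; have [] := class_C_is_derive l y fC.
have D2 l m : \forall y \near x, derivable (partial l f) y 'e_m.
  by apply: nearT => y; have [] := class_C_is_derive m y (C1 l).
apply: (schwarz (D j) (D i) (D2 j i) (D2 i j)).
  exact: (class_C_cont (class_C_partial i (C1 j))).
exact: (class_C_cont (class_C_partial j (C1 i))).
Qed.

Lemma class_C_cst k (c : R) : class_C k (fun _ : V => c).
Proof.
elim: k c => [|k IH] c; first by split=> //; exact: cst_continuous.
apply: (@class_C_intro k _ (fun _ _ => 0)) => //.
exact: cst_continuous.
Qed.

Lemma class_CD k f g : class_C k f -> class_C k g -> class_C k (fun x => f x + g x).
Proof.
elim: k f g => [|k IH] f g fC gC.
  by split=> //; apply: contD; [exact: (class_C_cont fC)|exact: (class_C_cont gC)].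
apply: (@class_C_intro k _ (fun j x => partial j f x + partial j g x)) => [|j x|j].
- by apply: contD; [exact: (class_C_cont fC)|exact: (class_C_cont gC)].
- exact: (is_deriveD (class_C_is_derive j x fC) (class_C_is_derive j x gC)).
- by apply: IH; exact: class_C_partial.
Qed.

Lemma class_CM k f g : class_C k f -> class_C k g -> class_C k (fun x => f x * g x).
Proof.
elim: k f g => [|k IH] f g fC gC.
  by split=> //; apply: contM; [exact: (class_C_cont fC)|exact: (class_C_cont gC)].
apply: (@class_C_intro k _ (fun j x => f x * partial j g x + g x * partial j f x)) => [|j x|j].
- by apply: contM; [exact: (class_C_cont fC)|exact: (class_C_cont gC)].
- exact: (is_deriveM (class_C_is_derive j x fC) (class_C_is_derive j x gC)).
- by apply: class_CD; apply: IH; try exact: class_C_partial; exact: class_CW.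
Qed.

Lemma class_CZ k c f : class_C k f -> class_C k (fun x => c * f x).
Proof. by move=> fC; apply: class_CM => //; exact: class_C_cst. Qed.

Lemma class_CN k f : class_C k f -> class_C k (fun x => - f x).
Proof.
move=> /(class_CZ (-1)).
by under eq_fun do rewrite mulN1r.
Qed.

Lemma class_C_sum k (I : Type) (s : seq I) (P : pred I) (f : I -> V -> R) :
  (forall a, P a -> class_C k (f a)) -> class_C k (fun x => \sum_(a <- s | P a) f a x).
Proof.
move=> fC; elim: s => [|a s IH].
  by under eq_fun do rewrite big_nil; exact: class_C_cst.
under eq_fun do rewrite big_cons.
by case: (P a) (fC a) => // fa; apply: class_CD => //; exact: fa.
Qed.

Lemma class_CX k f m : class_C k f -> class_C k (fun x => f x ^+ m).
Proof.
move=> fC; elim: m => [|m IH].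
  by under eq_fun do rewrite expr0; exact: class_C_cst.
by under eq_fun do rewrite exprS; exact: class_CM.
Qed.

Lemma is_derive_coord i x v : is_derive x v (fun x : V => x ord0 i) (v ord0 i).
Proof.
suff H : 'D_v (fun x : V => x ord0 i) x = v ord0 i /\
    derivable (fun x : V => x ord0 i) x v by case: H => E D; exact: DeriveDef.
suff H : (fun h : R => h^-1 *: (((fun x : V => x ord0 i) \o shift x) (h *: v) - x ord0 i)) @ 0^'
     --> v ord0 i.
  by split; [exact: cvg_lim|apply/cvg_ex; exists (v ord0 i)].
apply: (@cvg_trans _ ((fun=> v ord0 i) @ (0 : R)^')); last exact: cvg_cst.
apply: near_eq_cvg; near=> h => /=.
rewrite !mxE addrK scalerA mulVf ?scale1r //.
by near: h; exact: nbhs_dnbhs_neq.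
Unshelve. all: by end_near. Qed.

Lemma is_derive_coord_delta i j x :
  is_derive x 'e_j (fun x : V => x ord0 i) (i == j)%:R.
Proof.
by apply: (is_derive_eq (is_derive_coord i x 'e_j)); rewrite mxE eqxx.
Qed.

Lemma class_C_coord k i : class_C k (fun x : V => x ord0 i).
Proof.
have cc : continuous (fun x : V => x ord0 i) by move=> x; exact: coord_continuous.
case: k => [|k]; first by split.
apply: (@class_C_intro k _ (fun j x => (i == j)%:R)) => [|j x|j] //.
- exact: is_derive_coord_delta.
- exact: class_C_cst.
Qed.

Lemma is_derive_translate f x y v d :
  is_derive (x + y) v f d -> is_derive x v (fun z => f (z + y)) d.
Proof.
move=> fd; apply: line_is_derive.
have -> : (fun s : R => f (x + s *: v + y)) = (fun s => f ((x + y) + s *: v)).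
  by apply/funext => s; rewrite addrAC.
by apply: is_derive_line; rewrite scale0r addr0.
Qed.

Lemma class_C_translate k f y : class_C k f -> class_C k (fun x => f (x + y)).
Proof.
have cc g : continuous g -> continuous (fun x => g (x + y)).
  move=> cg x; have h : z + y @[z --> x] --> x + y by exact: (cvgD cvg_id (cvg_cst y)).
  exact: (cvg_comp _ _ h (cg (x + y))).
elim: k f => [|k IH] f fC; first by split=> //; apply: cc; exact: class_C_cont fC.
apply: (@class_C_intro k _ (fun j x => partial j f (x + y))) => [|j x|j].
- by apply: cc; exact: class_C_cont fC.
- by apply: is_derive_translate; exact: class_C_is_derive fC.
- by apply: IH; exact: class_C_partial.
Qed.

Lemma partial_translate k f y j x : class_C k.+1 f ->
  partial j (fun z => f (z + y)) x = partial j f (x + y).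
Proof.
move=> fC; apply: is_derive_partial; apply: is_derive_translate.
exact: class_C_is_derive fC.
Qed.

Lemma continuous_bounded (f : V -> R) (M : R) : continuous f ->
  exists2 C, 0 <= C & forall x, `|x| <= M -> `|f x| <= C.
Proof.
move=> cf.
pose B := [set x : V | `|x| <= M].
have cB : compact B.
  apply: bounded_closed_compact.
    by exists M; split; [exact: num_real|move=> K MK x /= /le_trans; apply; exact: ltW].
  have -> : B = (fun x : V => `|x|) @^-1` [set r : R | r <= M] by [].
  apply: closed_comp; last exact: closed_le.
  by move=> x _; exact: norm_continuous.
have [C [_ HC]] := compact_bounded (continuous_compact (continuous_subspaceT cf) cB).
exists (`|C| + 1) => [|x xM]; first by rewrite addr_ge0.
apply: (HC (`|C| + 1)); last by exists x.
by rewrite ltr_pwDr// ler_norm.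
Qed.

End class_C_theory.

Lemma derive_component {R : realType} (w : 'rV[R]_3 -> 'rV[R]_3) (x v : 'rV[R]_3) i :
  (forall j, class_C 1 (component w j)) ->
  ('D_v w x) ord0 i = \sum_k v ord0 k * partial k (component w i) x.
Proof.
move=> wC; rewrite derive_mx ?mxE.
  exact: class_C1_derive (wC i).
apply/derivable_mxP => a j; rewrite [a]ord1.
by have [] := class_C1_is_derive x v (wC j).
Qed.

(** * Homogeneous polynomials and polynomial solutions *)

Section partial_rules.
Context {R : realType} {n : nat}.
Notation V := 'rV[R]_n.+1.
Implicit Types (f g : V -> R) (x : V) (i j : 'I_n.+1) (k : nat).

Lemma partialD f g j : class_C 1 f -> class_C 1 g ->
  partial j (fun x => f x + g x) = (fun x => partial j f x + partial j g x).
Proof.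
move=> fC gC; apply: partial_ext => x.
exact: (is_deriveD (class_C_is_derive j x fC) (class_C_is_derive j x gC)).
Qed.

Lemma partialM f g j : class_C 1 f -> class_C 1 g ->
  partial j (fun x => f x * g x) = (fun x => f x * partial j g x + g x * partial j f x).
Proof.
move=> fC gC; apply: partial_ext => x.
exact: (is_deriveM (class_C_is_derive j x fC) (class_C_is_derive j x gC)).
Qed.

Lemma partial_cst (c : R) j : partial j (fun _ : V => c) = (fun=> 0).
Proof. by apply: partial_ext => x; exact: is_derive_cst. Qed.

Lemma partialZ c f j : class_C 1 f ->
  partial j (fun x => c * f x) = (fun x => c * partial j f x).
Proof.
move=> fC; rewrite partialM ?partial_cst//; last exact: class_C_cst.
by apply/funext => x; rewrite mulr0 addr0.
Qed.

Lemma partial_sum (I : Type) (s : seq I) (f : I -> V -> R) j :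
  (forall a, class_C 1 (f a)) ->
  partial j (fun x => \sum_(a <- s) f a x) = (fun x => \sum_(a <- s) partial j (f a) x).
Proof.
move=> fC; elim: s => [|a s IH].
  under eq_fun do rewrite big_nil; rewrite partial_cst.
  by apply/funext => x; rewrite big_nil.
under eq_fun do rewrite big_cons.
rewrite partialD ?IH//; last exact: class_C_sum.
by apply/funext => x; rewrite big_cons.
Qed.

Lemma partial_coord i j : partial j (fun x : V => x ord0 i) = (fun=> (i == j)%:R).
Proof. by apply: partial_ext => x; exact: is_derive_coord_delta. Qed.

Lemma class_C_dot k : class_C k (fun x : V => dot x x).
Proof. by apply: class_C_sum => i _; apply: class_CM; exact: class_C_coord. Qed.

Lemma partial_dot j : partial j (fun x : V => dot x x) = (fun x => 2 * x ord0 j).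
Proof.
rewrite partial_sum; last by move=> i; apply: class_CM; exact: class_C_coord.
apply/funext => x; rewrite (bigD1 j)//= big1 => [|i ij].
  rewrite partialM; try exact: class_C_coord.
  by rewrite partial_coord eqxx addr0 /= mulr1n; ring.
rewrite partialM; try exact: class_C_coord.
by rewrite partial_coord (negPf ij) !mulr0 addr0.
Qed.

Lemma laplacian_dotM f x : class_C 2 f ->
  laplacian (fun x => dot x x * f x) x =
  n.+1.*2%:R * f x + 4 * (\sum_j x ord0 j * partial j f x) + dot x x * laplacian f x.
Proof.
move=> fC; have fC1 := class_CW fC.
rewrite /laplacian.
transitivity (\sum_(j < n.+1)
    (2 * f x + 4 * (x ord0 j * partial j f x) + dot x x * partial j (partial j f) x)).
  apply: eq_bigr => j _.
  rewrite partialM//; last exact: class_C_dot.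
  rewrite partial_dot partialD; first last.
  - by apply: class_CM => //; apply: class_CZ; exact: class_C_coord.
  - by apply: class_CM; [exact: class_C_dot|exact: class_C_partial].
  rewrite partialM; [|exact: class_C_dot|exact: class_C_partial].
  rewrite partialM//; last by apply: class_CZ; exact: class_C_coord.
  rewrite partialZ; last exact: class_C_coord.
  by rewrite partial_dot partial_coord eqxx /= mulr1n; ring.
rewrite !big_split/= sumr_const card_ord -!mulr_sumr.
by congr (_ + _ + _); rewrite -[LHS]mulr_natl mulrA -muln2 natrM.
Qed.

Lemma laplacianD f g : class_C 2 f -> class_C 2 g ->
  laplacian (fun x => f x + g x) = (fun x => laplacian f x + laplacian g x).
Proof.
move=> fC gC; apply/funext => x; rewrite /laplacian -big_split; apply: eq_bigr => j _.
rewrite partialD; try exact: class_CW.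
by rewrite partialD//; exact: class_C_partial.
Qed.

Lemma laplacianZ c f : class_C 2 f ->
  laplacian (fun x => c * f x) = (fun x => c * laplacian f x).
Proof.
move=> fC; apply/funext => x; rewrite /laplacian mulr_sumr; apply: eq_bigr => j _.
rewrite partialZ; last exact: class_CW.
by rewrite partialZ//; exact: class_C_partial.
Qed.

Lemma class_C_laplacian k f : class_C k.+2 f -> class_C k (laplacian f).
Proof.
by move=> fC; apply: class_C_sum => j _; do 2 apply: class_C_partial.
Qed.

Lemma laplacian_partial i f : class_C 3 f ->
  laplacian (partial i f) = partial i (laplacian f).
Proof.
move=> fC; rewrite /laplacian partial_sum; last first.
  by move=> j; do 2 apply: class_C_partial.
apply/funext => x; apply: eq_bigr => j _.
rewrite (class_C2_schwarz j i (class_CW fC)).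
by rewrite (class_C2_schwarz j i (class_C_partial j fC)).
Qed.

End partial_rules.

Section homogeneous.
Context {R : realType}.
Notation V := 'rV[R]_3.
Implicit Types (f g : V -> R) (x : V) (k : nat).

(** Homogeneous polynomials in a form suited to structural induction; the equivalence with
    [homogeneous_poly] is proved below. [hpoly_zero] puts 0 in every degree, so that differentiation
    may lower the degree to [k.-1] also when k = 0. *)
Inductive hpoly : nat -> (V -> R) -> Prop :=
| hpoly_cst c : hpoly 0 (fun=> c)
| hpoly_zero k : hpoly k (fun=> 0)
| hpolyD k f g : hpoly k f -> hpoly k g -> hpoly k (fun x => f x + g x)
| hpolyX k i f : hpoly k f -> hpoly k.+1 (fun x => x ord0 i * f x).

Lemma hpolyZ k c f : hpoly k f -> hpoly k (fun x => c * f x).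
Proof.
elim=> [a|l|l g h _ Hg _ Hh|l i g _ Hg].
- exact: (hpoly_cst (c * a)).
- by under eq_fun do rewrite mulr0; exact: hpoly_zero.
- by under eq_fun do rewrite mulrDr; exact: hpolyD.
- by under eq_fun do rewrite mulrCA; exact: hpolyX.
Qed.

Lemma hpoly_sum k (I : Type) (s : seq I) (f : I -> V -> R) :
  (forall i, hpoly k (f i)) -> hpoly k (fun x => \sum_(i <- s) f i x).
Proof.
move=> fk; elim: s => [|a s IH].
  by under eq_fun do rewrite big_nil; exact: hpoly_zero.
by under eq_fun do rewrite big_cons; exact: hpolyD.
Qed.

Lemma hpoly_dotM k f : hpoly k f -> hpoly k.+2 (fun x => dot x x * f x).
Proof.
move=> fk; under eq_fun do rewrite /dot mulr_suml.
apply: hpoly_sum => i; under eq_fun do rewrite -mulrA.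
by do 2 apply: hpolyX.
Qed.

Lemma hpoly_class_C m k f : hpoly k f -> class_C m f.
Proof.
elim=> [c|l|l g h _ Hg _ Hh|l i g _ Hg].
- exact: class_C_cst.
- exact: class_C_cst.
- exact: class_CD.
- by apply: class_CM => //; exact: class_C_coord.
Qed.

Lemma hpoly0E f : hpoly 0 f -> exists c, f = (fun=> c).
Proof.
suff H k g : hpoly k g -> k = 0%N -> exists c, g = (fun=> c) by move/H; exact.
elim=> // [c _|l _|l h1 h2 _ Hg _ Hh l0].
- by exists c.
- by exists 0.
- by have [a ->] := Hg l0; have [b ->] := Hh l0; exists (a + b).
Qed.

Lemma hpoly_partial k f j : hpoly k f -> hpoly k.-1 (partial j f).
Proof.
elim=> [c|l|l g h Hg IHg Hh IHh|l i g Hg IHg].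
- rewrite partial_cst; exact: hpoly_zero.
- rewrite partial_cst; exact: hpoly_zero.
- by rewrite partialD; [exact: hpolyD| |]; apply: hpoly_class_C; eassumption.
- rewrite partialM; [|exact: class_C_coord|exact: hpoly_class_C Hg].
  rewrite partial_coord; apply: hpolyD; last first.
    by under eq_fun do rewrite mulrC; exact: hpolyZ.
  case: l Hg IHg => [Hg _|l _ IHg]; last exact: hpolyX.
  have [c ->] := hpoly0E Hg; rewrite partial_cst.
  by under eq_fun do rewrite mulr0; exact: hpoly_zero.
Qed.

Lemma hpoly_euler k f x : hpoly k f -> \sum_j x ord0 j * partial j f x = k%:R * f x.
Proof.
elim=> [c|l|l g h Hg IHg Hh IHh|l i g Hg IHg].
- by rewrite mul0r big1// => j _; rewrite partial_cst mulr0.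
- by rewrite mulr0 big1// => j _; rewrite partial_cst mulr0.
- rewrite mulrDr -IHg -IHh -big_split; apply: eq_bigr => j _.
  by rewrite partialD ?mulrDr//; apply: hpoly_class_C; eassumption.
- under eq_bigr => j _.
    rewrite partialM; [|exact: class_C_coord|exact: hpoly_class_C Hg].
    rewrite partial_coord mulrDr mulrCA.
    over.
  rewrite big_split/= -mulr_sumr IHg (bigD1 i)//= big1 => [|j ji].
    by rewrite eqxx -natr1 /= mulr1n; ring.
  by rewrite eq_sym (negPf ji) !mulr0.
Qed.

Lemma hpoly_scale k f t x : hpoly k f -> f (t *: x) = t ^+ k * f x.
Proof.
elim=> [c|l|l g h _ IHg _ IHh|l i g _ IHg].
- by rewrite expr0 mul1r.
- by rewrite mulr0.
- by rewrite IHg IHh mulrDr.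
- by rewrite IHg mxE exprS; ring.
Qed.

Lemma hpoly_pred0 k f x : (k < 1)%N -> hpoly k f -> forall j, partial j f x = 0.
Proof.
case: k => // _ fk j; have [c ->] := hpoly0E fk.
by rewrite partial_cst.
Qed.

(** Compensates the truncated subtraction in [k.-2]: for k < 2 second derivatives are formally of
    degree 0, but they vanish. *)
Lemma hpoly_partial2_small k f i j : (k < 2)%N -> hpoly k f ->
  partial i (partial j f) = (fun=> 0).
Proof.
move=> k2 fk; apply/funext => x.
apply: (@hpoly_pred0 k.-1); last exact: hpoly_partial.
by case: k k2 fk => [|[|]].
Qed.

Lemma hpoly_prodX k l (i : 'I_3) f : hpoly k f -> hpoly (l + k) (fun x => x ord0 i ^+ l * f x).
Proof.
move=> fk; elim: l => [|l IH]; first by under eq_fun do rewrite expr0 mul1r.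
by under eq_fun do rewrite exprS -mulrA; exact: hpolyX.
Qed.

Lemma hpoly_monomial (a : 'I_3 -> nat) c :
  hpoly (\sum_i a i) (fun x : V => c * \prod_i x ord0 i ^+ a i).
Proof.
apply: hpolyZ; elim: (index_enum _) => [|i s IH].
  have -> : (fun x : V => \prod_(j <- [::]) x ord0 j ^+ a j) = (fun=> 1).
    by apply/funext => x; rewrite big_nil.
  by rewrite big_nil; exact: hpoly_cst.
have -> : (fun x : V => \prod_(j <- i :: s) x ord0 j ^+ a j) =
  (fun x => x ord0 i ^+ a i * \prod_(j <- s) x ord0 j ^+ a j).
  by apply/funext => x; rewrite big_cons.
by rewrite big_cons; exact: hpoly_prodX.
Qed.

Lemma homogeneous_hpoly k f : homogeneous_poly k f -> hpoly k f.
Proof.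
move=> [c fE]; have -> : f = (fun x => \sum_(a : {ffun 'I_3 -> 'I_k.+1})
    if (\sum_i a i == k)%N then c a * \prod_i x ord0 i ^+ a i else 0).
  by apply/funext => x; rewrite fE big_mkcond.
apply: hpoly_sum => a; case: eqP => [ak|_]; last exact: hpoly_zero.
by have := hpoly_monomial (fun i => a i) (c a); rewrite ak.
Qed.

Lemma homogeneous_monomial k (a : 'I_3 -> nat) c : (\sum_i a i = k)%N ->
  homogeneous_poly k (fun x : V => c * \prod_i x ord0 i ^+ a i).
Proof.
move=> ak; have ale i : (a i < k.+1)%N by rewrite ltnS -ak (bigD1 i)//= leq_addr.
pose b : {ffun 'I_3 -> 'I_k.+1} := [ffun i => inord (a i)].
have bE i : b i = a i :> nat by rewrite ffunE inordK.
exists (fun b' => if b' == b then c else 0) => x.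
rewrite (bigD1 b)/=; last by apply/eqP; apply: etrans ak; exact: eq_bigr.
rewrite eqxx [X in _ + X]big1 ?addr0 => [|d /andP[_ /negPf ->]]; last by rewrite mul0r.
by congr (_ * _); apply: eq_bigr => i _; rewrite bE.
Qed.

Lemma hpoly_homogeneous k f : hpoly k f -> homogeneous_poly k f.
Proof.
have H0 l : @homogeneous_poly R l (fun=> 0).
  by exists (fun=> 0) => x; rewrite big1// => a _; rewrite mul0r.
have HD l g h : @homogeneous_poly R l g -> homogeneous_poly l h ->
    homogeneous_poly l (fun x => g x + h x).
  move=> [c gE] [d hE]; exists (fun a => c a + d a) => x.
  by rewrite gE hE -big_split; apply: eq_bigr => a _; rewrite mulrDl.
have HS l (I : Type) (s : seq I) (P : pred I) (g : I -> V -> R) :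
    (forall i, P i -> homogeneous_poly l (g i)) ->
    homogeneous_poly l (fun x => \sum_(i <- s | P i) g i x).
  move=> gl; elim: s => [|i s IH].
    by under eq_fun do rewrite big_nil; exact: H0.
  under eq_fun do rewrite big_cons.
  by case: (P i) (gl i) => // gi; apply: HD => //; exact: gi.
elim=> [c|//|l g h _ Hg _ Hh|l i g _ [c gE]]; last 1 first.
- have -> : (fun x : V => x ord0 i * g x) =
    (fun x => \sum_(a : {ffun 'I_3 -> 'I_l.+1} | (\sum_i a i)%N == l)
      c a * \prod_j x ord0 j ^+ ((i == j) + a j)).
    apply/funext => x; rewrite gE mulr_sumr; apply: eq_bigr => a _.
    rewrite mulrCA; congr (_ * _); rewrite [RHS](eq_bigr (fun j => x ord0 j ^+ (i == j) * x ord0 j ^+ a j)); last by move=> j _; rewrite exprD.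
    rewrite big_split/=; congr (_ * _); rewrite (bigD1 i)//= eqxx expr1 big1 ?mulr1// => j ji.
    by rewrite eq_sym (negPf ji) expr0.
  apply: HS => a /eqP al; apply: homogeneous_monomial.
  rewrite big_split/= al -[RHS]add1n; congr (_ + _)%N.
  by rewrite (bigD1 i)//= eqxx big1// => j ji; rewrite eq_sym (negPf ji).
- have s0 : (\sum_(i < 3) (fun _ : 'I_3 => 0) i = 0)%N by rewrite big1.
  have := homogeneous_monomial c s0.
  congr homogeneous_poly; apply/funext => x.
  by rewrite big1 ?mulr1// => j _; rewrite expr0.
- exact: HD.
Qed.

End homogeneous.

Section lame_constants.
Context {R : realType}.
Variables (lambda mu : R).
Hypotheses (mu_gt0 : 0 < mu) (lame : 0 < 3 * lambda + 2 * mu).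

Lemma lame_pos : 0 < lambda + 2 * mu.
Proof. by move: mu_gt0 lame => m0 l0; lra. Qed.

Lemma Lambda_den_neq0 k : lambda * (k%:R - 1) + mu * (3 * k%:R - 2) != 0.
Proof.
case: k => [|k].
  have H := lame_pos; apply: ltr0_neq0; rewrite -[0%:R]/(0:R).
  have -> : lambda * (0 - 1) + mu * (3 * 0 - 2) = - (lambda + 2 * mu) by ring.
  by rewrite oppr_lt0.
apply: lt0r_neq0; rewrite -natr1.
(* A combination of 3 lambda + 2 mu and mu with nonnegative coefficients, the second one
   positive. *)
have -> : lambda * (k%:R + 1 - 1) + mu * (3 * (k%:R + 1) - 2) =
  (k%:R / 3) * (3 * lambda + 2 * mu) + mu * (1 + (7 / 3) * k%:R) by field.
have k0 : 0 <= k%:R :> R by [].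
apply: ltr_wpDl; first by rewrite mulr_ge0 ?divr_ge0// ltW.
by rewrite mulr_gt0// ltr_pwDl// mulr_ge0.
Qed.

Notation V := 'rV[R]_3.

Lemma fourk_neq0 k : 4 * k%:R - 2 != 0 :> R.
Proof.
apply/eqP => H; have : (4 * k%:R : R) = 2%:R by lra.
by rewrite -natrM => /eqP; rewrite eqr_nat => /eqP; lia.
Qed.

(** For f harmonic of degree k - 2 the Leibniz rule and Euler's relation give the factor 6 + 4 (k -
    2). The last hypothesis covers k < 2, where [k.-2] is truncated. *)
Lemma laplacian_dotM_hpoly k (f : V -> R) x : hpoly k.-2 f ->
  (forall x, laplacian f x = 0) -> ((k < 2)%N -> f = (fun=> 0)) ->
  laplacian (fun x => dot x x * f x) x = (4 * k%:R - 2) * f x.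
Proof.
move=> fk fh f0; rewrite laplacian_dotM; last exact: hpoly_class_C fk.
rewrite (hpoly_euler _ fk) fh.
case: k fk f0 => [|[|k]] fk f0; try by rewrite f0//; ring.
have -> : k.+2%:R = k%:R + 2 :> R by rewrite -natrD addn2.
by rewrite (_ : _.*2%:R = 6 :> R)//=; ring.
Qed.

Lemma elasticityE (w : V -> V) x i : elasticity lambda mu w x ord0 i =
  mu * laplacian (component w i) x + (lambda + mu) * partial i (divergence w) x.
Proof. by rewrite /elasticity !mxE. Qed.

Section kelvin_vectors.
Variables (k : nat) (f : V -> R) (j : 'I_3).
Hypotheses (fk : hpoly k f) (fh : forall x, laplacian f x = 0).

Let a i := partial i (partial j f).
Let L := Lambda lambda mu k.
Let w x : V := f x *: delta_mx ord0 j + (L * dot x x) *: grad (partial j f) x.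

Let ak i : hpoly k.-2 (a i). Proof. by do 2 apply: hpoly_partial. Qed.

Let ah i x : laplacian (a i) x = 0.
Proof.
rewrite /a laplacian_partial; last exact: hpoly_class_C (hpoly_partial j fk).
rewrite laplacian_partial; last exact: hpoly_class_C fk.
have -> : laplacian f = (fun=> 0) by apply/funext.
by rewrite !partial_cst.
Qed.

Let a0 i : (k < 2)%N -> a i = (fun=> 0).
Proof. by move=> k2; exact: hpoly_partial2_small fk. Qed.

Let wE i : component w i = (fun x => (i == j)%:R * f x + L * (dot x x * a i x)).
Proof. by apply/funext => x; rewrite /component !mxE eqxx /= mulrC mulrA. Qed.

Lemma kelvin_smooth m i : class_C m (component w i).
Proof.
rewrite wE; apply: class_CD; apply: class_CZ; first exact: hpoly_class_C fk.
by apply: class_CM; [exact: class_C_dot|exact: hpoly_class_C (ak i)].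
Qed.

(** The functions [a i] have divergence d_j (Lap f) = 0, and Euler's relation for d_j f, of degree k
    - 1, evaluates sum_i x_i a_i. *)
Let divw : divergence w = (fun x => (1 + 2 * L * (k%:R - 1)) * partial j f x).
Proof.
apply/funext => x; rewrite /divergence.
transitivity (\sum_(i < 3) (i == j)%:R * partial i f x +
    2 * L * (\sum_i x ord0 i * a i x) + L * (dot x x * \sum_i partial i (a i) x)).
  rewrite !mulr_sumr -2!big_split/=; apply: eq_bigr => i _; rewrite wE.
  have aC m : class_C m (a i) by exact: hpoly_class_C (ak i).
  have fC m : class_C m f by exact: hpoly_class_C fk.
  have dC : class_C 1 (fun x : V => dot x x * a i x).
    by apply: class_CM => //; exact: class_C_dot.
  rewrite partialD; [|exact: class_CZ|exact: class_CZ].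
  rewrite (partialZ _ _ (fC 1)) (partialZ _ _ dC) (partialM _ (class_C_dot _) (aC 1)).
  by rewrite partial_dot; ring.
have -> : \sum_i partial i (a i) x = 0.
  have := laplacian_partial j (hpoly_class_C 3 fk).
  move/(congr1 (fun g => g x)); rewrite /laplacian.
  have -> : (fun x => \sum_j partial j (partial j f) x) = (fun=> 0) by apply/funext.
  by rewrite partial_cst.
have -> : \sum_i x ord0 i * a i x = (k%:R - 1) * partial j f x.
  rewrite (hpoly_euler x (hpoly_partial j fk)).
  case: k fk => [|l] fl; first by rewrite (hpoly_pred0 _ _ fl)// !mulr0.
  by rewrite -natr1 addrK.
rewrite (bigD1 j)//= big1 => [|i /negPf->]; last by rewrite mul0r.
by rewrite eqxx /= mulr1n; ring.
Qed.

(** All terms are multiples of d_i d_j f, with total coefficient mu L (4 k - 2) + (lambda + mu) (1 +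
    2 L (k - 1)); Lambda_k is the value of L that makes it vanish. *)
Lemma kelvin_elasticity x : elasticity lambda mu w x = 0.
Proof.
apply/rowP => i; rewrite elasticityE wE divw mxE.
have aC m : class_C m (a i) by exact: hpoly_class_C (ak i).
have fC m : class_C m f by exact: hpoly_class_C fk.
have dC m : class_C m (fun x : V => dot x x * a i x).
  by apply: class_CM => //; exact: class_C_dot.
rewrite (laplacianD (class_CZ _ (fC 2)) (class_CZ _ (dC 2))).
rewrite (laplacianZ _ (fC 2)) (laplacianZ _ (dC 2)) fh.
rewrite (partialZ _ _ (class_C_partial j (fC 2))).
rewrite (laplacian_dotM_hpoly x (ak i) (ah i) (@a0 i)).
have := Lambda_den_neq0 k; rewrite -/(a i) /L /Lambda => nz.
field; exact: nz.
Qed.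

End kelvin_vectors.

Section polynomial_solution_space.
Variables (k : nat) (P : 'I_3 -> V -> R).
Hypotheses (Pk : forall i, hpoly k (P i))
  (EP : forall x, elasticity lambda mu (fun x => \row_i P i x) x = 0).

Let PC i m : class_C m (P i). Proof. exact: hpoly_class_C (Pk i). Qed.

Let compP i : component (fun x : V => \row_i P i x) i = P i.
Proof. by apply/funext => x; rewrite /component mxE. Qed.

Let D : V -> R := fun x => \sum_i partial i (P i) x.

Let divP : divergence (fun x : V => \row_i P i x) = D.
Proof. by apply/funext => x; apply: eq_bigr => i _; rewrite compP. Qed.

Let Dk : hpoly k.-1 D. Proof. by apply: hpoly_sum => i; exact: hpoly_partial. Qed.

Let DC m : class_C m D. Proof. exact: hpoly_class_C Dk. Qed.

Let c : R := (lambda + mu) / mu.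

Let lapP i : laplacian (P i) = (fun x => - c * partial i D x).
Proof.
apply/funext => x; have /rowP/(_ i) := EP x.
rewrite elasticityE compP divP mxE => H.
have {}H : mu * laplacian (P i) x = - ((lambda + mu) * partial i D x).
  by apply/eqP; rewrite -subr_eq0 opprK H.
by apply: (mulfI (lt0r_neq0 mu_gt0)); rewrite H /c; field; rewrite lt0r_neq0.
Qed.

(** Taking the divergence of the equation gives (1 + c) Lap D = 0, and 1 + c = (lambda + 2 mu) / mu
    is positive. *)
Let lapD x : laplacian D x = 0.
Proof.
have E : laplacian D = (fun x => - c * laplacian D x).
  rewrite {1}/laplacian; apply/funext => y.
  rewrite /D; under eq_bigr => j _.
    rewrite partial_sum; last by move=> i; exact: class_C_partial (PC _ 2).
    rewrite partial_sum; last by move=> i; do 2 apply: class_C_partial; exact: PC.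
    over.
  rewrite exchange_big/=.
  transitivity (\sum_i partial i (laplacian (P i)) y).
    apply: eq_bigr => i _.
    by rewrite -laplacian_partial.
  rewrite [in RHS]/laplacian mulr_sumr; apply: eq_bigr => i _.
  by rewrite lapP partialZ//; exact: class_C_partial (DC 2).
have {}E : laplacian D x = - c * laplacian D x by rewrite {1}E.
have nz : 1 + c != 0.
  have -> : 1 + c = (lambda + 2 * mu) / mu.
    by rewrite /c; field; rewrite lt0r_neq0.
  by rewrite mulf_neq0 ?invr_eq0// lt0r_neq0// lame_pos.
apply: (mulfI nz); rewrite mulr0 mulrDl mul1r {1}E.
by rewrite mulNr addNr.
Qed.

(** Since Lap P_i = - c d_i D, where d_i D is harmonic of degree k - 2, subtracting |x|^2 [G i] from
    P_i leaves a harmonic polynomial [H i]. The divisor 4 k - 2 is the factor in Lap (|x|^2 d_i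
    D). *)
Let G i : V -> R := fun x => (- c / (4 * k%:R - 2)) * partial i D x.
Let H i : V -> R := fun x => P i x - dot x x * G i x.

Let Gk i : hpoly k.-2 (G i). Proof. by apply: hpolyZ; exact: hpoly_partial Dk. Qed.

Let D0 i : (k < 2)%N -> partial i D = (fun=> 0).
Proof.
move=> k2; rewrite /D partial_sum; last by move=> j; exact: class_C_partial (PC _ 2).
apply/funext => x; rewrite big1// => j _.
by rewrite (hpoly_partial2_small _ _ k2 (Pk j)).
Qed.

Let G0 i : (k < 2)%N -> G i = (fun=> 0).
Proof. by move=> k2; apply/funext => x; rewrite /G D0// mulr0. Qed.

Let lapG i x : laplacian (G i) x = 0.
Proof.
rewrite laplacianZ; last exact: class_C_partial (DC 3).
rewrite laplacian_partial//.
have -> : laplacian D = (fun=> 0) by apply/funext.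
by rewrite partial_cst mulr0.
Qed.

Let Hk i : hpoly k (H i).
Proof.
case: (ltnP k 2) => k2.
  by rewrite /H (G0 _ k2); under eq_fun do rewrite mulr0 subr0.
have -> : H i = (fun x => P i x + (-1) * (dot x x * G i x)).
  by apply/funext => x; rewrite /H mulN1r.
apply: hpolyD => //; apply: hpolyZ.
have := hpoly_dotM (Gk i); by case: k k2 => [|[|]].
Qed.

Let Hh i x : laplacian (H i) x = 0.
Proof.
have -> : H i = (fun x => P i x + (-1) * (dot x x * G i x)).
  by apply/funext => y; rewrite /H mulN1r.
have GC : class_C 2 (fun x : V => dot x x * G i x).
  by apply: class_CM; [exact: class_C_dot|exact: hpoly_class_C (Gk i)].
rewrite (laplacianD (PC i 2) (class_CZ _ GC)) (laplacianZ _ GC).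
rewrite (laplacian_dotM_hpoly x (Gk i) (lapG i) (@G0 i)).
by rewrite lapP /G; field; exact: fourk_neq0.
Qed.

Let divH : (fun x => \sum_i partial i (H i) x) =
  (fun x => (1 + 2 * c * (k%:R - 1) / (4 * k%:R - 2)) * D x).
Proof.
apply/funext => x.
have GC i m : class_C m (G i) by exact: hpoly_class_C (Gk i).
transitivity (\sum_(i < 3) partial i (P i) x + (-2) * (\sum_i x ord0 i * G i x) +
   - dot x x * \sum_i partial i (G i) x).
  rewrite !mulr_sumr -2!big_split/=; apply: eq_bigr => i _.
  have -> : H i = (fun x => P i x + (-1) * (dot x x * G i x)).
    by apply/funext => y; rewrite /H mulN1r.
  have dC : class_C 1 (fun x : V => dot x x * G i x).
    by apply: class_CM => //; exact: class_C_dot.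
  rewrite (partialD _ (PC i 1) (class_CZ _ dC)).
  rewrite (partialZ _ _ dC) (partialM _ (class_C_dot _) (GC i 1)).
  by rewrite partial_dot; ring.
have -> : \sum_i partial i (G i) x = 0.
  transitivity (\sum_i (- c / (4 * k%:R - 2)) * partial i (partial i D) x).
    by apply: eq_bigr => i _; rewrite partialZ//; exact: class_C_partial (DC 2).
  by rewrite -mulr_sumr -/(laplacian D x) lapD mulr0.
have -> : \sum_i x ord0 i * G i x = (- c / (4 * k%:R - 2)) * ((k%:R - 1) * D x).
  transitivity ((- c / (4 * k%:R - 2)) * \sum_i x ord0 i * partial i D x).
    by rewrite mulr_sumr; apply: eq_bigr => i _; rewrite /G mulrCA.
  congr (_ * _); rewrite (hpoly_euler x Dk).
  case: k Pk => [|l] Pl; last by rewrite -natr1 addrK.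
  rewrite /D big1 ?mulr0// => i _; exact: (hpoly_pred0 _ _ (Pl i)).
rewrite -/(D x); field; exact: fourk_neq0.
Qed.

(** As div H is a nonzero multiple of D = div P, the correction |x|^2 G is a multiple of |x|^2 grad
    (div H), and the constants combine to Lambda_k. *)
Let PH i x : P i x = H i x + Lambda lambda mu k * dot x x *
  partial i (fun x => \sum_j partial j (H j) x) x.
Proof.
rewrite divH partialZ//.
rewrite /H -[LHS]addr0 -addrA; congr (_ + _).
rewrite /G; have nz := Lambda_den_neq0 k; have nz4 := fourk_neq0 k.
have nzm := lt0r_neq0 mu_gt0.
rewrite /Lambda /c; field; rewrite nz4 nzm; exact: nz.
Qed.

(** The expression H + Lambda_k |x|^2 grad (div H) is linear in H, and H = omega_ks e_j gives a
    member of the system; so it suffices to expand the components of the harmonic part H in the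
    basis of harmonic polynomials. *)
Lemma polynomial_solution_comb (omega : forall k, 'I_(k.*2.+1) -> V -> R) :
  harmonic_basis (omega k) ->
  exists c : 'I_(k.*2.+1) -> 'I_3 -> R, forall x,
    \row_i P i x = \sum_s \sum_j c s j *:
      poly_solution lambda mu omega (existT _ k (s, j)) x.
Proof.
case=> omega_harm _ span.
have Hharm i : harmonic_poly k (H i).
  by split; [exact: hpoly_homogeneous|exact: Hh].
have /choice[b bE] : forall j : 'I_3, exists b : 'I_(k.*2.+1) -> R,
   forall x, H j x = \sum_s b s * omega k s x.
  by move=> j; exact: span.
exists (fun s j => b j s) => x; apply/rowP => i.
have oC s m : class_C m (omega k s).
  exact: hpoly_class_C (homogeneous_hpoly (omega_harm s).1).
have HE j : H j = (fun x => \sum_s b j s * omega k s x) by apply/funext.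
have HjE j : partial j (H j) = (fun x => \sum_s b j s * partial j (omega k s) x).
  rewrite HE partial_sum; last first.
    by move=> s; exact: (class_CZ _ (oC s 1)).
  by apply/funext => y; apply: eq_bigr => s _; rewrite (partialZ _ _ (oC s 1)).
rewrite mxE PH summxE.
have -> : partial i (fun x => \sum_j partial j (H j) x) x =
   \sum_s \sum_j b j s * partial i (partial j (omega k s)) x.
  rewrite partial_sum; last first.
    by move=> j; exact: class_C_partial (hpoly_class_C 2 (Hk j)).
  rewrite exchange_big/=; apply: eq_bigr => j _.
  rewrite HjE partial_sum; last first.
    by move=> s; exact: (class_CZ _ (class_C_partial j (oC s 2))).
  by apply: eq_bigr => s _; rewrite (partialZ _ _ (class_C_partial j (oC s 2))).
rewrite bE mulr_sumr -big_split/=; apply: eq_bigr => s _.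
rewrite summxE mulr_sumr.
transitivity (\sum_j ((i == j)%:R * (b j s * omega k s x) + Lambda lambda mu k * dot x x *
    (b j s * partial i (partial j (omega k s)) x))).
  rewrite big_split/=; congr (_ + _).
  rewrite (bigD1 i)//= eqxx mul1r big1 ?addr0// => j.
  by rewrite eq_sym => /negPf ->; rewrite mul0r.
by apply: eq_bigr => j _; rewrite !mxE eqxx /=; ring.
Qed.

End polynomial_solution_space.
End lame_constants.

(** * Lebesgue measure on R^3 and integration by parts *)

Section borel_rV.
Context {R : realType} {n : nat}.
Notation V := 'rV[R]_n.+1.
Implicit Types (x y : V) (A : set V) (f : V -> R).

Lemma rV_norm_le x r : 0 <= r -> (`|x| <= r) = [forall i, `|x ord0 i| <= r].
Proof.
move=> r0; rewrite {1}/Num.Def.normr/= mx_normrE; apply/idP/forallP => [H i|H].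
  by apply: le_trans H; exact: (le_bigmax _ (fun ij => `|x ij.1 ij.2|) (ord0, i)).
by apply: bigmax_le => // -[a i] _; rewrite [a]ord1; exact: H.
Qed.

Lemma coord_le_norm x i : `|x ord0 i| <= `|x|.
Proof. by have := lexx `|x|; rewrite rV_norm_le// => /forallP. Qed.

Lemma rV_norm_lt x r : 0 < r -> (forall i, `|x ord0 i| < r) -> `|x| < r.
Proof.
move=> r0 H; rewrite /Num.Def.normr/= mx_normrE.
by apply/bigmax_ltP; split => // -[a i] _; rewrite [a]ord1; exact: H.
Qed.

Lemma measurable_coord i : measurable_fun [set: V] (fun x : V => x ord0 i : measurableTypeR R).
Proof.
move=> _ B mB; rewrite setTI; apply: sub_sigma_algebra.
by rewrite -bigcup_seq; exists i; [rewrite /= mem_index_enum|exists B => //; rewrite setTI].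
Qed.

Lemma measurable_box (q : 'I_n.+1 -> R) (r : R) :
  measurable [set x : V | forall i, `|x ord0 i - q i| < r].
Proof.
have -> : [set x : V | forall i, `|x ord0 i - q i| < r] =
    \bigcap_(i in [set: 'I_n.+1]) ((fun x : V => x ord0 i : measurableTypeR R) @^-1` ball (q i) r).
  apply/seteqP; split=> x /= H i; last first.
    by have := H i I; rewrite /= -ball_normE/= distrC.
  by move=> _; rewrite -ball_normE/= distrC.
apply: fin_bigcap_measurable => // i _.
rewrite -[X in measurable X]setTI; apply: measurable_coord => //.
by apply: open_measurable; exact: ball_open.
Qed.

(** The sigma-algebra is the one generated by the coordinates, so an open set is written as a
    countable union of boxes with rational centre and radius 1/(m+1). *)
Lemma open_measurable_rV A : open A -> measurable A.
Proof.
move=> oA.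
pose box (qm : 'rV[rat]_n.+1 * nat) : set V :=
  [set x : V | forall i, `|x ord0 i - ratr (qm.1 ord0 i)| < qm.2.+1%:R^-1].
pose F qm := if `[< box qm `<=` A >] then box qm else set0.
have -> : A = \bigcup_qm F qm.
  apply/seteqP; split => [x Ax|x [qm _]]; last first.
    by rewrite /F; case: asboolP => // qmA /qmA.
  have /nbhs_ballP[e/= e0 eA] : nbhs x A by rewrite nbhsE/=; exists A.
  have [m me] : exists m : nat, m.+1%:R^-1 < e / 2.
    have e2 : 0 < e / 2 by rewrite divr_gt0.
    by have [m _ mP] := near_infty_natSinv_lt (PosNum e2); exists m; exact: (mP m (leqnn m)).
  have m0 : 0 < m.+1%:R^-1 :> R by rewrite invr_gt0.
  have /choice[q qP] : forall i, exists q : rat, `|x ord0 i - ratr q| < m.+1%:R^-1.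
    move=> i; have [|q] := @rat_in_itvoo R (x ord0 i - m.+1%:R^-1) (x ord0 i + m.+1%:R^-1).
      by rewrite ltrBlDr -addrA ltrDl addr_gt0.
    rewrite in_itv/= => /andP[q1 q2]; exists q.
    by rewrite ltr_distlC q1 q2.
  exists (\row_i q i, m) => //; rewrite /F asboolT => [i|y].
    by rewrite mxE; exact: qP.
  move=> yq; apply: eA; rewrite mx_norm_ball /ball_/=.
  apply: rV_norm_lt => // i; rewrite !mxE.
  have := yq i; rewrite /= mxE => yqi; have xqi := qP i.
  rewrite -(subrKA (ratr (q i))) (le_lt_trans (ler_normD _ _))//.
  by rewrite [e]splitr ltrD//; [exact: lt_trans me|rewrite distrC; exact: lt_trans me].
apply: countable_bigcupT_measurable => // qm; rewrite /F.
by case: asboolP => // _; exact: measurable_box.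
Qed.

Lemma closed_measurable_rV A : closed A -> measurable A.
Proof. by move=> cA; rewrite -[A]setCK; apply: measurableC; apply: open_measurable_rV; exact: closed_openC. Qed.

Lemma continuous_measurable_rV f : continuous f ->
  measurable_fun [set: V] (f : V -> measurableTypeR R).
Proof.
move=> cf; apply: (measurability _ (RGenOInfty.measurableE R)) => _ [_ [a ->] <-].
rewrite setTI; apply: open_measurable_rV.
by apply: open_comp => [x _|]; [exact: cf|rewrite set_itvE; exact: open_gt].
Qed.

Lemma measurable_norm_le (M : R) : measurable [set x : V | `|x| <= M].
Proof.
apply: closed_measurable_rV.
have -> : [set x : V | `|x| <= M] = (fun x : V => `|x|) @^-1` [set r : R | r <= M] by [].
by apply: closed_comp; [move=> x _; exact: norm_continuous|exact: closed_le].
Qed.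

End borel_rV.

Section lebesgue_rV_theory.
Context {R : realType}.
Notation V := 'rV[R]_3.
Notation mR := (measurableTypeR R).
Notation leb := (@lebesgue_measure R).

Lemma lebesgue_segment_lty (M : R) : (leb (`[(- M)%R, M]%classic) < +oo)%E.
Proof. by rewrite lebesgue_measure_itv/=; case: ifP => _; rewrite ?ltry// -EFinB ltry. Qed.

Lemma lebesgue2_square_lty (M : R) :
  ((leb \x leb)%E ((`[(- M)%R, M]%classic : set mR) `*` (`[(- M)%R, M]%classic : set mR)) < +oo)%E.
Proof.
have mJ : measurable (`[(- M)%R, M]%classic : set mR) by exact: measurable_itv.
have E := @product_measure1E _ _ _ _ R leb leb _ _ mJ mJ.
rewrite [X in (X < _)%E]E lte_mul_pinfty// ?ge0_fin_numE//; exact: lebesgue_segment_lty.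
Qed.

Lemma lebesgue2_sigma_finite : sigma_finite [set: mR * mR] (leb \x leb)%E.
Proof.
pose J (k : nat) : set mR := `[(- k%:R)%R, k%:R]%classic.
exists (fun k : nat => J k `*` J k).
  apply/seteqP; split=> // -[a b] _.
  exists (Num.truncn (`|a| + `|b|)).+1 => //.
  have H := truncnS_gt (`|a| + `|b|); rewrite /J /= !in_itv/= -!ler_norml.
  by split; apply/ltW; apply: le_lt_trans H; rewrite ?lerDl ?lerDr.
move=> k; split; first by apply: measurableX; exact: measurable_itv.
exact: lebesgue2_square_lty.
Qed.

(** A name for the planar product measure, to which the sigma-finite structure required by the
    second product and by Fubini's theorem is attached. *)
Definition lebesgue2 : set (mR * mR) -> \bar R := (leb \x leb)%E.

HB.instance Definition _ := Measure.on lebesgue2.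

HB.instance Definition _ := Measure_isSigmaFinite.Build _ _ _ lebesgue2
  lebesgue2_sigma_finite.

Lemma leb2_ball_lty (M : R) : (leb2 [set x : 'rV[R]_2 | (`|x| <= M)%R] < +oo)%E.
Proof.
have [M0|M0] := ltP M 0.
  rewrite (_ : [set x : 'rV_2 | `|x| <= M] = set0) ?measure0//.
  by rewrite -subset0 => x /= /(le_trans (normr_ge0 _)); rewrite leNgt M0.
pose J : set mR := `[(- M)%R, M]%classic.
have -> : leb2 [set x : 'rV[R]_2 | `|x| <= M] = (leb \x leb)%E (J `*` J).
  rewrite /leb2 /pushforward; congr product_measure1.
  apply/seteqP; split=> -[a b] /=; rewrite rV_norm_le//.
    move=> /forallP H; have := H 0; have := H 1.
    by rewrite !mxE/= /J/= !in_itv/= !ler_norml => -> ->.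
  rewrite /J/= !in_itv/= -!ler_norml => -[Ha Hb].
  by apply/forallP => -[[|[|i]] // Hi]; rewrite mxE.
exact: lebesgue2_square_lty.
Qed.

Lemma leb3_ballE (M : R) : 0 <= M ->
  leb3 [set x : V | `|x| <= M] = ((2 * M) ^+ 3)%:E.
Proof.
move=> M0; pose J : set mR := `[(- M)%R, M]%classic.
have mJ : measurable J by exact: measurable_itv.
have JE : leb J = (2 * M)%:E.
  rewrite /J lebesgue_measure_itv/= lte_fin; case: ltP => M1.
    by rewrite -EFinB; congr EFin; lra.
  by congr EFin; lra.
have -> : leb3 [set x : V | `|x| <= M] = ((leb \x leb) \x leb)%E ((J `*` J) `*` J).
  rewrite /leb3 /pushforward; congr product_measure1.
  apply/seteqP; split=> -[[a b] c] /=; rewrite rV_norm_le//.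
    move=> /forallP H; have := H 0; have := H 1; have := H 2.
    by rewrite !mxE/= /J/= !in_itv/= !ler_norml => -> -> ->.
  rewrite /J/= !in_itv/= -!ler_norml => -[[Ha Hb] Hc].
  by apply/forallP => -[[|[|[|i]]] // Hi]; rewrite mxE.
have mJJ : measurable (J `*` J) by exact: measurableX.
have E := @product_measure1E _ _ _ _ R lebesgue2 leb (J `*` J) J mJJ mJ.
have E2 := @product_measure1E _ _ _ _ R leb leb J J mJ mJ.
rewrite [LHS]E [X in (X * _)%E]E2.
apply: (@etrans _ _ ((2 * M)%:E * (2 * M)%:E * (2 * M)%:E)%E).
  by congr (_ * _ * _)%E; exact: JE.
by rewrite -!EFinM; congr EFin; ring.
Qed.

Lemma leb3_ball_lty (M : R) : (leb3 [set x : V | (`|x| <= M)%R] < +oo)%E.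
Proof.
have [M0|M0] := ltP M 0; last by rewrite leb3_ballE ?ltry.
rewrite (_ : [set x : V | `|x| <= M] = set0) ?measure0//.
by rewrite -subset0 => x /= /(le_trans (normr_ge0 _)); rewrite leNgt M0.
Qed.

Lemma leb3_sigma_finite : sigma_finite [set: V] (@leb3 R).
Proof.
exists (fun k : nat => [set x : V | `|x| <= k%:R]).
  apply/seteqP; split=> // x _; exists (Num.truncn `|x|).+1 => //=.
  by rewrite ltW// truncnS_gt.
by move=> k; split; [exact: measurable_norm_le|exact: leb3_ball_lty].
Qed.

HB.instance Definition _ := Measure_isSigmaFinite.Build _ _ _ (@leb3 R) leb3_sigma_finite.

Lemma integrable_bounded_support d (T : measurableType d)
    (m : {measure set T -> \bar R}) (A : set T) (f : T -> R) (C : R) :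
  measurable A -> (m A < +oo)%E -> measurable_fun [set: T] f ->
  (forall x, `|f x| <= C) -> (forall x, ~ A x -> f x = 0) ->
  m.-integrable [set: T] (EFin \o f).
Proof.
move=> mA Aoo mf fC f0.
have E : (EFin \o f) = (EFin \o f) \_ A.
  apply/funext => x; rewrite /patch; case: ifPn => //; rewrite notin_setE => /f0 /=.
  by move=> ->.
rewrite E; apply/(integrable_mkcond _ mA).
apply: measurable_bounded_integrable => //; first exact: measurable_funTS.
by exists C; split; [exact: num_real|move=> M CM x _ /=; apply: le_trans (fC x) _; exact: ltW].
Qed.

Lemma continuous_support_integrable (f : V -> R) (M : R) : continuous f ->
  (forall x, M < `|x| -> f x = 0) -> leb3.-integrable [set: V] (EFin \o f).
Proof.
move=> cf f0; have [C C0 HC] := continuous_bounded M cf.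
apply: (@integrable_bounded_support _ _ (@leb3 R) [set x : V | `|x| <= M] f C).
- exact: measurable_norm_le.
- exact: leb3_ball_lty.
- exact: continuous_measurable_rV.
- move=> x; have [/HC//|/f0 ->] := leP `|x| M; by rewrite normr0.
- by move=> x /negP; rewrite -ltNge => /f0.
Qed.

Lemma pushforward_measure d d' (T : measurableType d) (T' : measurableType d')
    (m : {measure set T -> \bar R}) (f : T -> T') :
  measurable_fun [set: T] f ->
  exists m' : {measure set T' -> \bar R}, forall A, m' A = m (f @^-1` A).
Proof.
move=> mf.
exists (measure_function_pushforward__canonical__measure_function_Measure m mf).
by [].
Qed.

Lemma lebesgue_measure_translate (c : R) (A : set mR) : measurable A ->
  pushforward leb (fun x : mR => x + c : mR) A = leb A.
Proof.
move=> mA; have mc : measurable_fun [set: mR] (fun x : mR => x + c : mR).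
  exact: measurable_funD.
apply/esym/lebesgue_measure_unique => //= _ [[a b]] _ <-.
rewrite /pushforward.
have -> : (fun x : mR => x + c) @^-1` `]a, b] = `]a - c, b - c]%classic.
  by apply/seteqP; split => x /=; rewrite !in_itv/= ltrBlDr lerBrDr.
rewrite !lebesgue_measure_itv/= !lte_fin ltrD2r; case: ifP => // _.
by rewrite -!EFinB; congr EFin; lra.
Qed.

(** A translation acts coordinatewise and a product measure is determined by its values on
    rectangles, so invariance passes from the line to the plane and from the plane to space. *)
Lemma leb3_translate (y : V) (A : set V) : measurable A ->
  leb3 ((fun x => x + y) @^-1` A) = leb3 A.
Proof.
move=> mA; rewrite /leb3 /pushforward.
pose t (i : 'I_3) (x : mR) : mR := x + y ord0 i.
have mt i : measurable_fun [set: mR] (t i) by exact: measurable_funD.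
pose t2 (q : mR * mR) : mR * mR := (t 0 q.1, t 1 q.2).
pose t3 (q : mR * mR * mR) : mR * mR * mR := (t2 q.1, t 2 q.2).
have mt2 : measurable_fun [set: mR * mR] t2.
  exact: (measurable_fun_pair (measurableT_comp (mt 0) measurable_fst) (measurableT_comp (mt 1) measurable_snd)).
have mt3 : measurable_fun [set: mR * mR * mR] t3.
  exact: (measurable_fun_pair (measurableT_comp mt2 measurable_fst) (measurableT_comp (mt 2) measurable_snd)).
have E2 B : measurable B -> (leb \x leb)%E (t2 @^-1` B) = (leb \x leb)%E B.
  move=> mB; rewrite -[LHS]/(pushforward (leb \x leb)%E t2 B).
  apply/esym/product_measure_unique => //= B1 B2 mB1 mB2.
  have m1 : measurable (t 0 @^-1` B1) by rewrite -[X in measurable X]setTI; exact: mt.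
  have m2 : measurable (t 1 @^-1` B2) by rewrite -[X in measurable X]setTI; exact: mt.
  have E := @product_measure1E _ _ _ _ R leb leb _ _ m1 m2.
  rewrite -[LHS]/((leb \x leb)%E ((t 0 @^-1` B1) `*` (t 1 @^-1` B2))) E.
  by congr (_ * _)%E; exact: lebesgue_measure_translate.
have -> : rV3 @^-1` ((fun x => x + y) @^-1` A) = t3 @^-1` (rV3 @^-1` A).
  apply/funext => -[[a b] c] /=; congr (A _).
  by apply/rowP => -[[|[|[|i]]] // Hi]; rewrite !mxE/=; congr (_ + y _ _); exact: val_inj.
have mA' : measurable (rV3 @^-1` A) by rewrite -[X in measurable X]setTI; exact: measurable_rV3.
have [m' m'E] := pushforward_measure ((leb \x leb) \x leb)%E mt3.
have U := @product_measure_unique _ _ _ _ R lebesgue2 leb m'.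
rewrite -m'E; apply/esym/U => // B1 B2 mB1 mB2; rewrite m'E.
have m1 : measurable (t2 @^-1` B1) by rewrite -[X in measurable X]setTI; exact: mt2.
have m2 : measurable (t 2 @^-1` B2) by rewrite -[X in measurable X]setTI; exact: mt.
have E := @product_measure1E _ _ _ _ R lebesgue2 leb _ _ m1 m2.
rewrite -[LHS]/(((leb \x leb) \x leb)%E ((t2 @^-1` B1) `*` (t 2 @^-1` B2))) E.
by congr (_ * _)%E; [exact: E2|exact: lebesgue_measure_translate].
Qed.

End lebesgue_rV_theory.

Section integration_by_parts_rV.
Context {R : realType}.
Notation V := 'rV[R]_3.
Notation mR := (measurableTypeR R).
Notation leb := (@lebesgue_measure R).
Notation leb2p := (@lebesgue2 R).

Lemma line_integral0 (F dF : R -> R) (N : R) :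
  (forall t : R, is_derive t (1 : R) F (dF t)) -> continuous dF ->
  (forall t, N < `|t| -> F t = 0) -> (forall t, N < `|t| -> dF t = 0) ->
  (\int[leb]_t (dF t)%:E = 0)%E.
Proof.
move=> FdF cdF F0 dF0.
pose N' := `|N| + 1.
have N'0 : 0 < N' by rewrite ltr_wpDl.
have NN' : N < N' by rewrite (le_lt_trans (ler_norm N))// ltrDl.
have -> : (\int[leb]_t (dF t)%:E = \int[leb]_(t in `[(- N')%R, N']) (dF t)%:E)%E.
  rewrite [RHS]integral_mkcond; apply: eq_integral => t _.
  rewrite patchE; case: ifPn => //; rewrite notin_setE/= in_itv/= -ler_norml => /negP.
  by rewrite -ltNge => /(lt_trans NN')/dF0 ->.
have cF : continuous F.
  by move=> t; apply/differentiable_continuous/derivable1_diffP; have [] := FdF t.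
rewrite (@continuous_FTC2 _ dF F).
- by rewrite !F0 ?subee// ?normrN gtr0_norm.
- by rewrite gtrN.
- exact: continuous_subspaceT.
- split; first by move=> t _; have [] := FdF t.
  + by apply: cvg_at_right_filter; exact: cF.
  + by apply: cvg_at_left_filter; exact: cF.
- by move=> t _; rewrite derive1E; have H := FdF t; rewrite derive_val.
Qed.

Lemma rV3_line0 a b c : rV3 (a, b, c) = rV3 (0, b, c) + a *: delta_mx ord0 (0 : 'I_3) :> V.
Proof. by apply/rowP => -[[|[|[|i]]] // Hi]; rewrite !mxE/= ?mulr1 ?mulr0 ?addr0 ?add0r. Qed.

Lemma rV3_line1 a b c : rV3 (a, b, c) = rV3 (a, 0, c) + b *: delta_mx ord0 (1 : 'I_3) :> V.
Proof. by apply/rowP => -[[|[|[|i]]] // Hi]; rewrite !mxE/= ?mulr1 ?mulr0 ?addr0 ?add0r. Qed.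

Lemma rV3_line2 a b c : rV3 (a, b, c) = rV3 (a, b, 0) + c *: delta_mx ord0 (2 : 'I_3) :> V.
Proof. by apply/rowP => -[[|[|[|i]]] // Hi]; rewrite !mxE/= ?mulr1 ?mulr0 ?addr0 ?add0r. Qed.

Lemma rV3_norm_ge (q : mR * mR * mR) :
  [/\ `|q.1.1| <= `|rV3 q|, `|q.1.2| <= `|rV3 q| & `|q.2| <= `|rV3 q|].
Proof.
split.
- by have := coord_le_norm (rV3 q) 0; rewrite mxE.
- by have := coord_le_norm (rV3 q) 1; rewrite mxE.
- by have := coord_le_norm (rV3 q) 2; rewrite mxE.
Qed.

Section supported.
Variables (f : V -> R) (M : R).
Hypotheses (cf : continuous f) (f0 : forall x, M < `|x| -> f x = 0).

Let g (q : mR * mR * mR) : \bar R := (f (rV3 q))%:E.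

Let fbd : exists C, forall x, `|f x| <= C.
Proof.
have [C C0 HC] := continuous_bounded M cf.
exists C => x; have [/HC//|/f0 ->] := leP `|x| M; by rewrite normr0.
Qed.

Let mg : measurable_fun [set: mR * mR * mR] (fun q => f (rV3 q) : mR).
Proof. exact: (measurableT_comp (continuous_measurable_rV cf) measurable_rV3). Qed.

Lemma integrable_rV3 : (leb2p \x leb)%E.-integrable [set: mR * mR * mR] g.
Proof.
have [C HC] := fbd.
apply: (@integrable_bounded_support _ _ _ (leb2p \x leb)%E
   (rV3 @^-1` [set x : V | `|x| <= M]) (fun q => f (rV3 q)) C) => //.
- rewrite -[X in measurable X]setTI; apply: measurable_rV3 => //.
  exact: measurable_norm_le.
- exact: (leb3_ball_lty M).
- by move=> q /= /negP; rewrite -ltNge => /f0.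
Qed.

Lemma leb3_integralE : (\int[leb3]_x (f x)%:E = \int[leb2p \x leb]_q g q)%E.
Proof.
have mf : measurable_fun [set: V] (EFin \o f).
  by apply/measurable_EFinP; exact: continuous_measurable_rV.
exact: (integral_pushforward measurable_rV3 mf integrable_rV3 measurableT).
Qed.

Let slice (c : mR) : leb2p.-integrable [set: mR * mR] (fun q => (f (rV3 (q, c)))%:E).
Proof.
have [C HC] := fbd.
pose J : set mR := `[(- M)%R, M]%classic.
apply: (@integrable_bounded_support _ _ _ leb2p (J `*` J) (fun q => f (rV3 (q, c))) C).
- by apply: measurableX; exact: measurable_itv.
- exact: lebesgue2_square_lty.
- exact: (measurable_fun_pair1 (f := fun q => f (rV3 q) : mR) c mg).
- by [].
- move=> -[a b] /= H; apply: f0; rewrite ltNge; apply/negP => le; apply: H.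
  have [/= H1 H2 _] := rV3_norm_ge (a, b, c).
  by rewrite /J/= !in_itv/= -!ler_norml; split; exact: le_trans le.
Qed.

(** In each of the three cases the order of integration is the one that makes the i-th coordinate
    innermost. *)
Lemma leb3_integral0 (i : 'I_3) :
  (forall x : V, (\int[leb]_t (f (x + t *: delta_mx ord0 i))%:E = 0)%E) ->
  (\int[leb3]_x (f x)%:E = 0)%E.
Proof.
move=> H; rewrite leb3_integralE.
have i012 : [\/ i = 0, i = 1 | i = 2].
  by case: i {H} => -[|[|[|i]]] // Hi; [apply: Or31|apply: Or32|apply: Or33]; exact: val_inj.
case: i012 => iE; rewrite {i}iE in H.
- rewrite -(integral21_prod_meas1 integrable_rV3); apply: integral0_eq => c _.
  rewrite /fubini_G -(integral21_prod_meas1 (slice c)).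
  by apply: integral0_eq => b _; rewrite -[RHS](H (rV3 (0, b, c))); apply: eq_integral => a _; rewrite -rV3_line0.
- rewrite -(integral21_prod_meas1 integrable_rV3); apply: integral0_eq => c _.
  rewrite /fubini_G -(integral12_prod_meas1 (slice c)).
  by apply: integral0_eq => a _; rewrite -[RHS](H (rV3 (a, 0, c))); apply: eq_integral => b _; rewrite -rV3_line1.
- rewrite -(integral12_prod_meas1 integrable_rV3); apply: integral0_eq => -[a b] _.
  by rewrite -[RHS](H (rV3 (a, b, 0))); apply: eq_integral => c _; rewrite -rV3_line2.
Qed.

End supported.

Lemma partial_support (f : V -> R) M i : (forall x, M < `|x| -> f x = 0) ->
  forall x, M < `|x| -> partial i f x = 0.
Proof.
move=> f0 x Mx; apply: is_derive_partial.
have N : \forall y \near x, (fun=> 0) y = f y.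
  have o : open [set y : V | M < `|y|].
    have -> : [set y : V | M < `|y|] = (fun y : V => `|y|) @^-1` [set r : R | M < r] by [].
    by apply: open_comp; [move=> y _; exact: norm_continuous|exact: open_gt].
  by move: (open_nbhs_nbhs (conj o Mx : open_nbhs x _)); apply: filterS => y My; rewrite f0.
have H : is_derive x (delta_mx ord0 i) (fun _ : V => 0 : R) 0 by exact: is_derive_cst.
exact: (near_eq_is_derive N H).
Qed.

Lemma leb3_integral_partial (h : V -> R) M i : class_C 1 h ->
  (forall x, M < `|x| -> h x = 0) -> (\int[leb3]_x (partial i h x)%:E = 0)%E.
Proof.
move=> hC h0.
have ph0 := partial_support i h0.
apply: (@leb3_integral0 (partial i h) M (class_C_cont (class_C_partial i hC)) ph0 i) => x.
have big t : M + `|x| < `|t| -> M < `|x + t *: delta_mx ord0 i|.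
  move=> H; have := coord_le_norm (x + t *: delta_mx ord0 i) i.
  apply: lt_le_trans; rewrite !mxE !eqxx mulr1.
  have := ler_normB (x ord0 i + t) (x ord0 i); rewrite addrAC subrr add0r => H2.
  have H3 := coord_le_norm x i.
  move: H H2 H3; move: (`|x|) (`|t|) (`|x ord0 i|) (`|x ord0 i + t|) => a b c d; lra.
apply: (@line_integral0 (fun t => h (x + t *: delta_mx ord0 i)) _ (M + `|x|)) => [t||t /big /h0//|t /big /ph0//].
- by apply: is_derive_line; exact: class_C_is_derive hC.
- move=> t; have h1 : x + s *: delta_mx ord0 i @[s --> t] --> x + t *: delta_mx ord0 i.
    apply: cvgD; first exact: cvg_cst.
    by apply: cvgZr_tmp; exact: cvg_id.
  have h2 : {for x + t *: delta_mx ord0 i, continuous (partial i h)}.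
    exact: (class_C_cont (class_C_partial i hC)).
  by have := cvg_comp _ _ h1 h2.
Qed.

Lemma leb3_by_parts (f g : V -> R) M i : class_C 1 f -> class_C 1 g ->
  (forall x, M < `|x| -> g x = 0) ->
  \int[leb3]_x (f x * partial i g x) = - \int[leb3]_x (partial i f x * g x).
Proof.
move=> fC gC g0.
have C := class_CM fC gC.
have fg0 x : M < `|x| -> f x * g x = 0 by move=> /g0 ->; rewrite mulr0.
have H := leb3_integral_partial i C fg0.
have cpf := class_C_cont (class_C_partial i fC).
have cpg := class_C_cont (class_C_partial i gC).
have I1 : leb3.-integrable [set: V] (EFin \o (fun x => f x * partial i g x)).
  apply: (@continuous_support_integrable _ _ M); first exact: contM (class_C_cont fC) cpg.
  by move=> x /(partial_support i g0) ->; rewrite mulr0.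
have I2 : leb3.-integrable [set: V] (EFin \o (fun x => partial i f x * g x)).
  apply: (@continuous_support_integrable _ _ M); first exact: contM cpf (class_C_cont gC).
  by move=> x /g0 ->; rewrite mulr0.
apply/eqP; rewrite -addr_eq0 -(RintegralD measurableT I1 I2) /Rintegral.
rewrite (_ : (\int[leb3]_x _ = 0)%E)// -[RHS]H; apply: eq_integral => x _.
by rewrite (partialM i fC gC) [g x * _]mulrC.
Qed.

End integration_by_parts_rV.

(** * Kelvin's matrix and the representation formula *)

Section pointwise_derivative_rules.
Context {R : realType} {V : normedModType R}.
Implicit Types (f g : V -> R) (x v : V).

Lemma is_derive_ptD f g x v a b : is_derive x v f a -> is_derive x v g b ->
  is_derive x v (fun y => f y + g y) (a + b).
Proof. by move=> fa gb; exact: (is_deriveD fa gb). Qed.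

Lemma is_derive_ptM f g x v a b : is_derive x v f a -> is_derive x v g b ->
  is_derive x v (fun y => f y * g y) (f x * b + g x * a).
Proof. by move=> fa gb; exact: (is_deriveM fa gb). Qed.

Lemma is_derive_ptZ c f x v a : is_derive x v f a -> is_derive x v (fun y => c * f y) (c * a).
Proof.
move=> fa; have H : is_derive x v (fun _ : V => c) 0 by exact: is_derive_cst.
by apply: (is_derive_eq (is_derive_ptM H fa)); rewrite mulr0 addr0.
Qed.

Lemma is_derive_ptX n f x v a : is_derive x v f a ->
  is_derive x v (fun y => f y ^+ n.+1) (n.+1%:R * f x ^+ n * a).
Proof.
move=> fa; elim: n => [|n IH].
  by apply: (is_derive_eq fa); rewrite mul1r mul1r.
apply: (is_derive_eq (is_derive_ptM fa IH)); rewrite -[n.+2%:R]natr1 exprS; ring.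
Qed.

Lemma is_derive_ptV f x v a : f x != 0 -> is_derive x v f a ->
  is_derive x v (fun y => (f y)^-1) (- (f x) ^- 2 * a).
Proof.
move=> f0 [fd fa]; split; first exact: derivableV.
by rewrite deriveV// fa.
Qed.

Lemma is_derive_chain (h : R -> R) f x v a b :
  is_derive (f x) (1 : R) h b -> is_derive x v f a -> is_derive x v (h \o f) (b * a).
Proof.
move=> hb fa; apply: line_is_derive.
have -> : (fun s : R => (h \o f) (x + s *: v)) = h \o (fun s => f (x + s *: v)) by [].
apply: is_derive1_comp; first by rewrite scale0r addr0.
by apply: is_derive_line; rewrite scale0r addr0.
Qed.

End pointwise_derivative_rules.

Section kernel.
Context {R : realType}.
Notation V := 'rV[R]_3.
Implicit Types (x : V) (e : R) (i j k l : 'I_3).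

(* [qe 0] is 1/|x|, with value 0 at the origin. *)
Definition qe e x : R := (Num.sqrt (dot x x + e ^+ 2))^-1.

Lemma dot_ge0 x : 0 <= dot x x.
Proof. by apply: sumr_ge0 => i _; rewrite -expr2 sqr_ge0. Qed.

Lemma dot_eq0 x : (dot x x == 0) = (x == 0).
Proof.
apply/eqP/eqP => [/eqP|->]; last by rewrite /dot big1// => i _; rewrite mxE mul0r.
rewrite psumr_eq0 => [/allP H|i _]; last by rewrite -expr2 sqr_ge0.
apply/rowP => i; have /(_ (mem_index_enum _)) := H i.
by rewrite mxE -expr2 sqrf_eq0 => /eqP.
Qed.

Lemma dot_coord x i : x ord0 i ^+ 2 <= dot x x.
Proof.
rewrite /dot (bigD1 i)//= -expr2 lerDl; apply: sumr_ge0 => k _.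
by rewrite -expr2 sqr_ge0.
Qed.

Lemma qe_ge0 e x : 0 <= qe e x. Proof. by rewrite invr_ge0 sqrtr_ge0. Qed.

Lemma den_ge0 e x : 0 <= dot x x + e ^+ 2.
Proof. by rewrite addr_ge0 ?dot_ge0 ?sqr_ge0. Qed.

Lemma den_gt0 e x : (e != 0) || (x != 0) -> 0 < dot x x + e ^+ 2.
Proof.
move=> H; rewrite lt_def den_ge0 andbT paddr_eq0 ?dot_ge0 ?sqr_ge0// dot_eq0 sqrf_eq0.
by rewrite negb_and orbC.
Qed.

Lemma qe_gt0 e x : 0 < dot x x + e ^+ 2 -> 0 < qe e x.
Proof. by move=> ?; rewrite invr_gt0 sqrtr_gt0. Qed.

Lemma qe2 e x : 0 < dot x x + e ^+ 2 -> (dot x x + e ^+ 2) * qe e x ^+ 2 = 1.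
Proof. by move=> H; rewrite exprVn sqr_sqrtr ?ltW// mulfV// gt_eqF. Qed.

Lemma qe2_le e x (a : R) : a ^+ 2 <= dot x x + e ^+ 2 -> `|a| * qe e x <= 1.
Proof.
move=> H; have [N0|N0] := ltP 0 (dot x x + e ^+ 2).
  rewrite -(@ler_pXn2r _ 2)// ?nnegrE ?mulr_ge0 ?qe_ge0//.
  rewrite exprMn expr1n -(qe2 N0) ler_wpM2r ?sqr_ge0//.
  by rewrite real_normK// num_real.
(* Here the denominator is 0, and so is its inverse by convention. *)
by rewrite /qe (ler0_sqrtr N0) invr0 mulr0.
Qed.

Lemma qe_coord_le e x i : `|x ord0 i| * qe e x <= 1.
Proof. by apply: qe2_le; rewrite (le_trans (dot_coord x i))// lerDl sqr_ge0. Qed.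

Lemma qe_eps_le e x : `|e| * qe e x <= 1.
Proof. by apply: qe2_le; rewrite lerDr dot_ge0. Qed.

Lemma qe_le_qe0 e x : x != 0 -> qe e x <= qe 0 x.
Proof.
move=> x0; rewrite lef_pV2 ?posrE ?sqrtr_gt0 ?den_gt0 ?x0 ?orbT//.
by rewrite ler_sqrt ?den_ge0// lerD2l expr0n sqr_ge0.
Qed.

Lemma is_derive_qe e x k : 0 < dot x x + e ^+ 2 ->
  is_derive x (delta_mx ord0 k) (qe e) (- x ord0 k * qe e x ^+ 3).
Proof.
move=> N0.
have Hd : is_derive x (delta_mx ord0 k) (fun x => dot x x + e ^+ 2) (2 * x ord0 k).
  have H1 := class_C_is_derive k x (class_C_dot 1).
  have H2 : is_derive x (delta_mx ord0 k) (fun _ : V => e ^+ 2) 0 by exact: is_derive_cst.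
  by apply: (is_derive_eq (is_derive_ptD H1 H2)); rewrite partial_dot addr0.
have Hs := is_derive_chain (f := fun x => dot x x + e ^+ 2) (is_derive1_sqrt N0) Hd.
have s0 : Num.sqrt (dot x x + e ^+ 2) != 0 by rewrite gt_eqF// sqrtr_gt0.
have Hd2 := is_derive_ptV (f := Num.sqrt \o (fun x : V => dot x x + e ^+ 2)) s0 Hs.
have E : - x ord0 k * qe e x ^+ 3 = - (Num.sqrt (dot x x + e ^+ 2)) ^- 2 *
    ((2 * Num.sqrt (dot x x + e ^+ 2))^-1 * (2 * x ord0 k)); last by rewrite E; exact: Hd2.
rewrite /qe.
by move: s0; move: (Num.sqrt _) => s s0; field.
Qed.

Lemma class_C_qe m e : e != 0 -> class_C m (qe e).
Proof.
move=> e0; have N0 x : 0 < dot x x + e ^+ 2 by rewrite den_gt0 ?e0.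
have cq : continuous (qe e).
  move=> x; have H := class_C_cont (@class_C_dot R 2 0).
  have H1 : {for x, continuous (fun x => Num.sqrt (dot x x + e ^+ 2))}.
    apply: (@continuous_comp _ _ _ (fun x => dot x x + e ^+ 2) Num.sqrt).
      exact: (cvgD (H x) (cvg_cst _)).
    exact: sqrt_continuous.
  by apply: cvgV H1; rewrite gt_eqF// sqrtr_gt0.
elim: m => [|m IH]; first by split.
apply: (@class_C_intro _ _ m (qe e) (fun k x => - x ord0 k * qe e x ^+ 3)) => // k.
- by move=> x; exact: is_derive_qe.
- by apply: class_CM; [apply: class_CN; exact: class_C_coord|exact: class_CX].
Qed.

Lemma measurable_qe e : measurable_fun [set: V] (qe e : V -> measurableTypeR R).
Proof.
have mN : measurable_fun [set: V] (fun x : V => Num.sqrt (dot x x + e ^+ 2) : measurableTypeR R).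
  apply: continuous_measurable_rV => x.
  have H1 : {for x, continuous (fun x : V => dot x x + e ^+ 2)}.
    exact: (class_C_cont (class_CD (class_C_dot 0) (class_C_cst 0 (e ^+ 2)))).
  exact: (continuous_comp H1 (@sqrt_continuous R _)).
rewrite (_ : qe e = (fun y => y `^ (-1)) \o (fun x : V => Num.sqrt (dot x x + e ^+ 2))).
  exact: (measurableT_comp (measurable_powR _) mN).
by apply/funext => x; rewrite /= powR_inv1// sqrtr_ge0.
Qed.

Section green.
Variable c : R.

(* The matrix [delta_ij Lap - c d_i d_j] applied to sqrt(|x|^2 + e^2); for
   c = (lambda+mu)/(lambda+2mu) and e = 0 it is a multiple of Kelvin's
   fundamental solution. *)
Definition Gam e i j x : R :=
  (i == j)%:R * ((2 - c) * qe e x + e ^+ 2 * qe e x ^+ 3) +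
  c * (x ord0 i * x ord0 j * qe e x ^+ 3).

(** The derivatives of [Gam] are kept as closed formulas rather than as [partial]: these remain
    defined and measurable for e = 0, the origin included. *)
Definition dGam e k i j x : R :=
  (i == j)%:R * (- (2 - c) * x ord0 k * qe e x ^+ 3 - 3 * e ^+ 2 * x ord0 k * qe e x ^+ 5) +
  c * ((k == i)%:R * x ord0 j * qe e x ^+ 3 + (k == j)%:R * x ord0 i * qe e x ^+ 3
       - 3 * x ord0 i * x ord0 j * x ord0 k * qe e x ^+ 5).

Definition ddGam e l k i j x : R :=
  (i == j)%:R * (- (2 - c) * ((k == l)%:R * qe e x ^+ 3 - 3 * x ord0 k * x ord0 l * qe e x ^+ 5)
     - 3 * e ^+ 2 * ((k == l)%:R * qe e x ^+ 5 - 5 * x ord0 k * x ord0 l * qe e x ^+ 7)) +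
  c * ((k == i)%:R * ((j == l)%:R * qe e x ^+ 3 - 3 * x ord0 j * x ord0 l * qe e x ^+ 5)
     + (k == j)%:R * ((i == l)%:R * qe e x ^+ 3 - 3 * x ord0 i * x ord0 l * qe e x ^+ 5)
     - 3 * ((i == l)%:R * x ord0 j * x ord0 k + (j == l)%:R * x ord0 i * x ord0 k
        + (k == l)%:R * x ord0 i * x ord0 j) * qe e x ^+ 5
     + 15 * x ord0 i * x ord0 j * x ord0 k * x ord0 l * qe e x ^+ 7).

Let dxq i l e x : 0 < dot x x + e ^+ 2 ->
  is_derive x (delta_mx ord0 l) (fun x : V => x ord0 i) (i == l)%:R.
Proof. by move=> _; exact: is_derive_coord_delta. Qed.

Lemma is_derive_Gam e k i j x : 0 < dot x x + e ^+ 2 ->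
  is_derive x (delta_mx ord0 k) (Gam e i j) (dGam e k i j x).
Proof.
move=> N0; have Hq := is_derive_qe k N0; have Hq3 := is_derive_ptX 2 Hq.
have Hi := dxq i k N0; have Hj := dxq j k N0.
apply: (is_derive_eq (is_derive_ptD (is_derive_ptZ _ (is_derive_ptD (is_derive_ptZ _ Hq) (is_derive_ptZ _ Hq3))) (is_derive_ptZ _ (is_derive_ptM (is_derive_ptM Hi Hj) Hq3)))).
by rewrite /dGam [k == i]eq_sym [k == j]eq_sym; ring.
Qed.

Lemma is_derive_dGam e l k i j x : 0 < dot x x + e ^+ 2 ->
  is_derive x (delta_mx ord0 l) (dGam e k i j) (ddGam e l k i j x).
Proof.
move=> N0; have Hq := is_derive_qe l N0; have Hq3 := is_derive_ptX 2 Hq; have Hq5 := is_derive_ptX 4 Hq.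
have Hi := dxq i l N0; have Hj := dxq j l N0; have Hk := dxq k l N0.
have E : dGam e k i j = (fun x =>
  (i == j)%:R * (- (2 - c) * (x ord0 k * qe e x ^+ 3) + (- 3 * e ^+ 2) * (x ord0 k * qe e x ^+ 5)) +
  c * (((k == i)%:R * (x ord0 j * qe e x ^+ 3) + (k == j)%:R * (x ord0 i * qe e x ^+ 3))
       + (- 3) * (x ord0 i * (x ord0 j * (x ord0 k * qe e x ^+ 5))))).
  by apply/funext => y; rewrite /dGam; ring.
rewrite E.
apply: (is_derive_eq (is_derive_ptD (is_derive_ptZ _ (is_derive_ptD (is_derive_ptZ _ (is_derive_ptM Hk Hq3)) (is_derive_ptZ _ (is_derive_ptM Hk Hq5))))
  (is_derive_ptZ _ (is_derive_ptD (is_derive_ptD (is_derive_ptZ _ (is_derive_ptM Hj Hq3)) (is_derive_ptZ _ (is_derive_ptM Hi Hq3))) (is_derive_ptZ _ (is_derive_ptM Hi (is_derive_ptM Hj (is_derive_ptM Hk Hq5)))))))).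
by rewrite /ddGam; ring.
Qed.

Lemma class_C_Gam m e i j : e != 0 -> class_C m (Gam e i j).
Proof.
move=> e0; have Cq := class_C_qe m e0; have Cx a := @class_C_coord R 2 m a.
have Cq3 := class_CX 3 Cq.
exact: (class_CD (class_CZ _ (class_CD (class_CZ _ Cq) (class_CZ _ Cq3)))
  (class_CZ _ (class_CM (class_CM (Cx i) (Cx j)) Cq3))).
Qed.

Lemma partial_Gam e k i j : e != 0 -> partial k (Gam e i j) = dGam e k i j.
Proof. by move=> e0; apply: partial_ext => x; apply: is_derive_Gam; rewrite den_gt0 ?e0. Qed.

Lemma partial_dGam e l k i j : e != 0 -> partial l (dGam e k i j) = ddGam e l k i j.
Proof. by move=> e0; apply: partial_ext => x; apply: is_derive_dGam; rewrite den_gt0 ?e0. Qed.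

Lemma sum_ord3 (F : 'I_3 -> R) : \sum_k F k = F 0 + F 1 + F 2.
Proof.
rewrite !big_ord_recl big_ord0 addr0 addrA.
by congr (F _ + F _ + F _); exact: val_inj.
Qed.

Lemma ord3P i : [\/ i = 0, i = 1 | i = 2].
Proof.
by case: i => -[|[|[|i]]] // Hi; [apply: Or31|apply: Or32|apply: Or33]; exact: val_inj.
Qed.

(** With s = sqrt(|x|^2 + e^2), applying E to the matrix gives mu delta_ij Lap^2 s + ((lambda + mu)
    - c (lambda + 2 mu)) d_i d_j Lap s. The choice of c kills the second term, and Lap^2 s = -15 e^4
    s^-7. In particular the result is 0 for e = 0. *)
Lemma Gam_elasticity lambda mu e i j x : c = (lambda + mu) / (lambda + 2 * mu) ->
  lambda + 2 * mu != 0 -> 0 < dot x x + e ^+ 2 ->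
  mu * (\sum_k ddGam e k k i j x) + (lambda + mu) * (\sum_k ddGam e i k k j x) =
  - 15 * mu * (e ^+ 4 * qe e x ^+ 7) * (i == j)%:R.
Proof.
move=> cE den N0; rewrite !sum_ord3 /ddGam.
have q0 : qe e x != 0 by rewrite gt_eqF// qe_gt0.
(* Eliminating e^2 turns the claim into a rational identity in q and the coordinates. *)
have eE : e ^+ 2 = (qe e x)^-2 - (x ord0 0 ^+ 2 + x ord0 1 ^+ 2 + x ord0 2 ^+ 2).
  have := qe2 N0; rewrite /dot sum_ord3 => H.
  apply: (mulIf (expf_neq0 2 q0)); rewrite mulrBl mulVf ?expf_neq0// -H.
  by ring.
have e4E : e ^+ 4 = (e ^+ 2) ^+ 2 by rewrite -exprM.
rewrite e4E eE {e4E eE} cE.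
have e01 : (0 == 1 :> 'I_3) = false by [].
have e02 : (0 == 2 :> 'I_3) = false by [].
have e12 : (1 == 2 :> 'I_3) = false by [].
have e10 : (1 == 0 :> 'I_3) = false by [].
have e20 : (2 == 0 :> 'I_3) = false by [].
have e21 : (2 == 1 :> 'I_3) = false by [].
case: (ord3P i) => ->; case: (ord3P j) => ->;
  rewrite ?eqxx ?e01 ?e02 ?e12 ?e10 ?e20 ?e21 /= ?mulr1n ?mulr0n;
  clear N0; move: (qe e x) (x ord0 0) (x ord0 1) (x ord0 2) q0 => q x0 x1 x2 q0;
  field; by rewrite q0 den.
Qed.

End green.
End kernel.

(** * A cut-off function of class C^3 *)

Section cutoff.
Context {R : realType}.

Definition posp (t : R) : R := Num.max 0 t.

Lemma posp_le0 t : t <= 0 -> posp t = 0. Proof. by move=> ?; rewrite /posp; apply/max_idPl. Qed.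
Lemma posp_ge0 t : 0 <= t -> posp t = t. Proof. by move=> ?; rewrite /posp; apply/max_idPr. Qed.

Lemma continuous_posp : continuous posp.
Proof. by move=> t; exact: (continuous_max (cvg_cst (0 : R)) cvg_id). Qed.

Lemma is_derive_pospX m (t : R) :
  is_derive t (1 : R) (fun s => posp s ^+ m.+2) (m.+2%:R * posp t ^+ m.+1).
Proof.
have [t0|t0|t0] := ltgtP t 0.
- rewrite (posp_le0 (ltW t0)) expr0n mulr0.
  have N : \forall s \near t, (fun=> 0) s = posp s ^+ m.+2.
    near=> s; rewrite posp_le0 ?expr0n// ltW//.
    by near: s; exact: lt_nbhsl.
  have H : is_derive t (1 : R) (fun _ : R => 0 : R) 0 by exact: is_derive_cst.
  exact: (near_eq_is_derive N H).
- rewrite (posp_ge0 (ltW t0)).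
  have N : \forall s \near t, (fun s : R => s ^+ m.+2) s = posp s ^+ m.+2.
    near=> s; rewrite posp_ge0// ltW//.
    by near: s; exact: lt_nbhsr.
  have H : is_derive t (1 : R) (fun s : R => s) 1 by exact: is_derive_id.
  have H2 := is_derive_eq (is_derive_ptX m.+1 H) (mulr1 _).
  exact: (near_eq_is_derive N H2).
(* At 0 the difference quotient is at most |h|^(m+1), which tends to 0 because the exponent is at
   least 2. *)
- rewrite t0 posp_le0// expr0n mulr0.
  suff H : (fun h : R => h^-1 *: (((fun s => posp s ^+ m.+2) \o shift 0) (h *: (1 : R)) - posp 0 ^+ m.+2)) @ 0^' --> (0 : R).
    by split; [apply/cvg_ex; exists 0|exact: cvg_lim].
  apply/cvgrPdist_le => eps eps0; near=> h.
  rewrite sub0r normrN /= addr0 -[h *: 1]/(h * 1) mulr1 (posp_le0 (lexx _)) expr0n subr0.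
  rewrite -[_ *: _]/(_ * _).
  have h0 : h != 0 by near: h; exact: nbhs_dnbhs_neq.
  have h1 : `|h| <= 1 by near: h; exact: dnbhs0_le.
  have he : `|h| <= eps by near: h; exact: dnbhs0_le.
  have ph : `|posp h| <= `|h|.
    by have [?|?] := leP h 0; [rewrite posp_le0// normr0|rewrite posp_ge0// ltW].
  rewrite normrM normrX normfV exprS exprS [X in X <= _]mulrA.
  have a1 : `|h|^-1 * `|posp h| <= 1 by rewrite mulrC ler_pdivrMr ?normr_gt0// mul1r.
  have a2 : `|posp h| * `|posp h| ^+ m <= eps.
    by rewrite -[eps]mulr1 ler_pM// ?(le_trans ph)// exprn_ile1// (le_trans ph).
  by rewrite -[eps]mul1r ler_pM// ?mulr_ge0// ?invr_ge0.
Unshelve. all: by end_near. Qed.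

(* 24^-1 times the fourth backward difference of t_+^4: the C^3 B-spline step
   from 0 (t <= 0) to 1 (t >= 4). *)
Definition spl (t : R) : R := 24^-1 *
  (posp t ^+ 4 + (- 4) * posp (t + (- 1)) ^+ 4 + 6 * posp (t + (- 2)) ^+ 4
   + (- 4) * posp (t + (- 3)) ^+ 4 + posp (t + (- 4)) ^+ 4).

Lemma spl0 t : t <= 0 -> spl t = 0.
Proof. by move=> t0; rewrite /spl !posp_le0 ?expr0n; [ring|lra..]. Qed.

Lemma spl1 t : 4 <= t -> spl t = 1.
Proof. by move=> t4; rewrite /spl !posp_ge0; [field|lra..]. Qed.

Variable n : nat.
Notation V := 'rV[R]_n.+1.

Lemma class_C_posp m (a b : R) (i : 'I_n.+1) :
  class_C m (fun x : V => posp (a + b * x ord0 i) ^+ m.+1).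
Proof.
have cA : continuous (fun x : V => a + b * x ord0 i).
  exact: (class_C_cont (class_CD (class_C_cst 0 a) (class_CZ b (class_C_coord 0 i)))).
have cP : continuous (fun x : V => posp (a + b * x ord0 i)).
  by move=> x; exact: (continuous_comp (cA x) (@continuous_posp _)).
have cX l : continuous (fun x : V => posp (a + b * x ord0 i) ^+ l.+1).
  elim: l => [|l IH] //.
  by under eq_fun do rewrite exprS; exact: contM.
elim: m => [|m IH]; first by split.
apply: (@class_C_intro _ _ m _ (fun j x => (m.+2%:R * posp (a + b * x ord0 i) ^+ m.+1) * (b * (i == j)%:R))).
- exact: cX.
- move=> j x.
  have H1 : is_derive x (delta_mx ord0 j) (fun x : V => a + b * x ord0 i) (b * (i == j)%:R).
    have H0 : is_derive x (delta_mx ord0 j) (fun _ : V => a) 0 by exact: is_derive_cst.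
    by apply: (is_derive_eq (is_derive_ptD H0 (is_derive_ptZ b (is_derive_coord_delta i j x)))); rewrite add0r.
  exact: (is_derive_chain (f := fun x : V => a + b * x ord0 i) (is_derive_pospX m _) H1).
- by move=> j; apply: class_CM; [exact: class_CZ|exact: class_C_cst].
Qed.

Lemma class_C_spl (a b : R) (i : 'I_n.+1) : class_C 3 (fun x : V => spl (a + b * x ord0 i)).
Proof.
have E : (fun x : V => spl (a + b * x ord0 i)) = (fun x : V => 24^-1 *
  (posp (a + b * x ord0 i) ^+ 4 + (- 4) * posp ((a + (- 1)) + b * x ord0 i) ^+ 4
   + 6 * posp ((a + (- 2)) + b * x ord0 i) ^+ 4
   + (- 4) * posp ((a + (- 3)) + b * x ord0 i) ^+ 4 + posp ((a + (- 4)) + b * x ord0 i) ^+ 4)).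
  by apply/funext => x; rewrite /spl ![_ + _ + b * _]addrAC.
rewrite E; have P u := @class_C_posp 3 u b i.
exact: (class_CZ _ (class_CD (class_CD (class_CD (class_CD (P _) (class_CZ _ (P _)))
  (class_CZ _ (P _))) (class_CZ _ (P _))) (P _))).
Qed.

(** For the max norm a product of one-variable steps is enough: each factor is 1 when the coordinate
    is at most M in absolute value, and some factor is 0 as soon as one coordinate exceeds M + 4.
    Class C^3 is what the representation formula asks for. *)
Definition cutf (M : R) (x : V) : R :=
  \prod_i (spl ((M + 4) + (- 1) * x ord0 i) * spl ((M + 4) + 1 * x ord0 i)).

Lemma class_C_cut M : class_C 3 (cutf M).
Proof.
rewrite /cutf; elim: (index_enum _) => [|i s IH].
  have -> : (fun x : V => \prod_(i <- [::])
    (spl ((M + 4) + (- 1) * x ord0 i) * spl ((M + 4) + 1 * x ord0 i))) = (fun=> 1).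
    by apply/funext => x; rewrite big_nil.
  exact: class_C_cst.
have -> : (fun x : V => \prod_(i <- i :: s)
    (spl ((M + 4) + (- 1) * x ord0 i) * spl ((M + 4) + 1 * x ord0 i))) =
  (fun x => (spl ((M + 4) + (- 1) * x ord0 i) * spl ((M + 4) + 1 * x ord0 i)) *
    \prod_(i <- s) (spl ((M + 4) + (- 1) * x ord0 i) * spl ((M + 4) + 1 * x ord0 i))).
  by apply/funext => x; rewrite big_cons.
exact: (class_CM (class_CM (class_C_spl _ _ i) (class_C_spl _ _ i)) IH).
Qed.

Lemma cut1 M x : `|x| <= M -> cutf M x = 1.
Proof.
move=> xM; rewrite /cutf big1// => i _.
have := le_trans (coord_le_norm x i) xM; rewrite ler_norml => /andP[a b].
by rewrite !spl1 ?mulr1//; lra.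
Qed.

Lemma cut0 M x : 0 <= M -> M + 4 < `|x| -> cutf M x = 0.
Proof.
move=> M0 xM.
have /existsP[i iM] : [exists i, M + 4 < `|x ord0 i|].
  rewrite -[X in is_true X]negbK negb_exists; apply/negP => /forallP H.
  move: xM; rewrite ltNge => /negP; apply.
  by rewrite rV_norm_le ?addr_ge0//; apply/forallP => i; have := H i; rewrite -leNgt.
rewrite /cutf (bigD1 i)//=.
have [xi|xi] := leP 0 (x ord0 i).
  by rewrite ger0_norm// in iM; rewrite spl0 ?mul0r//; lra.
by rewrite ltr0_norm// in iM; rewrite [X in _ * X * _]spl0 ?mulr0 ?mul0r//; lra.
Qed.

End cutoff.

Section rintegral_tools.
Context d (T : measurableType d) {R : realType} (m : {measure set T -> \bar R}).

Lemma integrable_le (f g : T -> R) : measurable_fun [set: T] f ->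
  m.-integrable [set: T] (EFin \o g) -> (forall x, `|f x| <= g x) ->
  m.-integrable [set: T] (EFin \o f).
Proof.
move=> mf ig fg; apply: (le_integrable measurableT _ _ ig); first exact/measurable_EFinP.
by move=> x _ /=; rewrite lee_fin (le_trans (fg x))// ler_norm.
Qed.

Lemma Rintegral_sum (I : Type) (s : seq I) (f : I -> T -> R) :
  (forall i, m.-integrable [set: T] (EFin \o f i)) ->
  m.-integrable [set: T] (EFin \o (fun x => \sum_(i <- s) f i x)) /\
  \int[m]_x (\sum_(i <- s) f i x) = \sum_(i <- s) \int[m]_x f i x.
Proof.
move=> If; elim: s => [|i s [IH1 IH2]].
  split; last by rewrite big_nil; under eq_Rintegral do rewrite big_nil; rewrite Rintegral_cst// mul0r.
  by apply: eq_integrable (integrable0 m setT) => // x _; rewrite /= big_nil.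
have E : (fun x => \sum_(j <- i :: s) f j x) = (fun x => f i x + \sum_(j <- s) f j x).
  by apply/funext => x; rewrite big_cons.
rewrite E; split; last by rewrite big_cons -IH2 RintegralD.
exact: (integrableD measurableT (If i) IH1).
Qed.

End rintegral_tools.

(** * Local integrability of |x|^-2 *)

Section inverse_square_integrable.
Context {R : realType}.
Notation V := 'rV[R]_3.

Definition epsn (n : nat) : R := n.+1%:R^-1.

Lemma epsn_neq0 n : epsn n != 0. Proof. by rewrite invr_eq0 pnatr_eq0. Qed.
Lemma epsn_ge0 n : 0 <= epsn n. Proof. by rewrite invr_ge0. Qed.
Lemma epsn_cvg0 : epsn n @[n --> \oo] --> (0 : R). Proof. exact: cvg_harmonic. Qed.

Lemma cvg_qe (x : V) : x != 0 -> qe (epsn n) x @[n --> \oo] --> qe 0 x.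
Proof.
move=> x0.
have H1 : dot x x + epsn n ^+ 2 @[n --> \oo] --> dot x x + 0 ^+ 2.
  by apply: (cvgD (cvg_cst _)); rewrite expr2; apply: (cvgM epsn_cvg0 epsn_cvg0).
have H2 := cvg_comp _ _ H1 (@sqrt_continuous R (dot x x + 0 ^+ 2)).
by apply: cvgV H2; rewrite gt_eqF// sqrtr_gt0 den_gt0// x0 orbT.
Qed.

(** The field x / (|x|^2 + e^2) has divergence q^2 + 2 e^2 q^4 >= q^2, where q = [qe e x].
    Integrated against the squared cut-off, the derivative falls on the cut-off, which gives a bound
    independent of e. *)
Let div_bound (M : R) : 1 <= M -> exists C : R, forall n,
  \int[leb3]_x (qe (epsn n) x ^+ 2 * cutf M x ^+ 2) <= C.
Proof.
move=> M1; have M0 : 0 <= M by exact: le_trans M1.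
pose g (x : V) := cutf M x ^+ 2.
have gC : class_C 3 g by apply: class_CX; exact: class_C_cut.
have gC1 : class_C 1 g by exact: class_C_le gC.
have g0 x : M + 4 < `|x| -> g x = 0 by move=> /(cut0 M0); rewrite /g => ->; rewrite expr0n.
have pg0 i x : M + 4 < `|x| -> partial i g x = 0 by apply: partial_support; exact: g0.
have pgi i x : `|x| < M -> partial i g x = 0.
  move=> xM; apply: is_derive_partial.
  have o : open [set y : V | `|y| < M].
    have -> : [set y : V | `|y| < M] = (fun y : V => `|y|) @^-1` [set r : R | r < M] by [].
    by apply: open_comp; [move=> y _; exact: norm_continuous|exact: open_lt].
  have N : \forall y \near x, (fun=> 1) y = g y.
    move: (open_nbhs_nbhs (conj o xM : open_nbhs x _)); apply: filterS => y My.
    by rewrite /g cut1 ?expr1n// ltW.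
  have H : is_derive x (delta_mx ord0 i) (fun _ : V => 1 : R) 0 by exact: is_derive_cst.
  exact: (near_eq_is_derive N H).
have cpg i := class_C_cont (class_C_partial i gC1).
have Ipg i : leb3.-integrable [set: V] (EFin \o (fun x => `|partial i g x|)).
  apply: (@continuous_support_integrable _ _ (M + 4)).
    move=> x; have h : {for x, continuous (partial i g)} by exact: cpg.
    exact: (cvg_norm h).
  by move=> x /pg0 ->; rewrite normr0.
exists (\sum_i \int[leb3]_x `|partial i g x|) => n.
have e0 := epsn_neq0 n; set e := epsn n in e0 *.
have qC : class_C 1 (qe (R := R) e) by exact: class_C_qe.
pose f i (x : V) := x ord0 i * qe e x ^+ 2.
have fC i : class_C 1 (f i) by apply: class_CM; [exact: class_C_coord|exact: class_CX].
have pf i x : partial i (f i) x = qe e x ^+ 2 - 2 * x ord0 i ^+ 2 * qe e x ^+ 4.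
  have N0 : 0 < dot x x + e ^+ 2 by rewrite den_gt0 ?e0.
  apply: is_derive_partial.
  apply: (is_derive_eq (is_derive_ptM (is_derive_coord_delta i i x) (is_derive_ptX 1 (is_derive_qe i N0)))).
  by rewrite eqxx /= mulr1n; ring.
have cq := class_C_cont (class_CM (class_CX 2 qC) gC1).
have Iq : leb3.-integrable [set: V] (EFin \o (fun x => qe e x ^+ 2 * g x)).
  apply: (@continuous_support_integrable _ _ (M + 4) cq).
  by move=> x /g0 ->; rewrite mulr0.
have Ipf i : leb3.-integrable [set: V] (EFin \o (fun x => partial i (f i) x * g x)).
  apply: (@continuous_support_integrable _ _ (M + 4)).
    exact: (contM (class_C_cont (class_C_partial i (fC i))) (class_C_cont gC1)).
  by move=> x /g0 ->; rewrite mulr0.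
have Ifp i : leb3.-integrable [set: V] (EFin \o (fun x => f i x * partial i g x)).
  apply: (@continuous_support_integrable _ _ (M + 4)).
    exact: (contM (class_C_cont (fC i)) (cpg i)).
  by move=> x /pg0 ->; rewrite mulr0.
have step1 : \int[leb3]_x (qe e x ^+ 2 * g x) <=
    \int[leb3]_x (\sum_i partial i (f i) x * g x).
  apply: le_Rintegral => //.
    exact: (Rintegral_sum (index_enum 'I_3) Ipf).1.
  move=> x _; rewrite -mulr_suml ler_wpM2r ?sqr_ge0//.
  rewrite sum_ord3 !pf.
  have N0 : 0 < dot x x + e ^+ 2 by rewrite den_gt0 ?e0.
  have := qe2 N0; rewrite /dot sum_ord3 => H.
  have -> : qe e x ^+ 2 - 2 * x ord0 0 ^+ 2 * qe e x ^+ 4 +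
    (qe e x ^+ 2 - 2 * x ord0 1 ^+ 2 * qe e x ^+ 4) +
    (qe e x ^+ 2 - 2 * x ord0 2 ^+ 2 * qe e x ^+ 4) =
    3 * qe e x ^+ 2 - 2 * qe e x ^+ 2 * ((x ord0 0 * x ord0 0 + x ord0 1 * x ord0 1 + x ord0 2 * x ord0 2 + e ^+ 2) * qe e x ^+ 2)
    + 2 * (e * qe e x ^+ 2) ^+ 2 by ring.
  rewrite H mulr1 -mulrBl (_ : 3 - 2 = 1); last by ring.
  by rewrite mul1r lerDl mulr_ge0// sqr_ge0.
apply: (le_trans step1).
rewrite (Rintegral_sum (index_enum 'I_3) Ipf).2.
apply: ler_sum => i _.
have -> : \int[leb3]_x (partial i (f i) x * g x) = - \int[leb3]_x (f i x * partial i g x).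
  by rewrite (leb3_by_parts i (fC i) gC1 g0) opprK.
apply: (le_trans (ler_norm _)); rewrite normrN.
apply: (le_trans (le_normr_Rintegral measurableT (Ifp i))).
apply: le_Rintegral => //; first exact: integrable_norm (Ifp i).
move=> x _; rewrite normrM -[leRHS]mul1r.
(* The cut-off is constant on the ball, so only |x| >= M >= 1 contributes; there both |x_i| q and q
   are at most 1. *)
have [xM|xM] := ltP `|x| M; first by rewrite pgi// normr0 !mulr0.
apply: ler_wpM2r => //.
rewrite /f normrM normrX expr2 mulrA -[leRHS]mulr1 (ger0_norm (qe_ge0 _ _)).
apply: ler_pM; rewrite ?mulr_ge0 ?qe_ge0 ?qe_coord_le//.
have [k xk] : exists k, M <= `|x ord0 k|.
  apply/existsP; rewrite -[X in is_true X]negbK negb_exists; apply/negP => /forallP H.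
  move: xM; rewrite leNgt => /negP; apply; apply: rV_norm_lt; first exact: lt_le_trans M1.
  by move=> k; have := H k; rewrite -ltNge.
apply: le_trans (qe_coord_le e x k).
by rewrite -[leLHS]mul1r ler_wpM2r ?qe_ge0// (le_trans M1).
Qed.

(** Fatou's lemma as e tends to 0, the regularised integrals being bounded by [div_bound]. *)
Lemma integrable_cut_qe2 (M : R) : 1 <= M ->
  leb3.-integrable [set: V] (EFin \o (fun x => qe 0 x ^+ 2 * cutf M x ^+ 2)).
Proof.
move=> M1; have [C HC] := div_bound M1.
have M0 : 0 <= M by exact: le_trans M1.
have mcut : measurable_fun [set: V] (fun x => cutf M x ^+ 2 : measurableTypeR R).
  exact: continuous_measurable_rV (class_C_cont (class_CX 2 (class_C_cut _ M))).
have mq e : measurable_fun [set: V] (fun x : V => qe e x ^+ 2 * cutf M x ^+ 2 : measurableTypeR R).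
  exact: (measurable_funM (measurable_funX 2 (measurable_qe e)) mcut).
apply/integrableP; split; first by apply/measurable_EFinP; exact: mq.
(* At the origin the regularised kernel tends to infinity while [qe 0] is 0 there; setting the value
   to 0 makes the limit correct at every point. *)
pose F n (x : V) : \bar R := if x == 0 then 0%E else (qe (epsn n) x ^+ 2 * cutf M x ^+ 2)%:E.
have mF n : measurable_fun [set: V] (F n).
  apply: measurable_fun_ifT.
  - apply: (measurable_fun_bool true); rewrite setTI.
    have -> : (fun x : V => x == 0) @^-1` [set true] = [set 0].
      by apply/seteqP; split => [x /eqP //|x -> /=]; rewrite eqxx.
    have -> : [set 0] = [set x : V | `|x| <= 0].
      by apply/seteqP; split => [x ->|x /=]; rewrite /= ?normr0// normr_le0 => /eqP.
    exact: measurable_norm_le.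
  - exact: measurable_cst.
  - by apply/measurable_EFinP; exact: mq.
have F0 n x : (0 <= F n x)%E by rewrite /F; case: ifP => // _; rewrite lee_fin mulr_ge0// sqr_ge0.
have lim x : limn_einf (fun n => F n x) = `|(qe 0 x ^+ 2 * cutf M x ^+ 2)%:E|%E.
  have [x0|x0] := eqVneq x 0.
    have -> : (fun n => F n x) = cst 0%E by apply/funext => n; rewrite /F x0 eqxx.
    rewrite is_cvg_limn_einfE; last exact: is_cvg_cst.
    by rewrite lim_cst// x0 /qe /dot big1 ?expr0n ?add0r ?sqrtr0 ?invr0 ?expr0n ?mul0r ?abse0// => i _; rewrite mxE mul0r.
  have c : F n x @[n --> \oo] --> (qe 0 x ^+ 2 * cutf M x ^+ 2)%:E.
    rewrite /F (negPf x0); apply: cvg_EFin; first exact: nearW.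
    have h := cvg_qe x0.
    by apply: (cvgM _ (cvg_cst _)); rewrite expr2; apply: (cvgM h h).
  have [-> _] := cvg_limn_einf_sup c.
  by rewrite gee0_abs// lee_fin mulr_ge0// sqr_ge0.
have := fatou (@leb3 R) measurableT mF (fun n x _ => F0 n x).
have -> : (\int[leb3]_x limn_einf (F ^~ x) = \int[leb3]_x `|(qe 0 x ^+ 2 * cutf M x ^+ 2)%:E|)%E.
  by apply: eq_integral => x _; rewrite lim.
move=> H; apply: (@le_lt_trans _ _ C%:E); last exact: ltry.
apply: (le_trans H); rewrite limn_einf_lim.
apply: lime_le; first exact: is_cvg_einfs.
apply: nearW => n.
have I : leb3.-integrable [set: V] (EFin \o (fun x => qe (epsn n) x ^+ 2 * cutf M x ^+ 2)).
  apply: (@continuous_support_integrable _ _ (M + 4)).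
    have qC : class_C 0 (qe (R := R) (epsn n)) by apply: class_C_qe; exact: epsn_neq0.
    exact: (class_C_cont (class_CM (class_CX 2 qC) (class_CX 2 (class_C_le (leq0n 3) (class_C_cut _ M))))).
  by move=> x /(cut0 M0) ->; rewrite expr0n mulr0.
apply: (@le_trans _ _ (\int[leb3]_x F n x)%E).
  by apply: ereal_inf_lbound; exists n => /=.
apply: (@le_trans _ _ (\int[leb3]_x (qe (epsn n) x ^+ 2 * cutf M x ^+ 2)%:E)%E).
  apply: ge0_le_integral => //.
  - by apply/measurable_EFinP; exact: mq.
  - by move=> x _; rewrite /F; case: ifP => // _; rewrite lee_fin mulr_ge0// sqr_ge0.
have := HC n; rewrite -lee_fin /Rintegral fineK//.
exact: (integrable_fin_num measurableT I).
Qed.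

End inverse_square_integrable.

Section kernel_bounds.
Context {R : realType}.
Notation V := 'rV[R]_3.
Variable c : R.

Let bd1 (k t : R) : `|t| <= 1 -> `|k * t| <= `|k|.
Proof. by move=> t1; rewrite normrM ler_piMr. Qed.

Let bdM (s t : R) : `|s| <= 1 -> `|t| <= 1 -> `|s * t| <= 1.
Proof. by move=> s1 t1; rewrite normrM mulr_ile1. Qed.

Let bdb (b : bool) : `|b%:R : R| <= 1.
Proof. by case: b; rewrite ?normr1 ?normr0. Qed.

Let u_le e (x : V) i : `|x ord0 i * qe e x| <= 1.
Proof. by rewrite normrM (ger0_norm (qe_ge0 _ _)) qe_coord_le. Qed.

Let v_le e (x : V) : `|e * qe e x| <= 1.
Proof. by rewrite normrM (ger0_norm (qe_ge0 _ _)) qe_eps_le. Qed.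

(** Apart from one factor q = [qe e x], everything is a polynomial in x_i q and e q, which are at
    most 1 in absolute value; so the bound is uniform in e. The same argument with two factors q
    bounds [dGam]. *)
Lemma Gam_bound e i j (x : V) : `|Gam c e i j x| <= (`|2 - c| + 1 + `|c|) * qe e x.
Proof.
have -> : Gam c e i j x = ((2 - c) * (i == j)%:R +
    (i == j)%:R * ((e * qe e x) * (e * qe e x)) +
    c * ((x ord0 i * qe e x) * (x ord0 j * qe e x))) * qe e x by rewrite /Gam; ring.
rewrite normrM (ger0_norm (qe_ge0 _ _)) ler_wpM2r ?qe_ge0//.
apply: (le_trans (ler_normD _ _)); apply: lerD; last by apply: bd1; exact: bdM.
apply: (le_trans (ler_normD _ _)); apply: lerD; first exact: bd1.
by apply: bdM => //; exact: bdM.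
Qed.

Lemma dGam_bound e k i j (x : V) :
  `|dGam c e k i j x| <= (`|2 - c| + 3 + (`|c| + `|c| + 3 * `|c|)) * qe e x ^+ 2.
Proof.
have -> : dGam c e k i j x = ((2 - c) * (- (i == j)%:R * (x ord0 k * qe e x)) +
    (- 3) * ((i == j)%:R * ((e * qe e x) * (e * qe e x)) * (x ord0 k * qe e x)) +
    (c * ((k == i)%:R * (x ord0 j * qe e x)) + c * ((k == j)%:R * (x ord0 i * qe e x))
    + (- 3 * c) * ((x ord0 i * qe e x) * (x ord0 j * qe e x) * (x ord0 k * qe e x))))
    * qe e x ^+ 2 by rewrite /dGam; ring.
rewrite normrM (ger0_norm (sqr_ge0 (qe e x))) ler_wpM2r ?sqr_ge0//.
have n3 : `|- 3 : R| = 3 by rewrite normrN ger0_norm.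
apply: (le_trans (ler_normD _ _)); apply: lerD.
  apply: (le_trans (ler_normD _ _)); apply: lerD.
    by apply: bd1; apply: bdM => //; rewrite normrN.
  by rewrite -[leRHS]n3; apply: bd1; do 2 apply: bdM => //; exact: bdM.
apply: (le_trans (ler_normD _ _)); apply: lerD.
  by apply: (le_trans (ler_normD _ _)); apply: lerD; apply: bd1; exact: bdM.
rewrite -[X in _ <= X * _]n3 -normrM; apply: bd1; apply: bdM => //; exact: bdM.
Qed.

Lemma measurable_Gam e i j : measurable_fun [set: V] (Gam c e i j : V -> measurableTypeR R).
Proof.
have mq := measurable_qe (R := R) e; have mx k := @measurable_coord R 2 k.
have mq3 := measurable_funX 3 mq.
exact: (measurable_funD (measurable_funM (measurable_cst _)
  (measurable_funD (measurable_funM (measurable_cst _) mq) (measurable_funM (measurable_cst _) mq3)))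
  (measurable_funM (measurable_cst _) (measurable_funM (measurable_funM (mx i) (mx j)) mq3))).
Qed.

Lemma measurable_dGam e k i j : measurable_fun [set: V] (dGam c e k i j : V -> measurableTypeR R).
Proof.
have mq := measurable_qe (R := R) e; have mx l := @measurable_coord R 2 l.
have mq3 := measurable_funX 3 mq; have mq5 := measurable_funX 5 mq.
have mc a : measurable_fun [set: V] (fun _ : V => a : measurableTypeR R) by exact: measurable_cst.
have E : dGam c e k i j = (fun x =>
  (i == j)%:R * (- (2 - c) * (x ord0 k * qe e x ^+ 3) + (- 3 * e ^+ 2) * (x ord0 k * qe e x ^+ 5)) +
  c * (((k == i)%:R * (x ord0 j * qe e x ^+ 3) + (k == j)%:R * (x ord0 i * qe e x ^+ 3))
       + (- 3) * (x ord0 i * (x ord0 j * (x ord0 k * qe e x ^+ 5))))).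
  by apply/funext => y; rewrite /dGam; ring.
rewrite E.
exact: (measurable_funD
  (measurable_funM (mc _) (measurable_funD (measurable_funM (mc _) (measurable_funM (mx k) mq3))
    (measurable_funM (mc _) (measurable_funM (mx k) mq5))))
  (measurable_funM (mc _) (measurable_funD (measurable_funD
    (measurable_funM (mc _) (measurable_funM (mx j) mq3))
    (measurable_funM (mc _) (measurable_funM (mx i) mq3)))
    (measurable_funM (mc _) (measurable_funM (mx i) (measurable_funM (mx j) (measurable_funM (mx k) mq5))))))).
Qed.

Lemma cvg_qeX m (x : V) : x != 0 -> qe (epsn n) x ^+ m @[n --> \oo] --> qe 0 x ^+ m.
Proof.
move=> x0; elim: m => [|m IH]; first exact: cvg_cst.
under eq_fun do rewrite exprS; rewrite exprS.
exact: (cvgM (cvg_qe x0) IH).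
Qed.

Lemma cvg_eps2 : epsn n ^+ 2 @[n --> \oo] --> (0 : R) ^+ 2.
Proof. by under eq_fun do rewrite expr2; rewrite expr2; exact: (cvgM epsn_cvg0 epsn_cvg0). Qed.

Lemma cvg_Gam i j (x : V) : x != 0 -> Gam c (epsn n) i j x @[n --> \oo] --> Gam c 0 i j x.
Proof.
move=> x0; have q1 := cvg_qe x0; have q3 := cvg_qeX (m := 3) x0.
exact: (cvgD (cvgM (cvg_cst _) (cvgD (cvgM (cvg_cst _) q1) (cvgM cvg_eps2 q3)))
  (cvgM (cvg_cst _) (cvgM (cvg_cst _) q3))).
Qed.

Lemma cvg_dGam k i j (x : V) : x != 0 ->
  dGam c (epsn n) k i j x @[n --> \oo] --> dGam c 0 k i j x.
Proof.
move=> x0; have q3 := cvg_qeX (m := 3) x0; have q5 := cvg_qeX (m := 5) x0.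
exact: (cvgD (cvgM (cvg_cst _) (cvgB (cvgM (cvg_cst _) q3)
    (cvgM (cvgM (cvgM (cvg_cst _) cvg_eps2) (cvg_cst _)) q5)))
  (cvgM (cvg_cst _) (cvgB (cvgD (cvgM (cvg_cst _) q3) (cvgM (cvg_cst _) q3)) (cvgM (cvg_cst _) q5)))).
Qed.

End kernel_bounds.

Section translation_and_singular_limits.
Context {R : realType}.
Notation V := 'rV[R]_3.

Lemma measurable_translate (y : V) : measurable_fun [set: V] (fun x : V => x - y).
Proof.
apply: measurable_to_rV => i.
under eq_fun do rewrite !mxE.
by apply: measurable_funD; [exact: measurable_coord|exact: measurable_cst].
Qed.

Lemma integrable_translate (f : V -> R) (y : V) : measurable_fun [set: V] f ->
  leb3.-integrable [set: V] (EFin \o f) ->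
  leb3.-integrable [set: V] (EFin \o (fun x => f (x - y))) /\
  \int[leb3]_x f (x - y) = \int[leb3]_x f x.
Proof.
move=> mf If; have mt := measurable_translate y.
pose t (x : V) : V := x - y; pose ft (x : V) : R := f (t x).
have mfy : measurable_fun [set: V] ft by exact: (measurableT_comp mf mt).
have mEf : measurable_fun [set: V] (EFin \o f) by apply/measurable_EFinP; exact: mf.
have E A : measurable A -> A `<=` [set: V] -> pushforward leb3 t A = leb3 A.
  by move=> mA _; exact: leb3_translate.
have Iy : leb3.-integrable [set: V] (EFin \o ft).
  apply/integrableP; split; first by apply/measurable_EFinP; exact: mfy.
  have mabs : measurable_fun [set: V] (abse \o EFin \o f).
    by apply: (measurableT_comp _ mEf).
  have := ge0_integral_pushforward (phi := t) mt (@leb3 R) measurableT mabs (fun y _ => abse_ge0 _).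
  rewrite preimage_setT => H.
  have K : (\int[leb3]_x ((abse \o EFin \o f) \o t) x < +oo)%E.
    rewrite -H (eq_measure_integral (@leb3 R) E); last exact: mt.
    by move/integrableP : If => [].
  exact: K.
split=> //; congr fine.
have := integral_pushforward (phi := t) mt (mu := @leb3 R) (D := setT) mEf.
rewrite preimage_setT => /(_ Iy measurableT) H.
have K : (\int[leb3]_x ((EFin \o f) \o t) x = \int[leb3]_x (EFin \o f) x)%E.
  by rewrite -H (eq_measure_integral (@leb3 R) E).
exact: K.
Qed.

(** The last coordinate is the outer factor of the product measure, so one application of the
    product formula is enough; null planes make points null. *)
Lemma leb3_plane0 (i : 'I_3) (a : R) : i = 2 -> leb3 [set x : V | x ord0 i = a] = 0%E.
Proof.
move=> ->; rewrite /leb3 /pushforward.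
have -> : rV3 @^-1` [set x : V | x ord0 2 = a] = setT `*` [set a].
  by apply/seteqP; split => -[[b1 b2] b] /=; rewrite mxE //= => -[].
have E := @product_measure1E _ _ _ _ R (@lebesgue2 R) (@lebesgue_measure R) setT [set a] measurableT (measurable_set1 a).
by rewrite [LHS]E [X in (_ * X)%E](_ : _ = 0%E) ?mule0//; exact: lebesgue_measure_set1.
Qed.

Lemma ae_neq (y : V) (P : V -> Prop) : (forall x, x != y -> P x) -> {ae leb3, forall x, P x}.
Proof.
move=> H; exists [set x : V | x ord0 2 = y ord0 2]; split.
- have -> : [set x : V | x ord0 2 = y ord0 2] = (fun x : V => x ord0 2) @^-1` [set y ord0 2] by [].
  by rewrite -[X in measurable X]setTI; apply: measurable_coord => //; exact: measurable_set1.
- exact: leb3_plane0.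
- move=> x /= nP; have [->//|xy] := eqVneq x y.
  by case: nP; exact: H.
Qed.

(** Dominated convergence with majorant B (1 + |x - y|^-2), cut off and translated to y. The
    hypotheses are stated off the point y, where the kernels have their singularity. *)
Lemma singular_dominated_cvg (y : V) (M B : R) (F : nat -> V -> R) (F0 : V -> R) :
  0 <= M -> 0 <= B ->
  (forall n, measurable_fun [set: V] (F n)) -> measurable_fun [set: V] F0 ->
  (forall n x, x != y -> `|F n x| <= B * (1 + qe 0 (x - y) ^+ 2)) ->
  (forall n x, M < `|x| -> F n x = 0) ->
  (forall x, x != y -> F n x @[n --> \oo] --> F0 x) ->
  leb3.-integrable [set: V] (EFin \o F0) /\
  \int[leb3]_x F n x @[n --> \oo] --> \int[leb3]_x F0 x.
Proof.
move=> M0 B0 mF mF0 Fb Fs Fc.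
(* Chosen so that the cut-off is 1 at x - y whenever |x| <= M; the summand 1 meets the requirement
   of [integrable_cut_qe2]. *)
pose M' := M + `|y| + 1.
have M'1 : 1 <= M' by rewrite /M' lerDr addr_ge0.
have M'0 : 0 <= M' by exact: le_trans M'1.
pose D (z : V) := B * (cutf M' z ^+ 2 + qe 0 z ^+ 2 * cutf M' z ^+ 2).
have cutC : class_C 0 (fun z : V => cutf M' z ^+ 2).
  by apply: class_CX; exact: class_C_le (leq0n 3) (class_C_cut _ _).
have mcut : measurable_fun [set: V] (fun z : V => cutf M' z ^+ 2 : measurableTypeR R).
  exact: continuous_measurable_rV (class_C_cont cutC).
have Icut : leb3.-integrable [set: V] (EFin \o (fun z : V => cutf M' z ^+ 2)).
  apply: (continuous_support_integrable (M := M' + 4) (class_C_cont cutC)) => x.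
  by move=> /(cut0 M'0) ->; rewrite expr0n.
have mD : measurable_fun [set: V] (D : V -> measurableTypeR R).
  apply: measurable_funM; first exact: measurable_cst.
  exact: (measurable_funD mcut (measurable_funM (measurable_funX 2 (measurable_qe 0)) mcut)).
have ID : leb3.-integrable [set: V] (EFin \o D).
  exact: (integrableZl measurableT B (integrableD measurableT Icut (integrable_cut_qe2 M'1))).
have [ID' _] := integrable_translate y mD ID.
have FD n x : x != y -> `|F n x| <= D (x - y).
  move=> xy; have [xM|xM] := leP `|x| M.
    rewrite /D cut1 ?expr1n ?mulr1; first exact: Fb.
    by rewrite /M' (le_trans (ler_normB _ _))// -addrA lerD// lerDl.
  by rewrite Fs// normr0 /D mulr_ge0// addr_ge0 ?sqr_ge0// mulr_ge0// sqr_ge0.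
have [] := @dominated_convergence _ _ R (@leb3 R) setT measurableT (fun n => EFin \o F n) (EFin \o F0) (EFin \o (fun x => D (x - y))).
- by move=> n; apply/measurable_EFinP; exact: mF.
- by apply/measurable_EFinP; exact: mF0.
- by apply: (ae_neq (y := y)) => x xy _; apply: cvg_EFin; [exact: nearW|exact: Fc].
- exact: ID'.
- by apply: (ae_neq (y := y)) => x xy n _; rewrite /= lee_fin; exact: FD.
move=> IF0 _ H; split=> //.
have E : (\int[leb3]_x (F0 x)%:E)%E = (\int[leb3]_x F0 x)%:E.
  by rewrite /Rintegral fineK// (integrable_fin_num measurableT IF0).
move: H; rewrite /= E => H; exact: (fine_cvg H).
Qed.

End translation_and_singular_limits.

Section finite_sum_rearrangements.
Context {R : comNzRingType}.
Implicit Types (f m n u : R).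

Lemma sum_distl (I : finType) f m n (a b : I -> R) :
  f * (m * (\sum_k a k) + n * (\sum_k b k)) = \sum_k (m * (f * a k) + n * (f * b k)).
Proof.
rewrite big_split/= mulrDr; congr (_ + _); rewrite !mulr_sumr; apply: eq_bigr => k _;
  by rewrite mulrCA.
Qed.

Lemma sum_distr (I : finType) u m n (a b : I -> R) :
  \sum_k (m * (a k * u) + n * (b k * u)) = u * (m * (\sum_k a k) + n * (\sum_k b k)).
Proof.
by rewrite sum_distl; apply: eq_bigr => k _; rewrite ![u * _]mulrC.
Qed.

Lemma double_sum_swap (I : finType) m n (A B : I -> I -> R) :
  \sum_i \sum_k (m * A i k + n * B k i) = \sum_i \sum_k (m * A i k + n * B i k).
Proof.
under eq_bigr do rewrite big_split/=.
under [RHS]eq_bigr do rewrite big_split/=.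
rewrite !big_split/=; congr (_ + _); exact: exchange_big.
Qed.

End finite_sum_rearrangements.

Section representation.
Context {R : realType}.
Notation V := 'rV[R]_3.
Variables (lambda mu : R).
Hypotheses (mu_gt0 : 0 < mu) (lame : 0 < 3 * lambda + 2 * mu).

Local Notation c := ((lambda + mu) / (lambda + 2 * mu)).

Definition navier (v : 'I_3 -> V -> R) i (x : V) : R :=
  mu * laplacian (v i) x + (lambda + mu) * partial i (fun x => \sum_k partial k (v k) x) x.

Lemma leb3_by_parts2 (f u : V -> R) M k l : class_C 2 f -> class_C 2 u ->
  (forall x, M < `|x| -> u x = 0) ->
  \int[leb3]_x (f x * partial k (partial l u) x) = \int[leb3]_x (partial l (partial k f) x * u x).
Proof.
move=> fC uC u0.
rewrite (leb3_by_parts k (class_CW fC) (class_C_partial l uC) (partial_support l u0)).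
by rewrite (leb3_by_parts l (class_C_partial k fC) (class_CW uC) u0) opprK.
Qed.

Lemma product_integrable (f u : V -> R) M : continuous f -> continuous u ->
  (forall x, M < `|x| -> u x = 0) -> leb3.-integrable [set: V] (EFin \o (fun x => f x * u x)).
Proof.
move=> cf cu u0; apply: (continuous_support_integrable (M := M) (contM cf cu)) => x.
by move=> /u0 ->; rewrite mulr0.
Qed.

Section regularized.
Variables (v : 'I_3 -> V -> R) (M e : R) (j : 'I_3) (y : V).
Hypotheses (vC : forall i, class_C 2 (v i)) (v0 : forall i x, M < `|x| -> v i x = 0)
  (e0 : e != 0).

Let f i (x : V) : R := Gam c e i j (x - y).

Let fC m i : class_C m (f i).
Proof. by apply: class_C_translate; exact: class_C_Gam. Qed.

Let pf k i : partial k (f i) = (fun x => dGam c e k i j (x - y)).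
Proof.
apply/funext => x; rewrite (partial_translate _ _ _ (class_C_Gam c 1 i j e0)).
by rewrite partial_Gam.
Qed.

Let ppf l k i : partial l (partial k (f i)) = (fun x => ddGam c e l k i j (x - y)).
Proof.
apply/funext => x; rewrite pf.
have dC : class_C 1 (dGam c e k i j).
  by rewrite -partial_Gam//; apply: class_C_partial; exact: class_C_Gam.
by rewrite (partial_translate _ _ _ dC) partial_dGam.
Qed.

Let vc i k l : continuous (partial k (partial l (v i))).
Proof. exact: (class_C_cont (class_C_partial k (class_C_partial l (vC i)))). Qed.

Let dv0 i k l x : M < `|x| -> partial k (partial l (v i)) x = 0.
Proof. by apply: partial_support; apply: partial_support; exact: v0. Qed.

Let dd l k i i' : leb3.-integrable [set: V] (EFin \o (fun x => ddGam c e l k i j (x - y) * v i' x)).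
Proof.
apply: (product_integrable (M := M)); last exact: v0.
  by rewrite -ppf; exact: (class_C_cont (class_C_partial l (class_C_partial k (fC 2 i)))).
exact: class_C_cont (vC i').
Qed.

Let navier_split i : \int[leb3]_x (f i x * navier v i x) =
  \sum_k (mu * \int[leb3]_x (ddGam c e k k i j (x - y) * v i x) +
    (lambda + mu) * \int[leb3]_x (ddGam c e k i i j (x - y) * v k x)).
Proof.
pose A k (x : V) := f i x * partial k (partial k (v i)) x.
pose B k (x : V) := f i x * partial i (partial k (v k)) x.
have IA k : leb3.-integrable [set: V] (EFin \o A k).
  apply: (product_integrable (M := M)); [exact: class_C_cont (fC 0 i)|exact: vc|exact: dv0].
have IB k : leb3.-integrable [set: V] (EFin \o B k).
  apply: (product_integrable (M := M)); [exact: class_C_cont (fC 0 i)|exact: vc|exact: dv0].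
have IA' k : leb3.-integrable [set: V] (EFin \o (fun x => mu * A k x)).
  exact: integrableZl (IA k).
have IB' k : leb3.-integrable [set: V] (EFin \o (fun x => (lambda + mu) * B k x)).
  exact: integrableZl (IB k).
have IAB k : leb3.-integrable [set: V] (EFin \o (fun x => mu * A k x + (lambda + mu) * B k x)).
  exact: (integrableD measurableT (IA' k) (IB' k)).
transitivity (\int[leb3]_x (\sum_k (mu * A k x + (lambda + mu) * B k x))).
  apply: eq_Rintegral => x _; rewrite /navier /laplacian /A /B.
  rewrite partial_sum; last by move=> k; exact: class_C_partial (vC k).
  exact: sum_distl.
rewrite (Rintegral_sum _ IAB).2; apply: eq_bigr => k _.
apply: (etrans (RintegralD measurableT (IA' k) (IB' k))); congr (_ + _).
  apply: (etrans (RintegralZl mu measurableT (IA k))); congr (_ * _).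
  apply: (etrans (leb3_by_parts2 k k (fC 2 i) (vC i) (@v0 i))).
  by apply: eq_Rintegral => x _; rewrite ppf.
apply: (etrans (RintegralZl (lambda + mu) measurableT (IB k))); congr (_ * _).
apply: (etrans (leb3_by_parts2 i k (fC 2 i) (vC k) (@v0 k))).
by apply: eq_Rintegral => x _; rewrite ppf.
Qed.

(** Two integrations by parts, without boundary terms since v has bounded support, move E to the
    kernel. Exchanging the summation indices in the grad-div part lets E act on the j-th column of
    the matrix, where [Gam_elasticity] applies. *)
Lemma regularized_green :
  \sum_i \int[leb3]_x (Gam c e i j (x - y) * navier v i x) =
  - 15 * mu * \int[leb3]_x (e ^+ 4 * qe e (x - y) ^+ 7 * v j x).
Proof.
transitivity (\sum_i \sum_k (mu * \int[leb3]_x (ddGam c e k k i j (x - y) * v i x) +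
    (lambda + mu) * \int[leb3]_x (ddGam c e k i i j (x - y) * v k x))).
  by apply: eq_bigr => i _; exact: navier_split.
transitivity (\sum_i \sum_k (mu * \int[leb3]_x (ddGam c e k k i j (x - y) * v i x) +
    (lambda + mu) * \int[leb3]_x (ddGam c e i k k j (x - y) * v i x))).
  exact: (double_sum_swap _ _ (fun i k => \int[leb3]_x (ddGam c e k k i j (x - y) * v i x))
    (fun i k => \int[leb3]_x (ddGam c e i k k j (x - y) * v i x))).
have Z i k : mu * \int[leb3]_x (ddGam c e k k i j (x - y) * v i x) +
    (lambda + mu) * \int[leb3]_x (ddGam c e i k k j (x - y) * v i x) =
  \int[leb3]_x (mu * (ddGam c e k k i j (x - y) * v i x) + (lambda + mu) * (ddGam c e i k k j (x - y) * v i x)).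
  apply/esym; apply: (etrans (RintegralD measurableT (integrableZl measurableT mu (dd k k i i))
    (integrableZl measurableT (lambda + mu) (dd i k k i)))).
  by congr (_ + _); [exact: (RintegralZl mu measurableT (dd k k i i))|
    exact: (RintegralZl (lambda + mu) measurableT (dd i k k i))].
have IZ i k : leb3.-integrable [set: V] (EFin \o (fun x =>
    mu * (ddGam c e k k i j (x - y) * v i x) + (lambda + mu) * (ddGam c e i k k j (x - y) * v i x))).
  exact: (integrableD measurableT (integrableZl measurableT mu (dd k k i i)) (integrableZl measurableT (lambda + mu) (dd i k k i))).
pose K i (x : V) := (- 15 * mu * (i == j)%:R) * (e ^+ 4 * qe e (x - y) ^+ 7 * v i x).
have S i : \sum_k (mu * \int[leb3]_x (ddGam c e k k i j (x - y) * v i x) +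
    (lambda + mu) * \int[leb3]_x (ddGam c e i k k j (x - y) * v i x)) = \int[leb3]_x K i x.
  under eq_bigr do rewrite Z.
  rewrite -(Rintegral_sum _ (IZ i)).2; apply: eq_Rintegral => x _.
  have den : 0 < dot (x - y) (x - y) + e ^+ 2 by rewrite den_gt0// e0.
  have := Gam_elasticity i j (x := x - y) erefl (lt0r_neq0 (lame_pos mu_gt0 lame)) den.
  move=> H; rewrite sum_distr H /K.
  by move: (v i x) (qe e (x - y)) (i == j)%:R => a b d; ring.
under eq_bigr do rewrite S.
have cK : continuous (fun x : V => e ^+ 4 * qe e (x - y) ^+ 7).
  exact: (class_C_cont (class_CZ _ (class_CX 7 (class_C_translate (- y) (class_C_qe (R := R) 0 e0))))).
have IK i : leb3.-integrable [set: V] (EFin \o (fun x => e ^+ 4 * qe e (x - y) ^+ 7 * v i x)).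
  by apply: (product_integrable (M := M)); [exact: cK|exact: class_C_cont (vC i)|exact: v0].
rewrite (bigD1 j)//= [X in _ + X]big1 ?addr0 => [|i ij].
  apply: (etrans (RintegralZl (- 15 * mu * (j == j)%:R) measurableT (IK j))).
  by rewrite eqxx mulr1.
apply: (etrans (RintegralZl (- 15 * mu * (i == j)%:R) measurableT (IK i))).
by rewrite (negPf ij) mulr0 mul0r.
Qed.

End regularized.

Section kernel_limits.
Variables (g : V -> R) (M : R) (y : V).
Hypotheses (cg : continuous g) (M0 : 0 <= M) (g0 : forall x, M < `|x| -> g x = 0).

Let mg : measurable_fun [set: V] (g : V -> measurableTypeR R).
Proof. exact: continuous_measurable_rV. Qed.

Let kernel_limit (K : nat -> V -> R) (K0 : V -> R) C : 0 <= C ->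
  (forall n, measurable_fun [set: V] (K n : V -> measurableTypeR R)) ->
  measurable_fun [set: V] (K0 : V -> measurableTypeR R) ->
  (forall n x, x != 0 -> `|K n x| <= C * (1 + qe 0 x ^+ 2)) ->
  (forall x, x != 0 -> K n x @[n --> \oo] --> K0 x) ->
  leb3.-integrable [set: V] (EFin \o (fun x => K0 (x - y) * g x)) /\
  \int[leb3]_x (K n (x - y) * g x) @[n --> \oo] --> \int[leb3]_x (K0 (x - y) * g x).
Proof.
move=> C0 mK mK0 Kb Kc; have [B B0 HB] := continuous_bounded M cg.
have gB x : `|g x| <= B by have [/HB//|/g0 ->] := leP `|x| M; rewrite normr0.
have mt := measurable_translate y.
apply: (@singular_dominated_cvg _ y M (C * B) (fun n x => K n (x - y) * g x)) => //.
- exact: mulr_ge0.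
- by move=> n; exact: (measurable_funM (measurableT_comp (mK n) mt) mg).
- exact: (measurable_funM (measurableT_comp mK0 mt) mg).
- move=> n x xy; rewrite normrM mulrAC ler_pM//.
  by apply: Kb; rewrite subr_eq0.
- by move=> n x /g0 ->; rewrite mulr0.
- move=> x xy; apply: (cvgM (Kc _ _) (cvg_cst _)).
  by rewrite subr_eq0.
Qed.

Lemma Gam_limit i j :
  leb3.-integrable [set: V] (EFin \o (fun x => Gam c 0 i j (x - y) * g x)) /\
  \int[leb3]_x (Gam c (epsn n) i j (x - y) * g x) @[n --> \oo] -->
  \int[leb3]_x (Gam c 0 i j (x - y) * g x).
Proof.
apply: (@kernel_limit (fun n => Gam c (epsn n) i j) _ (`|2 - c| + 1 + `|c|)).
- by rewrite !addr_ge0.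
- by move=> n; exact: measurable_Gam.
- exact: measurable_Gam.
- move=> n x x0; apply: (le_trans (Gam_bound _ _ _ _ _)).
  rewrite ler_wpM2l ?addr_ge0//; apply: (le_trans (qe_le_qe0 _ x0)).
  have := sqr_ge0 (qe 0 x - 1); rewrite sqrrB1 => H.
  have q0 := qe_ge0 0 x.
  rewrite -subr_ge0; move: H q0; set a := qe 0 x; rewrite mulr2n => H q0; lra.
- by move=> x x0; exact: cvg_Gam.
Qed.

Lemma dGam_limit k i j :
  leb3.-integrable [set: V] (EFin \o (fun x => dGam c 0 k i j (x - y) * g x)) /\
  \int[leb3]_x (dGam c (epsn n) k i j (x - y) * g x) @[n --> \oo] -->
  \int[leb3]_x (dGam c 0 k i j (x - y) * g x).
Proof.
apply: (@kernel_limit (fun n => dGam c (epsn n) k i j) _ (`|2 - c| + 3 + (`|c| + `|c| + 3 * `|c|))).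
- by rewrite !addr_ge0// mulr_ge0.
- by move=> n; exact: measurable_dGam.
- exact: measurable_dGam.
- move=> n x x0; apply: (le_trans (dGam_bound _ _ _ _ _ _)).
  rewrite ler_wpM2l ?addr_ge0 ?mulr_ge0//.
  rewrite -[leLHS]add0r lerD// ler_pXn2r ?nnegrE ?qe_ge0//.
  exact: qe_le_qe0.
- by move=> x x0; exact: cvg_dGam.
Qed.

End kernel_limits.

End representation.

(** * The approximate identity and the reproducing property of Kelvin's matrix *)

Section approximate_identity.
Context {R : realType}.
Notation V := 'rV[R]_3.

(** The right-hand side of [Gam_elasticity] up to the factor -15 mu: e^-3 times a fixed profile
    evaluated at x / e. *)
Let K7 n (x : V) : R := epsn n ^+ 4 * qe (epsn n) x ^+ 7.

Lemma lipschitz_support (v : V -> R) M (y : V) : class_C 1 v ->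
  (forall x, M < `|x| -> v x = 0) -> v y = 0 ->
  exists2 L, 0 <= L & forall x, `|v x| <= L * \sum_k `|x ord0 k - y ord0 k|.
Proof.
move=> vC v0 vy.
have pb k : exists2 C, 0 <= C & forall x, `|partial k v x| <= C.
  have [C C0 HC] := continuous_bounded M (class_C_cont (class_C_partial k vC)).
  exists C => // x; have [/HC//|H] := leP `|x| M.
  by rewrite (partial_support k v0 H) normr0.
have [C0 C00 H0] := pb 0; have [C1 C10 H1] := pb 1; have [C2 C20 H2] := pb 2.
exists (C0 + C1 + C2) => [|x]; first by rewrite !addr_ge0.
have [t _ E] : exists2 t, `|t| <= `|1 : R| & v (y + 1 *: (x - y)) - v (y + 0 *: (x - y)) =
    (\sum_k (x - y) ord0 k * partial k v (y + t *: (x - y))) * 1.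
  apply: (@MVT0 _ (fun t => v (y + t *: (x - y))) (fun t => \sum_k (x - y) ord0 k * partial k v (y + t *: (x - y)))) => t _.
  by apply: is_derive_line; exact: class_C1_is_derive.
move: E; rewrite scale1r scale0r addr0 vy subr0 mulr1 addrC subrK => ->.
apply: (le_trans (ler_norm_sum _ _ _)); rewrite mulr_sumr; apply: ler_sum => k _.
rewrite normrM !mxE mulrC ler_wpM2r//.
case: (ord3P k) => ->; [apply: (le_trans (H0 _))|apply: (le_trans (H1 _))|apply: (le_trans (H2 _))].
- by rewrite -addrA lerDl addr_ge0.
- by rewrite addrAC lerDr addr_ge0.
- by rewrite lerDr addr_ge0.
Qed.

Lemma measurable_K7 n : measurable_fun [set: V] (K7 n : V -> measurableTypeR R).
Proof. exact: (measurable_funM (measurable_cst _) (measurable_funX 7 (measurable_qe _))). Qed.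

(** A function vanishing at y is Lipschitz-small there, so one power of |x - y| is gained: kernel
    times v is dominated by a multiple of |x - y|^-2 and tends to 0 away from y. *)
Lemma K7_vanish (v : V -> R) M (y : V) : class_C 1 v -> 0 <= M ->
  (forall x, M < `|x| -> v x = 0) -> v y = 0 ->
  \int[leb3]_x (K7 n (x - y) * v x) @[n --> \oo] --> (0 : R).
Proof.
move=> vC M0 v0 vy; have [L L0 HL] := lipschitz_support vC v0 vy.
have mt := measurable_translate y.
have mv : measurable_fun [set: V] (v : V -> measurableTypeR R).
  exact: continuous_measurable_rV (class_C_cont vC).
have [||||||_] := @singular_dominated_cvg _ y M (L * 3) (fun n x => K7 n (x - y) * v x) (fun=> 0) M0.
- by rewrite mulr_ge0.
- by move=> n; exact: (measurable_funM (measurableT_comp (measurable_K7 n) mt) mv).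
- exact: measurable_cst.
- move=> n x xy; have xy0 : x - y != 0 by rewrite subr_eq0.
  set q := qe (epsn n) (x - y); have q0 : 0 <= q := qe_ge0 _ _.
  have e0 : 0 <= epsn n :> R := epsn_ge0 n.
  have qv : q * `|v x| <= L * 3.
    apply: (@le_trans _ _ (q * (L * \sum_k `|x ord0 k - y ord0 k|))).
      by rewrite ler_wpM2l.
    rewrite mulrCA ler_wpM2l// mulr_sumr.
    have H k : q * `|x ord0 k - y ord0 k| <= 1.
      by have := qe_coord_le (epsn n) (x - y) k; rewrite !mxE mulrC.
    by rewrite sum_ord3 (_ : 3 = 1 + 1 + 1); [rewrite !lerD|ring].
  have eq1 : epsn n * q <= 1.
    by have := qe_eps_le (epsn n) (x - y); rewrite ger0_norm.
  have eq4 : (epsn n * q) ^+ 4 <= 1 by rewrite exprn_ile1// mulr_ge0.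
  rewrite /K7 -/q normrM ger0_norm ?mulr_ge0 ?exprn_ge0//.
  have -> : epsn n ^+ 4 * q ^+ 7 * `|v x| = (q * `|v x|) * ((epsn n * q) ^+ 4 * q ^+ 2) by ring.
  rewrite ler_pM ?mulr_ge0 ?exprn_ge0 ?mulr_ge0//.
  apply: (@le_trans _ _ (q ^+ 2)); first by rewrite ler_piMl ?sqr_ge0.
  by rewrite -[leLHS]add0r lerD// ler_pXn2r ?nnegrE ?qe_ge0//; exact: qe_le_qe0.
- by move=> n x /v0 ->; rewrite mulr0.
- move=> x xy; have xy0 : x - y != 0 by rewrite subr_eq0.
  have e4 : epsn n ^+ 4 @[n --> \oo] --> (0 : R).
    have -> : (fun n => epsn n ^+ 4) = (fun n => epsn n ^+ 2 * epsn n ^+ 2) :> (nat -> R).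
      by apply/funext => n; rewrite -exprD.
    have := cvgM (@cvg_eps2 R) (@cvg_eps2 R); rewrite expr0n mul0r; exact.
  have := cvgM (cvgM e4 (cvg_qeX (m := 7) xy0)) (cvg_cst (v x)).
  by rewrite !mul0r; exact.
by rewrite (_ : \int[leb3]_x 0 = 0 :> R)// Rintegral_cst// mul0r.
Qed.

(** On the max-norm ball of radius e one has |x|^2 + e^2 <= 4 e^2, so the kernel is at least e^4 (2
    e)^-7 = 1 / (128 e^3) on a set of volume 8 e^3. *)
Lemma K7_lower n : 16^-1 <= \int[leb3]_x (K7 n x * cutf 1 x ^+ 2).
Proof.
have e0 : 0 < epsn n :> R by rewrite invr_gt0.
have e1 : epsn n <= 1 :> R by rewrite invf_le1// ler1n.
have en0 : epsn n != 0 :> R by exact: epsn_neq0.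
have cC : class_C 0 (fun x : V => cutf 1 x ^+ 2).
  by apply: class_CX; exact: class_C_le (leq0n 3) (class_C_cut _ _).
have IK : leb3.-integrable [set: V] (EFin \o (fun x => K7 n x * cutf 1 x ^+ 2)).
  apply: (product_integrable (M := 1 + 4)).
  - exact: (class_C_cont (class_CZ _ (class_CX 7 (class_C_qe (R := R) 0 en0)))).
  - exact: class_C_cont cC.
  - by move=> x /(cut0 ler01) ->; rewrite expr0n.
pose A := [set x : V | `|x| <= epsn n].
pose r : R := (128 * epsn n ^+ 3)^-1.
have mA : measurable A by exact: measurable_norm_le.
have IA : leb3.-integrable [set: V] (EFin \o ((fun=> r) \_ A)).
  apply: (@integrable_bounded_support _ _ _ (@leb3 R) A _ `|r|) => //.
  - exact: leb3_ball_lty.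
  - apply/(measurable_restrictT _ mA); exact: measurable_cst.
  - by move=> x; rewrite patchE; case: ifP; rewrite ?normr0.
  - by move=> x nA; rewrite patchE memNset.
apply: (@le_trans _ _ (\int[leb3]_x ((fun=> r) \_ A) x)).
  rewrite -Rintegral_mkcond Rintegral_cst// [X in fine X](leb3_ballE (ltW e0))/=.
  rewrite le_eqVlt; apply/orP; left; apply/eqP; rewrite /r.
  by move: (epsn n) en0 => e en0; field.
apply: le_Rintegral => // x _; rewrite patchE; case: ifPn => [|_]; last first.
  by rewrite mulr_ge0 ?sqr_ge0// mulr_ge0 ?exprn_ge0 ?qe_ge0// ltW.
rewrite inE /A/= => xA; rewrite cut1 ?(le_trans xA)// expr1n mulr1 /r /K7.
have q2 : (2 * epsn n)^-1 <= qe (epsn n) x.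
  have N0 : 0 < dot x x + epsn n ^+ 2 by rewrite den_gt0// en0.
  rewrite lef_pV2 ?posrE ?sqrtr_gt0 ?mulr_gt0//.
  rewrite -(@ler_pXn2r _ 2)// ?nnegrE ?sqrtr_ge0 ?mulr_ge0 ?(ltW e0)// sqr_sqrtr ?(ltW N0)//.
  have xk k : x ord0 k * x ord0 k <= epsn n ^+ 2.
    rewrite -expr2 -real_normK ?num_real//.
    by apply: lerXn2r; rewrite ?nnegrE ?(ltW e0)// (le_trans (coord_le_norm x k)).
  have -> : (2 * epsn n) ^+ 2 = epsn n ^+ 2 + epsn n ^+ 2 + epsn n ^+ 2 + epsn n ^+ 2 :> R by ring.
  by rewrite /dot sum_ord3 lerD2r !lerD.
apply: (@le_trans _ _ (epsn n ^+ 4 * ((2 * epsn n)^-1) ^+ 7)).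
  rewrite le_eqVlt; apply/orP; left; apply/eqP.
  by move: (epsn n) en0 => e en0; field.
rewrite ler_wpM2l ?exprn_ge0 ?(ltW e0)// ler_pXn2r ?nnegrE ?qe_ge0//.
by rewrite invr_ge0 mulr_ge0// ltW.
Qed.

Variables (lambda mu : R).
Hypotheses (mu_gt0 : 0 < mu) (lame : 0 < 3 * lambda + 2 * mu).
Local Notation c := ((lambda + mu) / (lambda + 2 * mu)).

Lemma class_C_navier k (v : 'I_3 -> V -> R) i : (forall i, class_C k.+2 (v i)) ->
  class_C k (navier lambda mu v i).
Proof.
move=> vC; apply: (class_CD (class_CZ _ (class_C_laplacian (vC i))) (class_CZ _ _)).
apply: class_C_partial; apply: class_C_sum => l _; exact: class_C_partial (vC l).
Qed.

Lemma navier_support (v : 'I_3 -> V -> R) M i : (forall i x, M < `|x| -> v i x = 0) ->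
  forall x, M < `|x| -> navier lambda mu v i x = 0.
Proof.
move=> v0 x xM; have d2 k := partial_support k (partial_support k (v0 i)) xM.
rewrite /navier /laplacian big1 ?mulr0 ?add0r// (partial_support i _ xM) ?mulr0// => z zM.
by rewrite big1// => k _; exact: (partial_support k (v0 k) zM).
Qed.

(** Convergence is deduced from the regularised Green formula for the field (g, 0, 0), whose other
    side converges by dominated convergence; positivity of the limit comes from [K7_lower]. *)
Lemma K7_reference_limit : exists2 kappa : R, 0 < kappa &
  \int[leb3]_x (K7 n x * cutf 1 x ^+ 2) @[n --> \oo] --> kappa.
Proof.
pose g (x : V) := cutf 1 x ^+ 2.
have gC : class_C 2 g by apply: class_CX; exact: class_C_le (class_C_cut _ _).
have g0 x : 1 + 4 < `|x| -> g x = 0 by move=> /(cut0 ler01); rewrite /g => ->; rewrite expr0n.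
pose v (i : 'I_3) (x : V) := (i == 0)%:R * g x.
have vC i : class_C 2 (v i) by exact: class_CZ.
have v0 i x : 1 + 4 < `|x| -> v i x = 0 by move=> /g0; rewrite /v => ->; rewrite mulr0.
have nC i : continuous (navier lambda mu v i) by exact: (class_C_cont (class_C_navier i vC)).
have n0 i := navier_support i v0.
have M0 : 0 <= 1 + 4 :> R by [].
have lim i := (Gam_limit lambda mu 0 (nC i) M0 (n0 i) i 0).2.
pose I i := \int[leb3]_x (Gam c 0 i 0 (x - 0) * navier lambda mu v i x).
pose k0 : R := I 0 + I 1 + I 2.
have H : \int[leb3]_x (Gam c (epsn n) 0 0 (x - 0) * navier lambda mu v 0 x) +
    \int[leb3]_x (Gam c (epsn n) 1 0 (x - 0) * navier lambda mu v 1 x) +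
    \int[leb3]_x (Gam c (epsn n) 2 0 (x - 0) * navier lambda mu v 2 x) @[n --> \oo] --> k0.
  exact: (cvgD (cvgD (lim 0) (lim 1)) (lim 2)).
have E n : \int[leb3]_x (K7 n x * cutf 1 x ^+ 2) = (- 15 * mu)^-1 *
   (\int[leb3]_x (Gam c (epsn n) 0 0 (x - 0) * navier lambda mu v 0 x) +
    \int[leb3]_x (Gam c (epsn n) 1 0 (x - 0) * navier lambda mu v 1 x) +
    \int[leb3]_x (Gam c (epsn n) 2 0 (x - 0) * navier lambda mu v 2 x)).
  have := regularized_green mu_gt0 lame 0 0 vC v0 (epsn_neq0 n).
  rewrite sum_ord3 => ->; rewrite mulKf; last by rewrite mulf_neq0 ?oppr_eq0 ?pnatr_eq0// gt_eqF.
  by apply: eq_Rintegral => x _; rewrite subr0 /v eqxx mul1r.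
have lim' : \int[leb3]_x (K7 n x * cutf 1 x ^+ 2) @[n --> \oo] --> (- 15 * mu)^-1 * k0.
  by under eq_fun do rewrite E; exact: (cvgM (cvg_cst _) H).
exists ((- 15 * mu)^-1 * k0) => //.
apply: (@lt_le_trans _ _ (16^-1)); first by rewrite invr_gt0.
apply: (ler_cvg_to (cvg_cst _) lim'); apply: nearW => n; exact: K7_lower.
Qed.

(** Subtracting from v the multiple v(y) of the reference function centred at y leaves a function
    vanishing at y, for which the limit is 0. *)
Lemma K7_limit : exists2 kappa : R, 0 < kappa & forall (v : V -> R) M y,
  class_C 2 v -> 0 <= M -> (forall x, M < `|x| -> v x = 0) ->
  \int[leb3]_x (epsn n ^+ 4 * qe (epsn n) (x - y) ^+ 7 * v x) @[n --> \oo] --> kappa * v y.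
Proof.
have [kappa k0 Hk] := K7_reference_limit; exists kappa => // v M y vC M0 v0.
pose g (x : V) := cutf 1 x ^+ 2.
have gC : class_C 2 g by apply: class_CX; exact: class_C_le (class_C_cut _ _).
have g0 x : 1 + 4 < `|x| -> g x = 0 by move=> /(cut0 ler01); rewrite /g => ->; rewrite expr0n.
have gyC : class_C 2 (fun x => g (x - y)) by exact: class_C_translate.
pose v1 (x : V) := v x + (- v y) * g (x - y).
have v1C : class_C 2 v1 by exact: (class_CD vC (class_CZ _ gyC)).
pose M1 := M + `|y| + 5.
have M10 : 0 <= M1 by rewrite !addr_ge0.
have v10 x : M1 < `|x| -> v1 x = 0.
  move=> xM; rewrite /v1 v0 ?g0 ?mulr0 ?addr0//.
    have := ler_normD (x - y) y; rewrite subrK => H.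
    rewrite -(ltrD2r `|y|); apply: lt_le_trans H; apply: le_lt_trans xM.
    by rewrite /M1; lra.
  by apply: le_lt_trans xM; rewrite /M1 -addrA lerDl addr_ge0.
have v1y : v1 y = 0 by rewrite /v1 subrr /g cut1 ?normr0// expr1n mulr1 subrr.
have H1 := K7_vanish (class_CW v1C) M10 v10 v1y.
have cK n : continuous (fun x : V => K7 n (x - y)).
  exact: (class_C_cont (class_CZ _ (class_CX 7 (class_C_translate (- y) (class_C_qe (R := R) 0 (epsn_neq0 n)))))).
have IK n : leb3.-integrable [set: V] (EFin \o (fun x => K7 n x * g x)).
  apply: (product_integrable (M := 1 + 4)) => //; last exact: class_C_cont gC.
  exact: (class_C_cont (class_CZ _ (class_CX 7 (class_C_qe (R := R) 0 (epsn_neq0 n))))).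
have mK n : measurable_fun [set: V] (fun x : V => K7 n x * g x : measurableTypeR R).
  exact: (measurable_funM (measurable_K7 n) (continuous_measurable_rV (class_C_cont gC))).
have tr n := integrable_translate y (mK n) (IK n).
have E n : \int[leb3]_x (epsn n ^+ 4 * qe (epsn n) (x - y) ^+ 7 * v x) =
   \int[leb3]_x (K7 n (x - y) * v1 x) + v y * \int[leb3]_x (K7 n x * cutf 1 x ^+ 2).
  rewrite -(tr n).2.
  have I1 : leb3.-integrable [set: V] (EFin \o (fun x => K7 n (x - y) * v1 x)).
    by apply: (product_integrable (M := M1)) => //; exact: class_C_cont v1C.
  rewrite -(RintegralZl (v y) measurableT (tr n).1).
  rewrite -(RintegralD measurableT I1 (integrableZl measurableT (v y) (tr n).1)).
  apply: eq_Rintegral => x _; rewrite /v1 -/(K7 n (x - y)) -/(g (x - y)).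
  by move: (K7 n (x - y)) (g (x - y)) (v x) (v y) => q d a b; ring.
under eq_fun do rewrite E.
have -> : kappa * v y = 0 + v y * kappa by rewrite add0r mulrC.
exact: (cvgD H1 (cvgM (cvg_cst _) Hk)).
Qed.

Lemma navier_partial (w : 'I_3 -> V -> R) k i : (forall i, class_C 3 (w i)) ->
  navier lambda mu (fun i => partial k (w i)) i = partial k (navier lambda mu w i).
Proof.
move=> wC; have wC2 l : class_C 2 (w l) := class_CW (wC l).
pose D (x : V) := \sum_l partial l (w l) x.
have DC : class_C 2 D by apply: class_C_sum => l _; exact: class_C_partial (wC l).
have LC : class_C 1 (laplacian (w i)) by exact: class_C_laplacian.
have ED : (fun x => \sum_l partial l (partial k (w l)) x) = partial k D.
  rewrite /D partial_sum; last by move=> l; exact: class_C_partial (wC2 l).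
  by apply/funext => x; apply: eq_bigr => l _; rewrite (class_C2_schwarz l k (wC2 l)).
rewrite {2}/navier (partialD k (class_CZ _ LC) (class_CZ _ (class_C_partial i DC))).
rewrite (partialZ _ _ LC) (partialZ _ _ (class_C_partial i DC)).
apply/funext => x; rewrite /navier ED (laplacian_partial k (wC i)).
by rewrite (class_C2_schwarz i k DC).
Qed.

(** The first formula is the limit e -> 0 of the regularised Green formula. The second is that
    formula for d_k w with the derivative moved to the kernel, which changes the sign and costs one
    derivative: hence class C^3. *)
Lemma kelvin_representation : exists2 kappa : R, 0 < kappa &
  forall (w : 'I_3 -> V -> R) M, 0 <= M -> (forall i, class_C 3 (w i)) ->
    (forall i x, M < `|x| -> w i x = 0) -> forall y j,
  \sum_i \int[leb3]_x (Gam c 0 i j (x - y) * navier lambda mu w i x) = - kappa * w j y /\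
  forall k, \sum_i \int[leb3]_x (dGam c 0 k i j (x - y) * navier lambda mu w i x) =
    kappa * partial k (w j) y.
Proof.
have [kappa k0 Hk] := K7_limit; exists (15 * mu * kappa) => [|w M M0 wC w0 y j].
  by rewrite !mulr_gt0.
have rep (v : 'I_3 -> V -> R) : (forall i, class_C 2 (v i)) ->
    (forall i x, M < `|x| -> v i x = 0) ->
  \sum_i \int[leb3]_x (Gam c (epsn n) i j (x - y) * navier lambda mu v i x) @[n --> \oo] -->
    - (15 * mu * kappa) * v j y.
  move=> vC v0.
  have E n : \sum_i \int[leb3]_x (Gam c (epsn n) i j (x - y) * navier lambda mu v i x) =
      - 15 * mu * \int[leb3]_x (epsn n ^+ 4 * qe (epsn n) (x - y) ^+ 7 * v j x).
    exact: (regularized_green mu_gt0 lame j y vC v0 (epsn_neq0 n)).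
  under eq_fun do rewrite E.
  have -> : - (15 * mu * kappa) * v j y = - 15 * mu * (kappa * v j y) by ring.
  exact: (cvgM (cvg_cst _) (Hk _ _ _ (vC j) M0 (v0 j))).
have wC2 l : class_C 2 (w l) := class_CW (wC l).
have nC i : class_C 1 (navier lambda mu w i) by exact: class_C_navier.
have n0 i := navier_support i w0.
have uniq (u : nat -> R) (a b : R) : u n @[n --> \oo] --> a -> u n @[n --> \oo] --> b -> a = b.
  by move=> ua ub; rewrite -(cvg_lim (@Rhausdorff R) ua) (cvg_lim (@Rhausdorff R) ub).
have sum_limit (A : nat -> 'I_3 -> R) (B : 'I_3 -> R) :
    (forall i, A n i @[n --> \oo] --> B i) -> \sum_i A n i @[n --> \oo] --> \sum_i B i.
  by move=> AB; under eq_fun do rewrite sum_ord3; rewrite sum_ord3; exact: (cvgD (cvgD (AB 0) (AB 1)) (AB 2)).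
split=> [|k].
  apply: (@uniq _ _ _ _ (rep w wC2 w0)); apply: sum_limit => i.
  exact: (Gam_limit lambda mu y (class_C_cont (nC i)) M0 (n0 i) i j).2.
have := rep (fun i => partial k (w i)) (fun i => class_C_partial k (wC i))
  (fun i => partial_support k (w0 i)).
have ibp n i : \int[leb3]_x (Gam c (epsn n) i j (x - y) * navier lambda mu (fun i => partial k (w i)) i x) =
   - \int[leb3]_x (dGam c (epsn n) k i j (x - y) * navier lambda mu w i x).
  have GC := class_C_Gam c 1 i j (epsn_neq0 n).
  rewrite (navier_partial k i wC) (leb3_by_parts k (class_C_translate (- y) GC) (nC i) (n0 i)).
  congr (- _); apply: eq_Rintegral => x _.
  by rewrite (partial_translate _ _ _ GC) (partial_Gam _ _ _ _ (epsn_neq0 n)).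
have E n : \sum_i \int[leb3]_x (Gam c (epsn n) i j (x - y) * navier lambda mu (fun i => partial k (w i)) i x) =
   - \sum_i \int[leb3]_x (dGam c (epsn n) k i j (x - y) * navier lambda mu w i x).
  by rewrite -sumrN; apply: eq_bigr => i _; exact: ibp.
move=> H0.
have H : \sum_i \int[leb3]_x (dGam c (epsn n) k i j (x - y) * navier lambda mu w i x) @[n --> \oo] -->
    - (- (15 * mu * kappa) * partial k (w j) y).
  have -> : (fun n => \sum_i \int[leb3]_x (dGam c (epsn n) k i j (x - y) * navier lambda mu w i x)) =
     (fun n => - \sum_i \int[leb3]_x (Gam c (epsn n) i j (x - y) * navier lambda mu (fun i => partial k (w i)) i x)).
    by apply/funext => n; exact: (esym (etrans (congr1 (fun t => - t) (E n)) (opprK _))).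
  exact: (cvgN H0).
rewrite mulNr opprK in H; apply: (@uniq _ _ _ _ H); apply: sum_limit => i.
exact: (dGam_limit lambda mu y (class_C_cont (nC i)) M0 (n0 i) k i j).2.
Qed.

End approximate_identity.

(** * Taylor expansion of Kelvin's matrix and of potentials *)

Section analytic_kernels.
Context {R : realType}.
Notation V := 'rV[R]_3.
Implicit Types (f g : V -> R) (x z h v : V) (i j k l : 'I_3) (d m n N : nat) (C : R).

Lemma near_neq0 x : x != 0 -> \forall y \near x, y != 0.
Proof.
move=> x0; have o : open [set y : V | 0 < `|y|].
  have -> : [set y : V | 0 < `|y|] = (fun y : V => `|y|) @^-1` [set r : R | 0 < r] by [].
  by apply: open_comp; [move=> y _; exact: norm_continuous|exact: open_gt].
have x0' : [set y : V | 0 < `|y|] x by rewrite /= normr_gt0.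
by move: (open_nbhs_nbhs (conj o x0' : open_nbhs x _)); apply: filterS => y /=; rewrite normr_gt0.
Qed.

(* [kern N d C f]: off the origin f is a combination of terms
   x^a |x|^-m with m - |a| = d and |a| + m <= N, the absolute values of the
   coefficients adding up to at most C. *)
Inductive kern : nat -> nat -> R -> (V -> R) -> Prop :=
| kern_base m : kern m m 1 (fun x => qe 0 x ^+ m)
| kernX N d C i f : kern N d.+1 C f -> kern N.+1 d C (fun x => x ord0 i * f x)
| kernZ N d C a f : kern N d C f -> kern N d (`|a| * C) (fun x => a * f x)
| kernD N d C C' f g : kern N d C f -> kern N d C' g -> kern N d (C + C') (fun x => f x + g x)
| kernW N N' d C C' f : (N <= N')%N -> C <= C' -> kern N d C f -> kern N' d C' f
| kernE N d C f g : (forall x, x != 0 -> f x = g x) -> kern N d C f -> kern N d C g.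

Lemma kern_ge0 N d C f : kern N d C f -> 0 <= C.
Proof.
elim=> {N d C f} [m|//|N d C a f _ IH|N d C C' f g _ IHf _ IHg|N N' d C C' f _ CC' _ IH|//].
- exact: ler01.
- exact: mulr_ge0 (normr_ge0 _) IH.
- exact: addr_ge0 IHf IHg.
- exact: le_trans IH CC'.
Qed.

Lemma kern_bound N d C f x : kern N d C f -> x != 0 -> `|f x| <= C * qe 0 x ^+ d.
Proof.
move=> + x0; elim=> {N d C f} [m|N d C i f _ IH|N d C a f _ IH|N d C C' f g _ IHf _ IHg|N N' d C C' f _ CC' _ IH|N d C f g E _ IH].
- by rewrite mul1r ger0_norm// exprn_ge0// qe_ge0.
- have C0 : 0 <= C * qe 0 x ^+ d.
    have q0 : 0 < qe 0 x by apply: qe_gt0; rewrite den_gt0// x0 orbT.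
    have := le_trans (normr_ge0 _) IH; rewrite exprS mulrCA pmulr_rge0//.
  rewrite normrM; apply: (le_trans (ler_wpM2l (normr_ge0 _) IH)).
  rewrite exprS; have := ler_wpM2r C0 (qe_coord_le 0 x i).
  by rewrite mul1r -!mulrA [qe 0 x * (C * _)]mulrCA.
- by rewrite normrM -mulrA ler_wpM2l.
- by rewrite mulrDl (le_trans (ler_normD _ _))// lerD.
- by apply: (le_trans IH); rewrite ler_wpM2r// exprn_ge0// qe_ge0.
- by rewrite -E.
Qed.

Lemma kern_measurable N d C f : kern N d C f ->
  measurable_fun [set: V] (f : V -> measurableTypeR R).
Proof.
elim=> {N d C f} [m|N d C i f _ IH|N d C a f _ IH|N d C C' f g _ IHf _ IHg|//|N d C f g E _ IH].
- exact: (measurable_funX m (measurable_qe 0)).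
- exact: (measurable_funM (measurable_coord i) IH).
- exact: (measurable_funM (measurable_cst _) IH).
- exact: (measurable_funD IHf IHg).
(* [kernE] leaves the value at the origin free, so g is f altered at one point. *)
- have -> : g = (fun x => if x == 0 then g 0 else f x).
    by apply/funext => x; case: eqVneq => [->//|/E].
  apply: (measurable_fun_ifT (g := fun=> g 0)) => //.
  apply: (measurable_fun_bool true); rewrite setTI.
  have -> : (fun x : V => x == 0) @^-1` [set true] = [set x : V | `|x| <= 0].
    by apply/seteqP; split => x /=; rewrite normr_le0 => ->.
  exact: measurable_norm_le.
Qed.

Lemma is_derive_qe0 x v : x != 0 ->
  is_derive x v (qe 0) (\sum_k v ord0 k * (- x ord0 k * qe 0 x ^+ 3)).
Proof.
move=> x0; have N0 : 0 < dot x x + 0 ^+ 2 :> R by rewrite den_gt0// x0 orbT.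
have Hd : is_derive x v (fun x => dot x x + 0 ^+ 2) (\sum_k v ord0 k * (2 * x ord0 k)).
  have H1 := class_C1_is_derive x v (class_C_dot 1).
  have H2 : is_derive x v (fun _ : V => (0 : R) ^+ 2) 0 by exact: is_derive_cst.
  apply: (is_derive_eq (is_derive_ptD H1 H2)); rewrite addr0.
  by apply: eq_bigr => k _; rewrite partial_dot.
have Hs := is_derive_chain (f := fun x => dot x x + 0 ^+ 2) (is_derive1_sqrt N0) Hd.
have s0 : Num.sqrt (dot x x + 0 ^+ 2) != 0 :> R by rewrite gt_eqF// sqrtr_gt0.
have Hd2 := is_derive_ptV (f := Num.sqrt \o (fun x : V => dot x x + 0 ^+ 2)) s0 Hs.
have E : \sum_k v ord0 k * (- x ord0 k * qe 0 x ^+ 3) = - (Num.sqrt (dot x x + 0 ^+ 2)) ^- 2 *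
    ((2 * Num.sqrt (dot x x + 0 ^+ 2))^-1 * (\sum_k v ord0 k * (2 * x ord0 k))).
  rewrite /qe !sum_ord3; move: s0; move: (Num.sqrt _) => s s0.
  by move: (v ord0 0) (v ord0 1) (v ord0 2) (x ord0 0) (x ord0 1) (x ord0 2) => *; field.
by rewrite E; exact: Hd2.
Qed.

Lemma kern_grad N d C f : kern N d C f -> forall x, x != 0 ->
  exists g : 'I_3 -> R, forall v, is_derive x v f (\sum_k v ord0 k * g k).
Proof.
move=> + x x0; elim=> {N d C f} [m|N d C i f _ [g IH]|N d C a f _ [g IH]|N d C C' f f' _ [g IHf] _ [g' IHg]|//|N d C f f' E _ [g IH]].
- case: m => [|m].
    exists (fun=> 0) => v; rewrite big1 => [|k _]; last by rewrite mulr0.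
    by have -> : (fun x : V => qe 0 x ^+ 0) = (fun=> 1); [apply/funext => y; rewrite expr0|exact: is_derive_cst].
  exists (fun k => m.+1%:R * qe 0 x ^+ m * (- x ord0 k * qe 0 x ^+ 3)) => v.
  apply: (is_derive_eq (is_derive_ptX m (is_derive_qe0 v x0))).
  by rewrite mulr_sumr; apply: eq_bigr => k _; rewrite mulrCA.
- exists (fun k => x ord0 i * g k + f x * (k == i)%:R) => v.
  apply: (is_derive_eq (is_derive_ptM (is_derive_coord i x v) (IH v))).
  rewrite mulr_sumr; transitivity (\sum_k (x ord0 i * (v ord0 k * g k)) + \sum_k (f x * (v ord0 k * (k == i)%:R))).
    congr (_ + _); rewrite -mulr_sumr (bigD1 i)//= eqxx mulr1 big1 ?addr0// => k /negPf ->.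
    by rewrite mulr0.
  by rewrite -big_split/=; apply: eq_bigr => k _; rewrite mulrDr mulrCA [f x * _]mulrCA.
- exists (fun k => a * g k) => v; apply: (is_derive_eq (is_derive_ptZ a (IH v))).
  by rewrite mulr_sumr; apply: eq_bigr => k _; rewrite mulrCA.
- exists (fun k => g k + g' k) => v; apply: (is_derive_eq (is_derive_ptD (IHf v) (IHg v))).
  by rewrite -big_split/=; apply: eq_bigr => k _; rewrite mulrDr.
- exists g => v; apply: (near_eq_is_derive _ (IH v)).
  by move: (near_neq0 x0); apply: filterS => y /E.
Qed.

Lemma kern_is_derive N d C f x v : kern N d C f -> x != 0 ->
  is_derive x v f (\sum_k v ord0 k * partial k f x).
Proof.
move=> fk x0; have [g gE] := kern_grad fk x0.
have pE k : partial k f x = g k.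
  apply: is_derive_partial; apply: (is_derive_eq (gE _)).
  rewrite (bigD1 k)//= mxE !eqxx mul1r big1 ?addr0// => l /negPf lk.
  by rewrite mxE lk andbF mul0r.
by apply: (is_derive_eq (gE v)); apply: eq_bigr => k _; rewrite pE.
Qed.

Lemma kern_partial_is_derive N d C f x k : kern N d C f -> x != 0 ->
  is_derive x (delta_mx ord0 k) f (partial k f x).
Proof.
move=> fk x0; apply: (is_derive_eq (kern_is_derive (delta_mx ord0 k) fk x0)).
rewrite (bigD1 k)//= mxE !eqxx mul1r big1 ?addr0// => l /negPf lk.
by rewrite mxE lk andbF mul0r.
Qed.

Lemma kern_continuous N d C f x : kern N d C f -> x != 0 -> {for x, continuous f}.
Proof.
move=> + x0; elim=> {N d C f} [m|N d C i f _ IH|N d C a f _ IH|N d C C' f g _ IHf _ IHg|//|N d C f g E _ IH].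
- have q1 : {for x, continuous (qe (R := R) 0)}.
    have H1 : {for x, continuous (fun x : V => dot x x + 0 ^+ 2)}.
      exact: (class_C_cont (class_CD (class_C_dot 0) (class_C_cst 0 (0 ^+ 2)))).
    have H2 := continuous_comp H1 (@sqrt_continuous R _).
    by apply: cvgV H2; rewrite gt_eqF// sqrtr_gt0 den_gt0// x0 orbT.
  elim: m => [|m IH].
    have -> : (fun x : V => qe 0 x ^+ 0) = (fun=> 1) by apply/funext => y; rewrite expr0.
    exact: cst_continuous.
  have -> : (fun x : V => qe 0 x ^+ m.+1) = (fun x => qe 0 x * qe 0 x ^+ m).
    by apply/funext => y; rewrite exprS.
  exact: (cvgM q1 IH).
- have H : {for x, continuous (fun x : V => x ord0 i)} by exact: coord_continuous.
  exact: (cvgM H IH).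
- exact: (cvgM (cvg_cst _) IH).
- exact: (cvgD IHf IHg).
- have n0 : \forall y \near x, f y = g y by move: (near_neq0 x0); apply: filterS => y /E.
  have H : g @ x --> f x by exact: (cvg_trans (near_eq_cvg n0) IH).
  by move: H; rewrite E.
Qed.

Lemma partial_off0 f g x k : (forall x, x != 0 -> f x = g x) -> x != 0 ->
  partial k f x = partial k g x.
Proof.
move=> E x0; rewrite /partial; apply: near_eq_derive.
by move: (near_neq0 x0); apply: filterS => y /E.
Qed.

(** Differentiating x^a |x|^-m gives a term with coefficient a_k and the term -m x_k x^a |x|^(-m-2):
    coefficients grow by the factor |a| + m <= N at most, and |a| + m grows by at most 3. The linear
    growth of N is what makes n-th derivatives of size n!. *)
Lemma kern_partial N d C f k : kern N d C f -> kern (N + 3) d.+1 (N%:R * C) (partial k f).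
Proof.
elim=> {N d C f} [m|N d C i f fk IH|N d C a f fk IH|N d C C' f g fk IHf gk IHg|N N' d C C' f NN' CC' fk IH|N d C f g E fk IH].
- apply: (@kernE _ _ _ (fun x => (- m%:R) * (x ord0 k * qe 0 x ^+ m.+2))).
    move=> x x0; apply/esym/is_derive_partial; case: m => [|m].
      have -> : (fun x : V => qe 0 x ^+ 0) = (fun=> 1) by apply/funext => y; rewrite expr0.
      have H : is_derive x (delta_mx ord0 k) (fun _ : V => 1 : R) 0 by exact: is_derive_cst.
      by apply: (is_derive_eq H); rewrite oppr0 mul0r.
    have N0 : 0 < dot x x + 0 ^+ 2 by rewrite den_gt0// x0 orbT.
    apply: (is_derive_eq (is_derive_ptX m (is_derive_qe k N0))).
    by rewrite -(addn3 m) exprD; ring.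
  rewrite addn3 mulr1; have := kernZ (- m%:R) (kernX k (kern_base m.+2)).
  by rewrite normrN normr_nat mulr1.
- apply: (@kernE _ _ _ (fun x => (i == k)%:R * f x + x ord0 i * partial k f x)).
    move=> x x0; apply/esym/is_derive_partial.
    apply: (is_derive_eq (is_derive_ptM (is_derive_coord_delta i k x) (kern_partial_is_derive k fk x0))).
    by rewrite addrC mulrC.
  have -> : N.+1%:R * C = C + N%:R * C by rewrite -natr1 mulrDl mul1r addrC.
  apply: kernD; last exact: (kernX i IH).
  apply: (kernW _ _ (kernZ (i == k)%:R fk)); first by rewrite leqW// leq_addr.
  rewrite -[leRHS]mul1r ler_wpM2r ?(kern_ge0 fk)//.
  by case: eqP => _; rewrite ?normr1 ?normr0.
- apply: (@kernE _ _ _ (fun x => a * partial k f x)).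
    move=> x x0; apply/esym/is_derive_partial.
    exact: (is_derive_ptZ a (kern_partial_is_derive k fk x0)).
  by rewrite mulrCA; exact: kernZ.
- apply: (@kernE _ _ _ (fun x => partial k f x + partial k g x)).
    move=> x x0; apply/esym/is_derive_partial.
    exact: (is_derive_ptD (kern_partial_is_derive k fk x0) (kern_partial_is_derive k gk x0)).
  by rewrite mulrDr; exact: kernD.
- apply: (kernW _ _ IH); first by rewrite leq_add2r.
  by rewrite ler_pM// ?(kern_ge0 fk)// ler_nat.
- by apply: (kernE _ IH) => x x0; exact: partial_off0.
Qed.

Lemma kern_schwarz N d C f x i j : kern N d C f -> x != 0 ->
  partial i (partial j f) x = partial j (partial i f) x.
Proof.
move=> fk x0; have pk l := kern_partial l fk.
have D l : \forall y \near x, derivable f y (delta_mx ord0 l).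
  by move: (near_neq0 x0); apply: filterS => y y0; have [] := kern_partial_is_derive l fk y0.
have D2 l l' : \forall y \near x, derivable (partial l f) y (delta_mx ord0 l').
  by move: (near_neq0 x0); apply: filterS => y y0; have [] := kern_partial_is_derive l' (pk l) y0.
apply: (schwarz (D j) (D i) (D2 j i) (D2 i j)).
  exact: (kern_continuous (kern_partial i (pk j)) x0).
exact: (kern_continuous (kern_partial j (pk i)) x0).
Qed.

(* [Dn n f z h] is the n-th derivative at t = 0 of f (z + t h). *)
Fixpoint Dn n f z h : R :=
  if n is n'.+1 then \sum_k h ord0 k * Dn n' (partial k f) z h else f z.

Lemma Dn_off0 n f g z h : (forall x, x != 0 -> f x = g x) -> z != 0 ->
  Dn n f z h = Dn n g z h.
Proof.
elim: n f g => [|n IH] f g E z0 /=; first exact: E.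
by apply: eq_bigr => k _; congr (_ * _); apply: IH => // x; exact: partial_off0.
Qed.

Lemma Dn_hpoly n f z : hpoly n (Dn n f z).
Proof.
elim: n f => [|n IH] f /=; first exact: hpoly_cst.
by apply: hpoly_sum => k; exact: hpolyX.
Qed.

(** By [kern_partial], n derivatives multiply the coefficients by N (N + 3) ... (N + 3 (n - 1)), at
    most (N + 3)^n n!. The 3 in 3 |h| counts the coordinates, each bounded by the max norm. *)
Lemma Dn_bound n N d C f z h : kern N d C f -> z != 0 ->
  `|Dn n f z h| <= C * (N.+3%:R ^+ n * n`!%:R) * (3 * `|h|) ^+ n * qe 0 z ^+ (d + n).
Proof.
move=> fk z0.
have q0 : 0 <= qe 0 z := qe_ge0 _ _.
have H : forall n N d C f, kern N d C f ->
  `|Dn n f z h| <= C * (\prod_(j < n) (N + 3 * j))%:R * (3 * `|h|) ^+ n * qe 0 z ^+ (d + n).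
  elim=> [|{}n IH] {}N {}d {}C {}f {}fk /=.
    by rewrite big_ord0 !expr0 mulr1n !mulr1 addn0; exact: (kern_bound fk z0).
  have Hk k : `|Dn n (partial k f) z h| <=
     C * (\prod_(j < n.+1) (N + 3 * j))%:R * (3 * `|h|) ^+ n * qe 0 z ^+ (d + n.+1).
    apply: (le_trans (IH _ _ _ _ (kern_partial k fk))).
    rewrite addSnnS big_ord_recl muln0 addn0.
    have -> : (\prod_(i < n) (N + 3 * lift ord0 i) = \prod_(j < n) (N + 3 + 3 * j))%N.
      by apply: eq_bigr => i _; rewrite -addnA /= /bump /= add1n mulnS.
    by rewrite natrM mulrA [C * N%:R]mulrC.
  set B := C * _ in Hk *.
  have B0 : 0 <= B * (3 * `|h|) ^+ n * qe 0 z ^+ (d + n.+1).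
    by apply: le_trans (Hk 0); exact: normr_ge0.
  apply: (le_trans (ler_norm_sum _ _ _)).
  apply: (@le_trans _ _ (\sum_(k < 3) `|h| * (B * (3 * `|h|) ^+ n * qe 0 z ^+ (d + n.+1)))).
    by apply: ler_sum => k _; rewrite normrM ler_pM//; exact: coord_le_norm.
  rewrite sumr_const card_ord -mulr_natl exprS.
  by rewrite le_eqVlt; apply/orP; left; apply/eqP; ring.
apply: (le_trans (H n _ _ _ _ fk)).
rewrite ler_wpM2r ?exprn_ge0// ler_wpM2r ?exprn_ge0 ?mulr_ge0// ler_wpM2l ?(kern_ge0 fk)//.
rewrite -natrX -natrM ler_nat.
have -> : (N.+3 ^ n * n`! = \prod_(j < n) (N.+3 * j.+1))%N.
  by rewrite big_split/= prod_nat_const card_ord fact_prod big_add1 big_mkord.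
by apply: leq_prod => j _; lia.
Qed.

Lemma Dn_line n N d C f z h (t : R) : kern N d C f -> z + t *: h != 0 ->
  is_derive t (1 : R) (fun t => Dn n f (z + t *: h) h) (Dn n.+1 f (z + t *: h) h).
Proof.
elim: n N d C f => [|n IH] N d C f fk zt.
  apply: is_derive_line; exact: kern_is_derive fk zt.
have -> : Dn n.+2 f (z + t *: h) h = \sum_k h ord0 k * Dn n.+1 (partial k f) (z + t *: h) h by [].
have Hk k := is_derive_ptZ (h ord0 k) (IH _ _ _ _ (kern_partial k fk) zt).
have -> : (fun t => Dn n.+1 f (z + t *: h) h) = (fun t =>
  h ord0 0 * Dn n (partial 0 f) (z + t *: h) h + h ord0 1 * Dn n (partial 1 f) (z + t *: h) h
  + h ord0 2 * Dn n (partial 2 f) (z + t *: h) h).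
  by apply/funext => s /=; rewrite sum_ord3.
by rewrite sum_ord3; exact: (is_derive_ptD (is_derive_ptD (Hk 0) (Hk 1)) (Hk 2)).
Qed.

Lemma sum_delta k (A B u : 'I_3 -> R) (a : R) :
  \sum_l ((l == k)%:R * A l + a * (u l * B l)) = A k + a * \sum_l u l * B l.
Proof.
rewrite big_split/= (bigD1 k)//= eqxx mul1r big1 ?addr0 -?mulr_sumr// => l /negPf ->.
by rewrite mul0r.
Qed.

(** As a function of h, [Dn] is a multilinear form evaluated on the diagonal. Its symmetry, which is
    Schwarz's theorem, makes the n + 1 terms of the product rule equal. *)
Lemma Dn_partial n N d C f z k : kern N d C f -> z != 0 ->
  partial k (Dn n.+1 f z) = (fun h => n.+1%:R * Dn n (partial k f) z h).
Proof.
move=> + z0; elim: n N d C f => [|n IH] N d C f fk.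
  have -> : Dn 1 f z = (fun h => \sum_l partial l f z * h ord0 l).
    by apply/funext => h /=; apply: eq_bigr => l _; rewrite mulrC.
  rewrite partial_sum; last by move=> l; apply: class_CZ; exact: class_C_coord.
  apply/funext => h; rewrite mul1r (bigD1 k)//= big1 => [|l lk].
    by rewrite partialZ ?partial_coord ?eqxx ?mulr1 ?addr0//; exact: class_C_coord.
  by rewrite partialZ ?partial_coord ?(negPf lk) ?mulr0//; exact: class_C_coord.
have DC m l : class_C m (Dn n.+1 (partial l f) z) := hpoly_class_C m (Dn_hpoly n.+1 (partial l f) z).
have -> : Dn n.+2 f z = (fun h => \sum_l h ord0 l * Dn n.+1 (partial l f) z h) by [].
rewrite partial_sum; last first.
  by move=> l; exact: (class_CM (class_C_coord 1 l) (DC 1 l)).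
apply/funext => h.
transitivity (\sum_l ((l == k)%:R * Dn n.+1 (partial l f) z h +
    n.+1%:R * (h ord0 l * Dn n (partial l (partial k f)) z h))).
  apply: eq_bigr => l _.
  have S : Dn n (partial k (partial l f)) z h = Dn n (partial l (partial k f)) z h.
    apply: Dn_off0 => [x x0|]; [exact: kern_schwarz fk x0|exact: z0].
  have E1 a : Dn n (partial k (partial l f)) z h = a ->
      partial k (Dn n.+1 (partial l f) z) h = n.+1%:R * a.
    by move=> <-; exact: (congr1 (@^~ h) (IH _ _ _ _ (kern_partial l fk))).
  have E3 : partial k (fun x : V => x ord0 l) h = (l == k)%:R := congr1 (@^~ h) (partial_coord l k).
  rewrite (partialM k (class_C_coord 1 l) (DC 1 l)) (E1 _ S) E3.
  move: (Dn n (partial l (partial k f)) z h) (Dn n.+1 (partial l f) z h) (h ord0 l) ((l == k)%:R : R) (n.+1%:R : R) => a b e e' e''.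
  by clear; ring.
apply: (etrans (sum_delta k (fun l => Dn n.+1 (partial l f) z h) _ _ _)).
have -> : n.+2%:R = 1 + n.+1%:R :> R by rewrite -[n.+2%:R]natr1 addrC.
rewrite mulrDl mul1r; congr (_ + _).
Qed.

Lemma DnD n N N' d d' C C' f g z h : kern N d C f -> kern N' d' C' g -> z != 0 ->
  Dn n (fun x => f x + g x) z h = Dn n f z h + Dn n g z h.
Proof.
move=> + + z0; elim: n N N' d d' C C' f g => [|n IH] N N' d d' C C' f g fk gk //=.
rewrite -big_split/=; apply: eq_bigr => k _; rewrite -mulrDr; congr (_ * _).
rewrite -(IH _ _ _ _ _ _ _ _ (kern_partial k fk) (kern_partial k gk)).
apply: Dn_off0 => // x x0; apply: is_derive_partial.
exact: (is_derive_ptD (kern_partial_is_derive k fk x0) (kern_partial_is_derive k gk x0)).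
Qed.

Lemma DnZ n N d C a f z h : kern N d C f -> z != 0 ->
  Dn n (fun x => a * f x) z h = a * Dn n f z h.
Proof.
move=> + z0; elim: n N d C f => [|n IH] N d C f fk //=.
rewrite mulr_sumr; apply: eq_bigr => k _; rewrite mulrCA; congr (_ * _).
rewrite -(IH _ _ _ _ (kern_partial k fk)).
by apply: Dn_off0 => // x x0; apply: is_derive_partial; exact: (is_derive_ptZ a (kern_partial_is_derive k fk x0)).
Qed.

Lemma Dn0 n z h : Dn n (fun=> 0) z h = 0.
Proof.
elim: n => //= n IH; rewrite big1// => k _.
by rewrite partial_cst IH mulr0.
Qed.

Lemma Dn_scale n f z t h : Dn n f z (t *: h) = t ^+ n * Dn n f z h.
Proof. exact: hpoly_scale (Dn_hpoly n f z). Qed.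

Lemma measurable_Dn n N d C f h : kern N d C f ->
  measurable_fun [set: V] ((fun z => Dn n f z h) : V -> measurableTypeR R).
Proof.
elim: n N d C f => [|n IH] N d C f fk /=; first exact: kern_measurable fk.
have -> : (fun z => \sum_k h ord0 k * Dn n (partial k f) z h) = (fun z =>
  h ord0 0 * Dn n (partial 0 f) z h + h ord0 1 * Dn n (partial 1 f) z h + h ord0 2 * Dn n (partial 2 f) z h).
  by apply/funext => z; rewrite sum_ord3.
have Hk k := measurable_funM (measurable_cst (h ord0 k)) (IH _ _ _ _ (kern_partial k fk)).
exact: (measurable_funD (measurable_funD (Hk 0) (Hk 1)) (Hk 2)).
Qed.

Lemma measurable_Dn_h n f z : measurable_fun [set: V] (Dn n f z : V -> measurableTypeR R).
Proof. exact: continuous_measurable_rV (class_C_cont (hpoly_class_C 0 (Dn_hpoly n f z))). Qed.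

Lemma qe0_norm_le x (r : R) : 0 < r -> r <= `|x| -> qe 0 x <= r^-1.
Proof.
move=> r0 rx.
have [i ri] : exists i, r <= `|x ord0 i|.
  apply/existsP; rewrite -[X in is_true X]negbK negb_exists; apply/negP => /forallP H.
  move: rx; rewrite leNgt => /negP; apply; apply: rV_norm_lt => // i.
  by have := H i; rewrite -ltNge.
rewrite -[leRHS]mul1r ler_pdivlMr//; apply: le_trans (qe_coord_le 0 x i).
by rewrite mulrC ler_wpM2r ?qe_ge0.
Qed.

(** Taylor's formula along the segment with the remainder in Cauchy's form. The condition 2 |h| <= r
    keeps the segment at distance at least r / 2 from the singularity. *)
Lemma kern_taylor M N d C f z h (r : R) : kern N d C f -> 0 < r -> r <= `|z| -> 2 * `|h| <= r ->
  `|f (z + h) - \sum_(n < M.+1) Dn n f z h / n`!%:R| <=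
  C * (2 / r) ^+ d * (M.+1%:R * (N.+3%:R * (3 * `|h|) * (4 / r)) ^+ M.+1).
Proof.
move=> fk r0 rz hr.
have zt (t : R) : `|t| <= `|1 : R| -> r / 2 <= `|z + t *: h|.
  rewrite normr1 => t1; have := ler_normB (z + t *: h) (t *: h); rewrite addrK normrZ.
  have : `|t| * `|h| <= `|h| by rewrite ler_piMl.
  move: rz hr; move: (`|z|) (`|z + t *: h|) (`|t| * `|h|) (`|h|) => a b e e'.
  by clear -r0; move=> *; lra.
have r2 : 0 < r / 2 by rewrite divr_gt0.
have zt0 (t : R) : `|t| <= `|1 : R| -> z + t *: h != 0.
  by move=> /zt zt1; rewrite -normr_gt0 (lt_le_trans r2).
(* The Taylor polynomial at the moving point z + t h evaluated at z + h; its derivative in t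
   telescopes to the single term [dpsi]. *)
pose psi (t : R) := \sum_(n < M.+1) Dn n f (z + t *: h) h * ((1 - t) ^+ n / n`!%:R).
pose dpsi (t : R) := Dn M.+1 f (z + t *: h) h * ((1 - t) ^+ M / M`!%:R).
have [t t1 E] : exists2 t, `|t| <= `|1 : R| & psi 1 - psi 0 = dpsi t * 1.
  apply: (@MVT0 _ psi dpsi) => t t1; rewrite /psi /dpsi; clear psi dpsi zt r2.
  elim: M => [|M IH].
    have -> : (fun t => \sum_(n < 1) Dn n f (z + t *: h) h * ((1 - t) ^+ n / n`!%:R)) =
      (fun t => Dn 0 f (z + t *: h) h).
      by apply/funext => s; rewrite big_ord1 expr0 mul1r invr1 mulr1.
    by rewrite expr0 mul1r invr1 mulr1; exact: (Dn_line 0 fk (zt0 _ t1)).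
  have -> : (fun t => \sum_(n < M.+2) Dn n f (z + t *: h) h * ((1 - t) ^+ n / n`!%:R)) =
    (fun t => \sum_(n < M.+1) Dn n f (z + t *: h) h * ((1 - t) ^+ n / n`!%:R) +
      Dn M.+1 f (z + t *: h) h * (M.+1`!%:R^-1 * (1 + t * (- 1)) ^+ M.+1)).
    by apply/funext => s; rewrite big_ord_recr/= mulrN1 [M.+1`!%:R^-1 * _]mulrC.
  have H2 := is_derive_ptZ (M.+1`!%:R^-1) (is_derive_ptX M (is_derive_affine 1 (- 1) t)).
  apply: (is_derive_eq (is_derive_ptD IH (is_derive_ptM (Dn_line M.+1 fk (zt0 _ t1)) H2))).
  rewrite mulrN1 factS natrM.
  have f0 : M`!%:R != 0 :> R by rewrite pnatr_eq0 -lt0n fact_gt0.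
  have m0 : M.+1%:R != 0 :> R by rewrite pnatr_eq0.
  have -> : 1 + t * -1 = 1 - t by clear; ring.
  rewrite !exprS; move: (Dn _ _ _ _) (Dn _ _ _ _) (M`!%:R : R) (M.+1%:R : R) f0 m0 ((1 - t) ^+ M) => a b p q p0 q0 e.
  by clear -p0 q0; field; rewrite p0 q0.
have psi1 : psi 1 = f (z + h).
  rewrite /psi big_ord_recl big1 => [|n _]; last by rewrite subrr exprS mul0r mul0r mulr0.
  by rewrite scale1r subrr expr0 mul1r invr1 mulr1 addr0.
have psi0 : psi 0 = \sum_(n < M.+1) Dn n f z h / n`!%:R.
  by apply: eq_bigr => n _; rewrite scale0r addr0 subr0 expr1n mul1r.
rewrite -psi1 -psi0 E mulr1 /dpsi.
have q2 : 0 <= qe 0 (z + t *: h) <= 2 / r.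
  by rewrite qe_ge0 -[2 / r]invf_div qe0_norm_le// zt.
have C0 := kern_ge0 fk.
have f0 : 0 < M`!%:R :> R by rewrite ltr0n fact_gt0.
(* [MVT0] locates t only in [-1, 1], hence 2 in place of 1; this is the origin of 4 / r in the
   bound. *)
have u2 : `|1 - t| <= 2.
  by rewrite (le_trans (ler_normB _ _))// normr1; move: t1; rewrite normr1; clear; lra.
rewrite normrM normrM normfV normr_nat normrX.
apply: (@le_trans _ _ ((C * (N.+3%:R ^+ M.+1 * M.+1`!%:R) * (3 * `|h|) ^+ M.+1 * (2 / r) ^+ (d + M.+1)) *
   (2 ^+ M.+1 / M`!%:R))).
  apply: ler_pM => //.
  - apply: (le_trans (Dn_bound M.+1 h fk (zt0 _ t1))).
    apply: ler_wpM2l; first by rewrite !mulr_ge0 ?exprn_ge0 ?mulr_ge0.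
    by have /andP[q20 q2r] := q2; apply: lerXn2r => //; rewrite ?nnegrE// divr_ge0// ltW.
  - apply: ler_wpM2r; first by rewrite invr_ge0 ler0n.
    apply: (@le_trans _ _ (2 ^+ M)); first by apply: lerXn2r; rewrite ?nnegrE.
    by rewrite exprS ler_peMl ?exprn_ge0//; clear; lra.
rewrite le_eqVlt; apply/orP; left; apply/eqP.
have -> : 4 / r = 2 * (2 / r) by rewrite mulrA; congr (_ / _); clear; ring.
rewrite factS natrM exprD !exprMn.
move: f0 => /lt0r_neq0; move: (M`!%:R : R) (M.+1%:R : R) (N.+3%:R ^+ M.+1) (2 ^+ M.+1) (`|h| ^+ _) (r^-1 ^+ M.+1) (r^-1 ^+ d) (2 ^+ d) (3 ^+ M.+1).
by clear; move=> *; field.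
Qed.

End analytic_kernels.

(** * Consequences of geometrically small remainders *)

Section geometric_decay.
Context {R : realType}.
Implicit Types (a A t : R).

Lemma geometric_eq0 a A : (forall M, `|a| <= A * 2^-1 ^+ M.+1) -> a = 0.
Proof.
move=> H; apply/eqP; rewrite -normr_le0 leNgt; apply/negP => a0.
have [M MA] : exists M : nat, A / `|a| < M%:R.
  exists (Num.Def.archi_bound `|A / `|a| |).
  exact: le_lt_trans (ler_norm _) (archi_boundP (normr_ge0 _)).
have := H M; rewrite exprVn ler_pdivlMr ?exprn_gt0//; apply/negP; rewrite -ltNge.
rewrite -ltr_pdivrMl// mulrC; apply: (lt_trans MA).
by rewrite -natrX ltr_nat ltnW// ltn_expl.
Qed.

(** The factor M + 1 is absorbed by 2^(M + 1), at the price of doubling the ratio. *)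
Lemma linear_geometric_le (rho t : R) M : 0 <= rho -> rho <= t / 4 ->
  M.+1%:R * rho ^+ M.+1 <= (t / 2) ^+ M.+1.
Proof.
move=> rho0 rhot.
apply: (@le_trans _ _ (2 ^+ M.+1 * (t / 4) ^+ M.+1)).
  apply: ler_pM => //; first exact: exprn_ge0.
    by rewrite -natrX ler_nat ltnW// ltn_expl.
  by apply: lerXn2r; rewrite ?nnegrE// (le_trans rho0).
by rewrite -exprMn; have -> : 2 * (t / 4) = t / 2 by field.
Qed.

(** Since f vanishes near 0, a first nonzero coefficient would violate the remainder estimate of its
    own order for small t; once all coefficients are 0, the estimates at t = 1 force f(1) = 0. *)
Lemma taylor_vanish (f : R -> R) (c : nat -> R) A :
  (forall M t, `|t| <= 1 ->
    `|f t - \sum_(n < M.+1) c n * t ^+ n| <= A * (`|t| / 2) ^+ M.+1) ->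
  (\forall t \near (0 : R), f t = 0) -> f 1 = 0.
Proof.
move=> H f0.
have c0 n : c n = 0.
  have [k] := ubnP n; elim: k n => // k IH n nk.
  apply/eqP; rewrite -normr_le0 leNgt; apply/negP => cn.
  have A0 : 0 <= A.
    have := le_trans (normr_ge0 _) (H 0%N 1 _); rewrite normr1 => /(_ (lexx _)).
    by rewrite pmulr_lge0// exprn_gt0.
  have [e e0 ef] : exists2 e : R, 0 < e & forall t, `|t| <= e -> f t = 0.
    move/nbhs_ballP : f0 => [e /= e0 ef]; exists (e / 2); first by rewrite divr_gt0.
    move=> t te; apply: ef; rewrite /ball /= sub0r normrN (le_lt_trans te)//.
    by rewrite ltr_pdivrMr// ltr_pMr// ltr1n.
  (* Small enough for f(s) = 0 and for A s < |c n|, so that |c n| s^n exceeds the remainder of order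
     n + 1. *)
  pose s := Num.min (Num.min e 1) (`|c n| / (A + 1)).
  have s0 : 0 < s by rewrite !lt_min e0 ltr01/= divr_gt0// ltr_wpDl.
  have se : `|s| <= e by rewrite gtr0_norm// !ge_min lexx.
  have s1 : `|s| <= 1 by rewrite gtr0_norm// !ge_min lexx orbT.
  have := H n s s1; rewrite ef// big_ord_recr/= big1 => [|i _]; last first.
    by rewrite IH ?mul0r// (leq_trans (ltn_ord i)).
  rewrite !add0r normrN normrM normrX !(gtr0_norm s0).
  apply/negP; rewrite -ltNge.
  have sA : s * A < `|c n|.
    have : s <= `|c n| / (A + 1) by rewrite !ge_min lexx !orbT.
    rewrite ler_pdivlMr ?ltr_wpDl// mulrDr mulr1; apply: lt_le_trans.
    by rewrite ltrDl.
  apply: (@le_lt_trans _ _ ((s * A) * s ^+ n)); last by rewrite ltr_pM2r// exprn_gt0.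
  rewrite [s * A]mulrC -mulrA -exprS; apply: ler_wpM2l => //.
  by apply: lerXn2r; rewrite ?nnegrE ?divr_ge0 ?(ltW s0)// ler_pdivrMr// ler_peMr ?(ltW s0)// ler1n.
apply: (@geometric_eq0 _ A) => M; have := H M 1; rewrite normr1 => /(_ (lexx _)).
by rewrite big1 ?subr0 ?mul1r// => n _; rewrite c0 mul0r.
Qed.

End geometric_decay.

(** * Taylor expansion and continuation of potentials *)

Section potentials.
Context {R : realType}.
Notation V := 'rV[R]_3.
Variable sigma : {measure set V -> \bar R}.
Implicit Types (f m : V -> R) (x h : V).

Lemma integrable_mul_bounded m (F : V -> R) B : sigma.-integrable [set: V] (EFin \o m) ->
  measurable_fun [set: V] F -> (forall y, m y != 0 -> `|F y| <= B) ->
  sigma.-integrable [set: V] (EFin \o (fun y => m y * F y)) /\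
  `|\int[sigma]_y (m y * F y)| <= B * \int[sigma]_y `|m y|.
Proof.
move=> im mF FB.
have mm : measurable_fun [set: V] m by apply/measurable_EFinP; exact: measurable_int im.
have in_ : sigma.-integrable [set: V] (EFin \o (fun y => `|m y|)) by exact: integrable_norm.
have ib : sigma.-integrable [set: V] (EFin \o (fun y => B * `|m y|)).
  exact: (integrableZl measurableT B in_).
have le y : `|m y * F y| <= B * `|m y|.
  rewrite normrM mulrC; have [->|m0] := eqVneq (m y) 0; first by rewrite normr0 !mulr0.
  by rewrite ler_wpM2r// FB.
have iF : sigma.-integrable [set: V] (EFin \o (fun y => m y * F y)).
  exact: integrable_le (measurable_funM mm mF) ib le.
split => //; apply: (le_trans (le_normr_Rintegral measurableT iF)).
rewrite -RintegralZl//; apply: le_Rintegral => //; exact: integrable_norm.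
Qed.

Lemma measurable_reflect x f : measurable_fun [set: V] f ->
  measurable_fun [set: V] (fun y => f (x - y)).
Proof.
move=> mf; apply: (measurableT_comp mf); apply: measurable_to_rV => i.
under eq_fun do rewrite !mxE.
exact: measurable_funB (measurable_cst _) (measurable_coord i).
Qed.

(** Stated for a base point Z and an increment H both depending on y, to serve two expansions: at x
    - y in a fixed direction, for continuation, and at x in the variable -y, for the far field. The
    ratio in [kern_taylor] is 12 (N + 3) |H| / r; the constant 48 makes it at most t / 4, as
    [linear_geometric_le] requires. *)
Lemma integral_taylor M N d C f m (Z H : V -> V) (r eta t : R) :
  kern N d C f -> sigma.-integrable [set: V] (EFin \o m) ->
  (forall n, measurable_fun [set: V] (fun y => Dn n f (Z y) (H y))) ->
  measurable_fun [set: V] (fun y => f (Z y + H y)) ->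
  0 < r -> 0 <= eta -> t <= 1 -> 48 * N.+3%:R * eta <= t * r ->
  (forall y, m y != 0 -> r <= `|Z y| /\ `|H y| <= eta) ->
  [/\ sigma.-integrable [set: V] (EFin \o (fun y => m y * f (Z y + H y))),
      forall n, sigma.-integrable [set: V] (EFin \o (fun y => m y * Dn n f (Z y) (H y))) &
  `|\int[sigma]_y (m y * f (Z y + H y)) -
    \sum_(n < M.+1) (\int[sigma]_y (m y * Dn n f (Z y) (H y))) / n`!%:R|
  <= (C * (2 / r) ^+ d * \int[sigma]_y `|m y|) * (t / 2) ^+ M.+1].
Proof.
move=> fk im mD mf r0 eta0 t1 etar ZH.
have C0 := kern_ge0 fk.
have N3 : 3 <= N.+3%:R :> R by rewrite ler_nat.
have eta2 : 2 * eta <= r.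
  have : 3 * eta <= N.+3%:R * eta by rewrite ler_wpM2r.
  have : t * r <= r by rewrite ler_piMl// ltW.
  by move: etar eta0; rewrite -mulrA; move: (N.+3%:R * eta) (t * r) => a b; clear; lra.
have Z0 y : m y != 0 -> Z y != 0.
  by move=> /ZH[rZ _]; rewrite -normr_gt0 (lt_le_trans r0).
have qr y : m y != 0 -> qe 0 (Z y) <= r^-1 by move=> /ZH[rZ _]; exact: qe0_norm_le.
have iD n : sigma.-integrable [set: V] (EFin \o (fun y => m y * Dn n f (Z y) (H y))).
  have DB y : m y != 0 -> `|Dn n f (Z y) (H y)| <=
      C * (N.+3%:R ^+ n * n`!%:R) * (3 * eta) ^+ n * r^-1 ^+ (d + n); last first.
    exact: (integrable_mul_bounded im (mD n) DB).1.
  move=> my; apply: (le_trans (Dn_bound n (H y) fk (Z0 _ my))).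
  have [_ Hy] := ZH _ my.
  apply: ler_pM; rewrite ?mulr_ge0 ?exprn_ge0 ?mulr_ge0 ?qe_ge0//; last first.
    by apply: lerXn2r (qr _ my); rewrite ?nnegrE ?qe_ge0// invr_ge0 ltW.
  apply: ler_wpM2l; first by rewrite !mulr_ge0 ?exprn_ge0.
  by apply: lerXn2r; rewrite ?nnegrE ?mulr_ge0// ler_wpM2l.
pose P y := \sum_(n < M.+1) Dn n f (Z y) (H y) / n`!%:R.
have mP : measurable_fun [set: V] P.
  apply: measurable_sum => n; exact: (measurable_funM (mD n) (measurable_cst _)).
have tayl y : m y != 0 -> `|f (Z y + H y) - P y| <= C * (2 / r) ^+ d * (t / 2) ^+ M.+1.
  move=> my; have [rZ Hy] := ZH _ my.
  have Hr : 2 * `|H y| <= r by apply: le_trans eta2; rewrite ler_wpM2l.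
  apply: (le_trans (kern_taylor M fk r0 rZ Hr)).
  apply: ler_wpM2l; first by rewrite mulr_ge0 ?exprn_ge0// divr_ge0// ltW.
  apply: linear_geometric_le; first by rewrite !mulr_ge0// invr_ge0 ltW.
  have -> : N.+3%:R * (3 * `|H y|) * (4 / r) = 48 * (N.+3%:R * `|H y|) / r / 4.
    by field; rewrite gt_eqF.
  rewrite ler_wpM2r// ler_pdivrMr//; apply: le_trans etar.
  by rewrite -[leRHS]mulrA ler_wpM2l// ler_wpM2l.
have iPf := integrable_mul_bounded im (measurable_funB mf mP) tayl.
have iDf (n : 'I_M.+1) : sigma.-integrable [set: V] (EFin \o (fun y => m y * Dn n f (Z y) (H y) / n`!%:R)).
  exact: (integrableZr measurableT (n`!%:R^-1) (iD n)).
have iP : sigma.-integrable [set: V] (EFin \o (fun y => \sum_(n < M.+1) m y * Dn n f (Z y) (H y) / n`!%:R)).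
  exact: (Rintegral_sum _ iDf).1.
have PE y : m y * P y = \sum_(n < M.+1) m y * Dn n f (Z y) (H y) / n`!%:R.
  by rewrite mulr_sumr; apply: eq_bigr => n _; rewrite mulrA.
have iF : sigma.-integrable [set: V] (EFin \o (fun y => m y * f (Z y + H y))).
  have -> : (fun y => m y * f (Z y + H y)) = (fun y => m y * (f (Z y + H y) - P y) +
     \sum_(n < M.+1) m y * Dn n f (Z y) (H y) / n`!%:R).
    by apply/funext => y; rewrite -PE mulrBr subrK.
  exact: (integrableD measurableT iPf.1 iP).
split => //.
have -> : \sum_(n < M.+1) (\int[sigma]_y (m y * Dn n f (Z y) (H y))) / n`!%:R =
   \int[sigma]_y (\sum_(n < M.+1) m y * Dn n f (Z y) (H y) / n`!%:R).
  rewrite (Rintegral_sum _ iDf).2.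
  by apply: eq_bigr => n _; rewrite (RintegralZr _ measurableT (iD n)).
rewrite -RintegralB//; have -> : (fun y => m y * f (Z y + H y) - \sum_(n < M.+1) m y * Dn n f (Z y) (H y) / n`!%:R)
  = (fun y => m y * (f (Z y + H y) - P y)) by apply/funext => y; rewrite mulrBr PE.
by apply: (le_trans iPf.2); rewrite mulrAC.
Qed.

Lemma measurable_Dn_reflect n N d C f x h : kern N d C f ->
  measurable_fun [set: V] (fun y => Dn n f (x - y) h).
Proof. by move=> fk; apply: (measurable_reflect x (measurable_Dn n h fk)). Qed.

(** [taylor_vanish] along the segment from x to x + h. The reach r / (48 (N + 3)) depends only on
    the distance r from x to the support of the densities, not on the size of the neighbourhood
    where the potential is known to vanish. *)
Lemma potential_continuation (I : finType) N (d : I -> nat) (C : I -> R) (G m : I -> V -> R) x (r : R) :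
  (forall b, kern N (d b) (C b) (G b)) ->
  (forall b, sigma.-integrable [set: V] (EFin \o m b)) ->
  0 < r -> (forall b y, m b y != 0 -> r <= `|x - y|) ->
  (\forall z \near x, \sum_b \int[sigma]_y (m b y * G b (z - y)) = 0) ->
  forall h, 48 * N.+3%:R * `|h| <= r -> \sum_b \int[sigma]_y (m b y * G b (x + h - y)) = 0.
Proof.
move=> Gk im r0 mr U0 h hr.
pose f (t : R) := \sum_b \int[sigma]_y (m b y * G b (x + t *: h - y)).
have -> : \sum_b \int[sigma]_y (m b y * G b (x + h - y)) = f 1 by rewrite /f scale1r.
pose c n := \sum_b (\int[sigma]_y (m b y * Dn n (G b) (x - y) h)) / n`!%:R.
pose A := \sum_b C b * (2 / r) ^+ (d b) * \int[sigma]_y `|m b y|.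
apply: (@taylor_vanish _ f c A) => [M t t1|]; last first.
  have cz : (fun t : R => x + t *: h) t @[t --> 0] --> x.
    rewrite -[X in _ --> X]addr0 -[X in _ + X](scale0r h).
    by apply: cvgD; [exact: cvg_cst|apply: cvgZr_tmp; exact: cvg_id].
  exact: (cz _ U0).
have T b : [/\ sigma.-integrable [set: V] (EFin \o (fun y => m b y * G b (x - y + t *: h))),
      forall n, sigma.-integrable [set: V] (EFin \o (fun y => m b y * Dn n (G b) (x - y) (t *: h))) &
  `|\int[sigma]_y (m b y * G b (x - y + t *: h)) -
    \sum_(n < M.+1) (\int[sigma]_y (m b y * Dn n (G b) (x - y) (t *: h))) / n`!%:R|
  <= (C b * (2 / r) ^+ d b * \int[sigma]_y `|m b y|) * (`|t| / 2) ^+ M.+1].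
  apply: (integral_taylor (eta := `|t| * `|h|) M (Gk b) (im b)) => //.
  - by move=> n; exact: measurable_Dn_reflect (Gk b).
  - under eq_fun do rewrite addrAC.
    by apply: measurable_reflect; exact: kern_measurable (Gk b).
  - by rewrite mulrCA ler_wpM2l.
  - by move=> y my; split; [exact: mr my|rewrite normrZ].
have -> : f t - \sum_(n < M.+1) c n * t ^+ n = \sum_b (\int[sigma]_y (m b y * G b (x - y + t *: h)) -
    \sum_(n < M.+1) (\int[sigma]_y (m b y * Dn n (G b) (x - y) (t *: h))) / n`!%:R).
  rewrite sumrB; congr (_ - _).
    by apply: eq_bigr => b _; congr (Rintegral _ _); apply/funext => y; rewrite addrAC.
  rewrite exchange_big/=; apply: eq_bigr => n _; rewrite /c mulr_suml; apply: eq_bigr => b _.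
  rewrite mulrAC; congr (_ / _); have [_ iD _] := T b.
  (* For t = 0 only n = 0 survives. For t <> 0 the integrability needed to take t^n out of the
     integral is recovered from the scaled derivative by dividing by t^n. *)
  have [t0|t0] := eqVneq t 0.
    case: n => -[|n] n1 /=.
      by rewrite mulr1.
    rewrite t0 exprS mul0r mulr0.
    have -> : (fun y => m b y * Dn n.+1 (G b) (x - y) (0 *: h)) = (fun=> 0).
      by apply/funext => y; rewrite (Dn_scale n.+1) exprS mul0r mul0r mulr0.
    by rewrite Rintegral_cst// mul0r.
  rewrite -RintegralZr//; last first.
    have -> : (fun y => m b y * Dn n (G b) (x - y) h) = (fun y => m b y * Dn n (G b) (x - y) (t *: h) * (t ^- n)).
      apply/funext => y; rewrite Dn_scale; move: (t ^+ n) (m b y) (Dn _ _ _ _) (expf_neq0 n t0) => p q e p0.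
      by field.
    exact: (integrableZr measurableT (t ^- n) (iD n)).
  by congr (Rintegral _ _); apply/funext => y; rewrite Dn_scale mulrAC mulrA.
apply: (le_trans (ler_norm_sum _ _ _)); rewrite mulr_suml; apply: ler_sum => b _.
by have [] := T b.
Qed.

End potentials.

(** * Vanishing of the layer potentials far away *)

Section far_field.
Context {R : realType}.
Notation V := 'rV[R]_3.
Implicit Types (x y z h : V) (i j k l : 'I_3) (f g : V -> R).

Section kelvin_kernels.
Variable c : R.

Lemma Gam_sym e i j : Gam c e i j = Gam c e j i.
Proof. by apply/funext => x; rewrite /Gam eq_sym [x ord0 i * _]mulrC. Qed.

Lemma dGam_sym e k i j : dGam c e k i j = dGam c e k j i.
Proof. by apply/funext => x; rewrite /dGam [i == j]eq_sym; ring. Qed.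

Lemma partial_Gam0 k i j x : x != 0 -> partial k (Gam c 0 i j) x = dGam c 0 k i j x.
Proof. by move=> x0; apply/is_derive_partial/is_derive_Gam; rewrite den_gt0// x0 orbT. Qed.

Lemma partial_dGam0 l k i j x : x != 0 -> partial l (dGam c 0 k i j) x = ddGam c 0 l k i j x.
Proof. by move=> x0; apply/is_derive_partial/is_derive_dGam; rewrite den_gt0// x0 orbT. Qed.

Lemma kern_Gam i j : kern 5 1 (`|2 - c| + `|c|) (Gam c 0 i j).
Proof.
apply: (@kernE _ _ _ _ (fun x => ((i == j)%:R * (2 - c)) * qe 0 x ^+ 1 +
    c * (x ord0 i * (x ord0 j * qe 0 x ^+ 3)))).
  by move=> x _; rewrite /Gam expr1 expr0n/= mul0r addr0 !mulrA.
have H1 := kernZ ((i == j)%:R * (2 - c)) (kern_base 1).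
have H2 := kernZ c (kernX i (kernX j (kern_base (R := R) 3))).
rewrite mulr1 in H2; apply: (kernD (kernW _ _ H1) H2) => //.
by rewrite mulr1 normrM normr_nat; case: eqP => _; rewrite ?mul1r ?mul0r.
Qed.

Lemma kern_dGam k i j : kern 8 2 (5 * (`|2 - c| + `|c|)) (dGam c 0 k i j).
Proof. exact: kernE (fun x nz => partial_Gam0 k i j nz) (kern_partial k (kern_Gam i j)). Qed.

(* With b = (j, None) the i-th component of the single layer kernel for a force
   in the direction j, with b = (j, Some k) its k-th derivative. *)
Definition layer_kernel i (b : 'I_3 * option 'I_3) : V -> R :=
  if b.2 is Some k then dGam c 0 k b.1 i else Gam c 0 b.1 i.

Definition layer_order (b : 'I_3 * option 'I_3) : nat := if b.2 is Some _ then 2 else 1.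

(** A common size 8 for single and double layer kernels; it produces the factor 8 + 3 = 11 in the
    radii below. *)
Lemma kern_layer i b : kern 8 (layer_order b) (5 * (`|2 - c| + `|c|)) (layer_kernel i b).
Proof.
case: b => j [k|]; first exact: kern_dGam.
apply: (kernW _ _ (kern_Gam j i)) => //.
by rewrite ler_peMl ?addr_ge0// ler1n.
Qed.

End kelvin_kernels.

Lemma Dn_sum n N d (C : 'I_3 -> R) (f : 'I_3 -> V -> R) z h : (forall k, kern N d (C k) (f k)) -> z != 0 ->
  Dn n (fun x => \sum_k f k x) z h = \sum_k Dn n (f k) z h.
Proof.
move=> fk z0; rewrite sum_ord3 -(DnD n h (fk 0) (fk 1) z0) -(DnD n h (kernD (fk 0) (fk 1)) (fk 2) z0).
by apply: Dn_off0 => // x _; rewrite sum_ord3.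
Qed.

Lemma Dn_partial2 n N d C f z k l (a : R) : kern N d C f -> z != 0 ->
  partial k (partial l (fun h => a * Dn n.+2 f z h)) =
  (fun h => a * (n.+2%:R * n.+1%:R) * Dn n (partial k (partial l f)) z h).
Proof.
move=> fk z0; have DC m g p : class_C p (Dn m g z) := hpoly_class_C p (Dn_hpoly m g z).
have -> : partial l (fun h => a * Dn n.+2 f z h) = (fun h => a * n.+2%:R * Dn n.+1 (partial l f) z h).
  by rewrite (partialZ _ _ (DC n.+2 f 1%N)) (Dn_partial n.+1 l fk z0); apply/funext => h; rewrite mulrA.
rewrite (partialZ _ _ (DC n.+1 _ 1%N)) (Dn_partial n k (kern_partial l fk) z0).
by apply/funext => h; rewrite !mulrA.
Qed.

Variables (lambda mu : R).
Hypotheses (mu_gt0 : 0 < mu) (lame : 0 < 3 * lambda + 2 * mu).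

Local Notation c := ((lambda + mu) / (lambda + 2 * mu)).

(** Two derivatives in h turn the form of order n into n (n - 1) times the form of order n - 2 of
    the second derivatives of the kernel at z. As the form is linear in the kernel, it annihilates
    the combination that E makes of these derivatives, which is 0 away from the origin. *)
Lemma kelvin_taylor_elasticity n i z (a : R) x : z != 0 ->
  elasticity lambda mu (fun h => \row_j (a * Dn n (Gam c 0 j i) z h)) x = 0.
Proof.
move=> z0; apply/rowP => l; rewrite elasticityE mxE.
pose P j h := a * Dn n (Gam c 0 j i) z h.
have Pk j : hpoly n (P j) by apply: hpolyZ; exact: Dn_hpoly.
have PC j m : class_C m (P j) := hpoly_class_C m (Pk j).
have compE j : component (fun h => \row_j (a * Dn n (Gam c 0 j i) z h)) j = P j.
  by apply/funext => h; rewrite /component mxE.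
have -> : divergence (fun h => \row_j (a * Dn n (Gam c 0 j i) z h)) = (fun x => \sum_k partial k (P k) x).
  by apply/funext => y; apply: eq_bigr => k _; rewrite compE.
rewrite compE /laplacian partial_sum; last by move=> k; exact: class_C_partial (PC k 2).
have small j k k' : (n < 2)%N -> partial k (partial k' (P j)) x = 0.
  by move=> n2; exact: (congr1 (@^~ x) (hpoly_partial2_small k k' n2 (Pk j))).
have [n2|n2] := ltnP n 2.
  have z1 : \sum_k partial k (partial k (P l)) x = 0 by apply: big1 => k _; exact: small.
  have z2 : \sum_k partial l (partial k (P k)) x = 0 by apply: big1 => k _; exact: small.
  transitivity (mu * 0 + (lambda + mu) * 0); last by rewrite !mulr0 addr0.
  congr (mu * _ + (lambda + mu) * _); [exact: z1|exact: z2].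
case: n n2 @P Pk PC compE {small} => [|[|n]] // _ P Pk PC compE.
have E k k' j : partial k (partial k' (P j)) x =
    a * (n.+2%:R * n.+1%:R) * Dn n (partial k (partial k' (Gam c 0 j i))) z x.
  exact: (congr1 (@^~ x) (Dn_partial2 n k k' a (kern_Gam c j i) z0)).
have kk k k' j := kern_partial k (kern_partial k' (kern_Gam c j i)).
have ks (F : 'I_3 -> V -> R) C : (forall k, kern 11 3 C (F k)) -> kern 11 3 (C + C + C) (fun x => \sum_k F k x).
  move=> Fk; apply: (kernE _ (kernD (kernD (Fk 0) (Fk 1)) (Fk 2))) => y _.
  by rewrite sum_ord3.
have k1 := ks _ _ (fun k => kk k k l); have k2 := ks _ _ (fun k => kk l k k).
have alg (p : R) (D1 D2 : 'I_3 -> R) : mu * (\sum_k D1 k) + (lambda + mu) * (\sum_k D2 k) = 0 ->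
    mu * (\sum_k p * D1 k) + (lambda + mu) * (\sum_k p * D2 k) = 0.
  move=> H; rewrite -!mulr_sumr; move: H; move: (\sum_k D1 k) (\sum_k D2 k) => d1 d2 H.
  by rewrite [mu * _]mulrCA [(lambda + mu) * _]mulrCA -mulrDr H mulr0.
transitivity (mu * \sum_k (a * (n.+2%:R * n.+1%:R)) * Dn n (partial k (partial k (Gam c 0 l i))) z x +
    (lambda + mu) * \sum_k (a * (n.+2%:R * n.+1%:R)) * Dn n (partial l (partial k (Gam c 0 k i))) z x).
  by congr (mu * _ + (lambda + mu) * _); apply: eq_bigr => k _; exact: E.
apply: alg.
have e1 := esym (Dn_sum n x (fun k => kk k k l) z0).
have e2 := esym (Dn_sum n x (fun k => kk l k k) z0).
apply: (etrans (congr2 (fun p q => mu * p + (lambda + mu) * q) e1 e2)).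
apply: (etrans (congr2 (fun p q => p + q) (esym (DnZ n mu x k1 z0)) (esym (DnZ n (lambda + mu) x k2 z0)))).
apply: (etrans (esym (DnD n x (kernZ mu k1) (kernZ (lambda + mu) k2) z0))).
apply: (etrans _ (Dn0 n z x)); apply: (Dn_off0 n x _ z0) => y y0.
have dd k k' j : partial k (partial k' (Gam c 0 j i)) y = ddGam c 0 k k' j i y.
  rewrite -(partial_dGam0 c k k' j i y0); apply: partial_off0 => // t t0; exact: partial_Gam0.
under eq_bigr do rewrite dd.
under [X in _ + _ * X]eq_bigr do rewrite dd.
rewrite (Gam_elasticity l i (erefl c)).
- by rewrite expr0n/= mul0r mulr0 mul0r.
- by rewrite gt_eqF// (lame_pos mu_gt0 lame).
- by rewrite den_gt0// y0 orbT.
Qed.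

Variables (sigma : {measure set V -> \bar R}) (m : 'I_3 * option 'I_3 -> V -> R) (R0 : R).
Hypotheses (im : forall b, sigma.-integrable [set: V] (EFin \o m b))
  (R0_ge0 : 0 <= R0) (mR : forall b y, m b y != 0 -> `|y| <= R0)
  (mP : forall n (P : 'I_3 -> V -> R), (forall j, hpoly n (P j)) ->
     (forall y, elasticity lambda mu (fun y => \row_j P j y) y = 0) ->
     \sum_j (\int[sigma]_y (m (j, None) y * P j y) -
        \sum_k \int[sigma]_y (m (j, Some k) y * partial k (P j) y)) = 0).

Lemma sum_pair_option (F : 'I_3 * option 'I_3 -> R) :
  \sum_b F b = \sum_j (F (j, None) + \sum_k F (j, Some k)).
Proof.
transitivity (\sum_j \sum_o F (j, o)).
  by rewrite pair_big/=; apply: eq_bigr => -[].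
apply: eq_bigr => j _; rewrite (bigD1 None)//=; congr (_ + _).
rewrite (reindex_omap Some id) => [|[]//].
by apply: eq_bigl => k; rewrite eqxx.
Qed.

(** The kernels are expanded in y about 0. The terms of degree n of all the layers together are the
    form in [mP] applied to the polynomial solution with components (-1)^n Dn(y) / n!, hence 0; only
    the remainder is left, and it tends to 0. *)
Lemma layer_potential_far i x : 0 < `|x| -> 48 * 11 * R0 <= `|x| ->
  \sum_b \int[sigma]_y (m b y * layer_kernel c i b (x - y)) = 0.
Proof.
rewrite normr_gt0 => x0 xR; have x_gt0 : 0 < `|x| by rewrite normr_gt0.
pose A b := 5 * (`|2 - c| + `|c|) * (2 / `|x|) ^+ layer_order b * \int[sigma]_y `|m b y|.
have T M b : [/\ sigma.-integrable [set: V] (EFin \o (fun y => m b y * layer_kernel c i b (x - y))),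
      forall n, sigma.-integrable [set: V] (EFin \o (fun y => m b y * Dn n (layer_kernel c i b) x (- y))) &
  `|\int[sigma]_y (m b y * layer_kernel c i b (x - y)) -
    \sum_(n < M.+1) (\int[sigma]_y (m b y * Dn n (layer_kernel c i b) x (- y))) / n`!%:R|
  <= A b * (1 / 2) ^+ M.+1].
  apply: (integral_taylor (Z := fun=> x) (H := fun y => - y) (r := `|x|) (eta := R0) (t := 1) M (kern_layer c i b) (im b)) => //.
  - move=> n; have H := measurable_reflect 0 (measurable_Dn_h n (layer_kernel c i b) x).
    by under eq_fun do rewrite -[- _]add0r.
  - have H := measurable_reflect x (kern_measurable (kern_layer c i b)); exact: H.
  - by rewrite mul1r.
  - by move=> y my; rewrite normrN; split => //; exact: mR my.
have T' M b : `|\int[sigma]_y (m b y * layer_kernel c i b (x - y)) -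
    \sum_(n < M.+1) (\int[sigma]_y (m b y * Dn n (layer_kernel c i b) x (- y))) / n`!%:R|
  <= A b * 2^-1 ^+ M.+1 by have [_ _] := T M b; rewrite mul1r.
have A0 b : 0 <= A b.
  rewrite mulr_ge0 ?exprn_ge0 ?mulr_ge0 ?addr_ge0 ?invr_ge0//.
  by apply: Rintegral_ge0 => y _; exact: normr_ge0.
apply: (@geometric_eq0 _ _ (\sum_b A b)) => M.
(* The double layer sums stop one degree earlier: the derivative of a polynomial of degree n pairs
   with the single layer term of degree n. *)
pose dg (b : 'I_3 * option 'I_3) := if b.2 is Some _ then M.+1 else M.+2.
pose S b := \sum_(n < dg b) (\int[sigma]_y (m b y * Dn n (layer_kernel c i b) x (- y))) / n`!%:R.
have TS b : `|\int[sigma]_y (m b y * layer_kernel c i b (x - y)) - S b| <= A b * 2^-1 ^+ M.+1.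
  case: b => j [k|]; first exact: T' M (j, Some k).
  apply: (le_trans (T' M.+1 (j, None))); rewrite ler_wpM2l// [leLHS]exprS.
  by rewrite ler_piMl ?exprn_ge0// invf_le1// ler1n.
have S0 : \sum_b S b = 0.
  pose a n : R := (- 1) ^+ n / n`!%:R.
  pose P n j y := a n * Dn n (Gam c 0 j i) x y.
  have mPn n := mP (fun j => hpolyZ (a n) (Dn_hpoly n (Gam c 0 j i) x))
    (fun y => kelvin_taylor_elasticity n i (a n) y x0).
  have : \sum_(n < M.+2) \sum_j (\int[sigma]_y (m (j, None) y * P n j y) -
        \sum_k \int[sigma]_y (m (j, Some k) y * partial k (P n j) y)) = 0.
    by rewrite big1// => n _; exact: mPn.
  move=> Z; apply: etrans Z; rewrite [RHS]exchange_big [LHS]sum_pair_option; apply: eq_bigr => j _ /=.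
  rewrite sumrB; congr (_ + _).
    apply: eq_bigr => n _; rewrite -RintegralZr//; last first.
      have [_ iD _] := T M (j, None); exact: iD.
    congr (Rintegral _ _); apply/funext => y.
    rewrite -scaleN1r Dn_scale /P /a [layer_kernel c i _]/(Gam c 0 j i).
    by move: (Dn n (Gam c 0 j i) x y) (m (j, None) y) => p q; ring.
  rewrite exchange_big/= -sumrN; apply: eq_bigr => k _.
  (* The polynomial of degree 0 has zero derivative; dropping it shifts the index so that both sums
     have M + 1 terms. *)
  rewrite [in RHS]big_ord_recl /=.
  have -> : \int[sigma]_y (m (j, Some k) y * partial k (P 0%N j) y) = 0.
    have -> : (fun y => m (j, Some k) y * partial k (P 0%N j) y) = (fun=> 0).
      apply/funext => y.
      have p0 := @hpoly_pred0 _ 0 (P 0%N j) y isT (hpolyZ (a 0%N) (Dn_hpoly 0 (Gam c 0 j i) x)) k.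
      by rewrite p0 mulr0.
    by rewrite Rintegral_cst// mul0r.
  rewrite add0r -sumrN; apply: eq_bigr => n _.
  have -> : (fun y => m (j, Some k) y * partial k (P (lift ord0 n) j) y) = (fun y =>
      (m (j, Some k) y * Dn n (layer_kernel c i (j, Some k)) x (- y)) * - n`!%:R^-1).
    apply/funext => y; rewrite -mulrA; congr (_ * _).
    have E0 : partial k (P n.+1 j) y = a n.+1 * (n.+1%:R * Dn n (partial k (Gam c 0 j i)) x y).
      have DC : class_C 1 (Dn n.+1 (Gam c 0 j i) x) := hpoly_class_C 1 (Dn_hpoly n.+1 _ x).
      apply: (etrans (congr1 (@^~ y) (partialZ _ _ DC))).
      exact: (congr1 (fun F : V -> R => a n.+1 * F y) (Dn_partial n k (kern_Gam c j i) x0)).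
    have D0 : Dn n (partial k (Gam c 0 j i)) x y = Dn n (layer_kernel c i (j, Some k)) x y.
      by apply: (Dn_off0 n y _ x0) => t t0; exact: partial_Gam0.
    apply: (etrans E0); rewrite D0 -scaleN1r Dn_scale /a exprS factS natrM.
    have : n`!%:R != 0 :> R by rewrite pnatr_eq0 -lt0n fact_gt0.
    have : n.+1%:R != 0 :> R by rewrite pnatr_eq0.
    move: (n`!%:R : R) (n.+1%:R : R) ((-1 : R) ^+ n) (Dn n (layer_kernel c i (j, Some k)) x y) => p q e e' q0 p0.
    by field; rewrite q0 p0.
  rewrite RintegralZr//; last by have [_ iD _] := T M (j, Some k); exact: iD.
  by rewrite mulrN opprK.
have -> : \sum_b \int[sigma]_y (m b y * layer_kernel c i b (x - y)) =
    \sum_b (\int[sigma]_y (m b y * layer_kernel c i b (x - y)) - S b).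
  by rewrite sumrB S0 subr0.
by apply: (le_trans (ler_norm_sum _ _ _)); rewrite mulr_suml; apply: ler_sum.
Qed.

End far_field.

(** * Surfaces which are locally graphs *)

Section row_continuity.
Context {R : realType}.

Lemma continuous_to_rV (T : topologicalType) n (f : T -> 'rV[R]_n.+1) :
  (forall i, continuous (fun t => f t ord0 i)) -> continuous f.
Proof.
move=> cf t; apply/cvgrPdist_lt => e e0.
have H : \forall s \near t, forall i, `|f t ord0 i - f s ord0 i| < e.
  apply: filter_forall => i; have := cf i t; move/cvgrPdist_lt => /(_ e e0); exact.
by apply: filterS H => s Hs; apply: rV_norm_lt => // i; rewrite !mxE; exact: Hs.
Qed.

Lemma cont_sum (T : topologicalType) (I : finType) (f : I -> T -> R) :
  (forall i, continuous (f i)) -> continuous (fun t => \sum_i f i t).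
Proof.
move=> cf; elim: (index_enum I) => [|i s IH].
  by under eq_fun do rewrite big_nil; exact: cst_continuous.
by under eq_fun do rewrite big_cons; exact: contD.
Qed.

Lemma cont_coord (T : topologicalType) n (f : T -> 'rV[R]_n.+1) i :
  continuous f -> continuous (fun t => f t ord0 i).
Proof. by move=> cf t; exact: (cvg_comp _ _ (cf t) (@coord_continuous _ _ _ ord0 i (f t))). Qed.

Lemma contB (T : topologicalType) (f g : T -> R) :
  continuous f -> continuous g -> continuous (fun x => f x - g x).
Proof. by move=> cf cg x; exact: (cvgB (cf x) (cg x)). Qed.

Lemma cont_comp (T U W : topologicalType) (f : T -> U) (g : U -> W) :
  continuous f -> continuous g -> continuous (fun x => g (f x)).
Proof. by move=> cf cg x; exact: (cvg_comp _ _ (cf x) (cg (f x))). Qed.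

Lemma continuous_mulmx n m (Q : 'M[R]_(n.+1, m.+1)) : continuous (fun x : 'rV[R]_n.+1 => x *m Q).
Proof.
apply: continuous_to_rV => j; under eq_fun do rewrite mxE.
apply: cont_sum => k; apply: contM; [exact: coord_continuous|exact: cst_continuous].
Qed.

Lemma continuous_subr (T : topologicalType) n (f g : T -> 'rV[R]_n.+1) :
  continuous f -> continuous g -> continuous (fun t => f t - g t).
Proof.
move=> cf cg; apply: continuous_to_rV => i; under eq_fun do rewrite !mxE.
by apply: contB; exact: cont_coord.
Qed.

Lemma mulmx_norm_le n m (Q : 'M[R]_(n.+1, m.+1)) : exists2 K : R, 0 <= K & forall x : 'rV[R]_n.+1, `|x *m Q| <= K * `|x|.
Proof.
exists (\sum_k \sum_j `|Q k j|) => [|x]; first by do 2 (apply: sumr_ge0 => ? _).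
have S0 : 0 <= (\sum_k \sum_j `|Q k j|) * `|x| by rewrite mulr_ge0//; do 2 (apply: sumr_ge0 => ? _).
rewrite rV_norm_le//; apply/forallP => j; rewrite mxE.
apply: (le_trans (ler_norm_sum _ _ _)); rewrite mulr_suml; apply: ler_sum => k _.
rewrite normrM mulrC ler_pM ?coord_le_norm//.
by rewrite (bigD1 j)//= lerDl sumr_ge0.
Qed.

Lemma dot_mulmx n (a b : 'rV[R]_n) (Q : 'M[R]_n) : Q *m Q^T = 1%:M -> dot (a *m Q) (b *m Q) = dot a b.
Proof.
have dE (u v : 'rV[R]_n) : dot u v = (u *m v^T) ord0 ord0.
  by rewrite mxE; apply: eq_bigr => i _; rewrite mxE.
by move=> QQ; rewrite !dE trmx_mul mulmxA -[a *m Q *m Q^T]mulmxA QQ mulmx1.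
Qed.

End row_continuity.

Section graph_charts.
Context {R : realType}.
Notation V := 'rV[R]_3.
Notation V2 := 'rV[R]_2.
Variables (Q : 'M[R]_3) (phi : V2 -> R).
Hypotheses (QQ : Q *m Q^T = 1%:M) (phiC : class_C 1 phi).

Let QTQ : Q^T *m Q = 1%:M. Proof. exact: mulmx1C. Qed.

Definition lift3 (y : V2) (s : R) : V := row_mx y s%:M : 'rV[R]_(2 + 1).
Definition up (y : V2) (s : R) : V := lift3 y s *m Q.
Definition pr (q : V) : V2 := lsubmx (q *m Q^T : 'rV[R]_(2 + 1)).
Definition ht (q : V) : R := (q *m Q^T) ord0 2.

Lemma lift3E y s i : lift3 y s ord0 i = if i == 2 then s else y ord0 (inord i).
Proof.
have E (j : 'I_2) : lift3 y s ord0 (lshift 1 j) = y ord0 j := row_mxEl _ _ _ _.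
have E2 : lift3 y s ord0 (rshift 2 (0 : 'I_1)) = s.
  by apply: (etrans (row_mxEr _ _ _ _)); rewrite mxE eqxx mulr1n.
case: (ord3P i) => -> /=; last by rewrite -[RHS]E2; congr (lift3 _ _ _ _); exact: val_inj.
- by rewrite -E; congr (lift3 _ _ _ _); apply: val_inj; rewrite /= inordK.
- by rewrite -E; congr (lift3 _ _ _ _); apply: val_inj; rewrite /= inordK.
Qed.

Lemma lift3_pr q : lift3 (pr q) (ht q) = q *m Q^T.
Proof.
apply/rowP => i; rewrite lift3E /ht /pr; case: (ord3P i) => -> //=.
- by rewrite mxE; congr (fun_of_matrix _ _ _); apply: val_inj; rewrite /= inordK.
- by rewrite mxE; congr (fun_of_matrix _ _ _); apply: val_inj; rewrite /= inordK.
Qed.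

Lemma upK q : up (pr q) (ht q) = q.
Proof. by rewrite /up lift3_pr -mulmxA QTQ mulmx1. Qed.

Lemma up_flat y s : up y s *m Q^T = lift3 y s.
Proof. by rewrite /up -mulmxA QQ mulmx1. Qed.

Lemma pr_up y s : pr (up y s) = y.
Proof. by rewrite /pr up_flat /lift3 row_mxKl. Qed.

Lemma ht_up y s : ht (up y s) = s.
Proof. by rewrite /ht up_flat lift3E. Qed.

Lemma graph_pointE y : graph_point Q phi y = up y (phi y). Proof. by []. Qed.

(** Signed height above the graph: in a chart ball the surface is its zero set, and its sign
    distinguishes the two sides. *)
Definition level (q : V) : R := ht q - phi (pr q).

Lemma range_graph q : range (graph_point Q phi) q <-> level q = 0.
Proof.
split=> [[y _ <-]|/subr0_eq H]; first by rewrite /level graph_pointE ht_up pr_up subrr.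
by exists (pr q) => //; rewrite graph_pointE -H upK.
Qed.

Lemma continuous_pr : continuous pr.
Proof.
apply: continuous_to_rV => i; under eq_fun do rewrite mxE.
have H := @cont_coord _ V 2 (fun q : V => q *m Q^T) (lshift 1 i) (@continuous_mulmx _ _ _ (Q^T)); exact: H.
Qed.

Lemma continuous_ht : continuous ht.
Proof. have H := @cont_coord _ V 2 (fun q : V => q *m Q^T) 2 (@continuous_mulmx _ _ _ (Q^T)); exact: H. Qed.

Lemma up_add y s y' s' : up y s + up y' s' = up (y + y') (s + s').
Proof.
rewrite /up -mulmxDl; congr (_ *m _); apply/rowP => i; rewrite mxE !lift3E.
by case: eqP => // _; rewrite mxE.
Qed.

Lemma up_scale a y s : a *: up y s = up (a *: y) (a * s).
Proof.
rewrite /up scalemxAl; congr (_ *m _); apply/rowP => i; rewrite mxE !lift3E.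
by case: eqP => // _; rewrite mxE.
Qed.

Lemma up_opp y s : - up y s = up (- y) (- s).
Proof. by rewrite -scaleN1r up_scale scaleN1r mulN1r. Qed.

Lemma cvg_up (T : Type) (F : set_system T) {FF : Filter F} (y : T -> V2) (s : T -> R) y0 s0 :
  y @ F --> y0 -> s @ F --> s0 -> (fun t => up (y t) (s t)) @ F --> up y0 s0.
Proof.
move=> cy cs.
have upE z r : up z r = up z 0 + r *: up 0 1 by rewrite up_scale up_add !(addr0, add0r, scaler0, mulr1).
have cl : continuous (fun z : V2 => up z 0).
  apply: (cont_comp (f := fun z => lift3 z 0) _ (@continuous_mulmx _ _ _ Q)).
  apply: continuous_to_rV => i; under eq_fun do rewrite lift3E.
  by case: eqP => _; [exact: cst_continuous|exact: coord_continuous].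
rewrite upE; under eq_fun do rewrite upE.
have H1 := cvg_comp _ _ cy (cl y0).
have H2 : (fun t => s t *: up 0 1) @ F --> s0 *: up 0 1 by apply: cvgZr_tmp.
exact: (cvgD H1 H2).
Qed.

Lemma continuous_graph_point : continuous (graph_point Q phi).
Proof. by move=> y; have H := @cvg_up _ (nbhs y) _ (fun z => z) phi y (phi y) cvg_id (class_C_cont phiC (x := y)); exact: H. Qed.

Lemma continuous_level : continuous level.
Proof.
exact: contB continuous_ht (cont_comp continuous_pr (class_C_cont phiC)).
Qed.

Lemma level_vertical q t : level (q + up 0 t) = level q + t.
Proof.
rewrite -{1}[q]upK up_add /level pr_up ht_up addr0 addrAC; congr (_ - _ + _).
Qed.

Lemma chart_norm : exists2 K : R, 0 <= K & forall q, `|pr q| <= K * `|q|.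
Proof.
have [K K0 HK] := mulmx_norm_le Q^T; exists K => // q; apply: le_trans (HK q).
rewrite rV_norm_le//; apply/forallP => i; rewrite mxE; exact: coord_le_norm.
Qed.

Lemma dot_up y s y' s' : dot (up y s) (up y' s') = dot y y' + s * s'.
Proof.
rewrite dot_mulmx// /dot big_ord_recr/=; congr (_ + _); last by rewrite !lift3E.
apply: eq_bigr => i _; rewrite !lift3E.
have -> : (widen_ord (leqnSn 2) i == 2) = false.
  by apply/negP => /eqP/(congr1 val)/= E; have := ltn_ord i; rewrite E.
by congr (fun_of_matrix y _ _ * fun_of_matrix y' _ _); apply: val_inj; rewrite /= inordK.
Qed.

(* The unit normal pointing towards increasing height. *)
Definition up_normal (q : V) : V :=
  (Num.sqrt (1 + dot (grad phi (pr q)) (grad phi (pr q))))^-1 *: up (- grad phi (pr q)) 1.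

Lemma slope_gt0 y : 0 < 1 + dot (grad phi y) (grad phi y).
Proof. by rewrite ltr_pwDl// /dot sumr_ge0// => i _; rewrite -expr2 sqr_ge0. Qed.

Lemma continuous_partial_phi k : continuous (partial k phi).
Proof. exact: class_C_cont (class_C_partial k phiC). Qed.

Lemma continuous_slope : continuous (fun y => Num.sqrt (1 + dot (grad phi y) (grad phi y))).
Proof.
apply: (cont_comp (f := fun y => 1 + dot (grad phi y) (grad phi y)) (g := Num.sqrt)); last exact: sqrt_continuous.
apply: contD; first exact: cst_continuous.
have cg k : continuous (fun y => grad phi y ord0 k).
  by under eq_fun do rewrite mxE; exact: continuous_partial_phi.
by apply: cont_sum => k; apply: contM.
Qed.

Lemma continuous_up_normal : continuous up_normal.
Proof.
have cg : continuous (grad phi).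
  by apply: continuous_to_rV => k; under eq_fun do rewrite mxE; exact: continuous_partial_phi.
move=> q.
have H : (fun q => up (- grad phi (pr q)) 1) @ q --> up (- grad phi (pr q)) 1.
  have H := @cvg_up _ (nbhs q) _ (fun q => - grad phi (pr q)) (fun=> 1) (- grad phi (pr q)) 1 (cvgN (cont_comp continuous_pr cg (x := q))) (cvg_cst _).
  exact: H.
have S := cont_comp continuous_pr continuous_slope (x := q).
have N : Num.sqrt (1 + dot (grad phi (pr q)) (grad phi (pr q))) != 0.
  by rewrite gt_eqF// sqrtr_gt0 slope_gt0.
have W : (fun q => (Num.sqrt (1 + dot (grad phi (pr q)) (grad phi (pr q))))^-1) @ q -->
    (Num.sqrt (1 + dot (grad phi (pr q)) (grad phi (pr q))))^-1 by exact: (cvgV N S).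
exact: (cvgZ W H).
Qed.

Lemma graph_curve_is_derive y k :
  is_derive (0 : R) (1 : R) (fun t : R => graph_point Q phi (y + t *: delta_mx ord0 k))
    (up (delta_mx ord0 k) (partial k phi y)).
Proof.
have [D E] := class_C_is_derive k y phiC.
have H : (h^-1 *: (graph_point Q phi (y + (h *: 1 + 0) *: delta_mx ord0 k) - graph_point Q phi (y + 0 *: delta_mx ord0 k)))
    @[h --> (0 : R)^'] --> up (delta_mx ord0 k) (partial k phi y).
  have C : (h^-1 *: ((phi \o shift y) (h *: delta_mx ord0 k) - phi y)) @[h --> (0 : R)^'] --> partial k phi y.
    by rewrite -E; exact: D.
  apply: cvg_trans (cvg_up (cvg_cst (delta_mx ord0 k : V2)) C).
  apply: near_eq_cvg; near=> h.
  have h0 : h != 0 by near: h; exact: nbhs_dnbhs_neq.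
  have -> : (phi \o shift y) (h *: delta_mx ord0 k) = phi (h *: delta_mx ord0 k + y) by [].
  rewrite scale0r !graph_pointE up_opp up_add up_scale [_%:A]mulr1 !addr0.
  congr (up _ _); last by rewrite [_ + y]addrC.
  by rewrite addrAC subrr add0r scalerA mulVf// scale1r.
apply: DeriveDef; first by apply/cvg_ex; exists (up (delta_mx ord0 k) (partial k phi y)).
exact/cvg_lim.
Unshelve. all: by end_near. Qed.

End graph_charts.

Section compact_localization.
Context {R : realType}.
Notation V := 'rV[R]_3.

Lemma open_distance_ball (x : V) (r : R) : open [set q : V | `|x - q| < r].
Proof.
have -> : [set q : V | `|x - q| < r] = (fun q : V => `|x - q|) @^-1` [set s : R | s < r] by [].
apply: open_comp; last exact: open_lt.
move=> q _; have H : continuous (fun q : V => x - q).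
  by apply: continuous_subr; [exact: cst_continuous|move=> z; exact: cvg_id].
exact: (cvg_comp _ _ (H q) (@norm_continuous _ _ (x - q))).
Qed.

Lemma open_contains_ball (U : set V) (x : V) : open U -> U x ->
  exists2 r : R, 0 < r & [set q : V | `|x - q| < r] `<=` U.
Proof.
move=> oU Ux; have /nbhs_ballP[r /= r0 rU] := open_nbhs_nbhs (conj oU Ux : open_nbhs x U).
by exists r => // q xq; apply: rU; rewrite -ball_normE.
Qed.

(** A finite subcover, packaged as an induction principle that carries finite area, nullity and
    measurability of the normal from charts to the whole boundary. *)
Lemma compact_local (K : set V) (P : set V -> Prop) : compact K -> P set0 ->
  (forall A B, P A -> P B -> P (A `|` B)) ->
  (forall x, K x -> exists2 r : R, 0 < r & P [set q | `|x - q| < r]) ->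
  exists2 A, P A & K `<=` A.
Proof.
move=> cK P0 PU Pl.
have [f fP] : {f : V -> R & forall x, K x -> 0 < f x /\ P [set q | `|x - q| < f x]}.
  apply: (@choice _ _ (fun x r => K x -> 0 < r /\ P [set q | `|x - q| < r])) => x.
  have [Kx|nKx] := pselect (K x); last by exists 0.
  by have [r r0 Pr] := Pl x Kx; exists r.
move: cK; rewrite compact_cover => /(_ V K (fun x => [set q | `|x - q| < f x])) [].
- by move=> x _; exact: open_distance_ball.
- by move=> x Kx; exists x => //=; rewrite subrr normr0; have [] := fP x Kx.
move=> D' DK cov; eexists; last exact: cov.
have H (s : seq V) : (forall x, x \in s -> K x) -> P (\big[setU/set0]_(x <- s) [set q | `|x - q| < f x]).
  elim: s => [|x s IH] sK; first by rewrite big_nil.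
  rewrite big_cons; apply: PU; first by apply: (fP x _).2; apply: sK; rewrite mem_head.
  by apply: IH => y ys; apply: sK; rewrite inE ys orbT.
have := H (finmap.enum_fset D') _; rewrite -bigcup_seq; apply => x xD.
by have := DK x xD; rewrite inE.
Qed.

End compact_localization.

Section graph_surface.
Context {R : realType}.
Notation V := 'rV[R]_3.
Variables (Omega : set V) (theta : R) (nu : V -> V) (sigma : {measure set V -> \bar R}).
Hypotheses (oO : open Omega) (bO : bounded_set Omega)
  (surf : C2_holder_surface theta (boundary Omega))
  (nuP : outward_unit_normal Omega nu)
  (sigmaP : surface_measure (boundary Omega) sigma).

Let Sig := boundary Omega.

Lemma boundaryE : Sig = closure Omega `\` Omega.
Proof. by rewrite /Sig /boundary (_ : interior Omega = Omega)//; exact/interior_id. Qed.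

Lemma bounded_domain : exists2 M : R, 0 < M & forall x, closure Omega x -> `|x| <= M.
Proof.
move: bO => [M [_ HM]].
have M1 : 0 < `|M| + 1 by rewrite ltr_pwDr.
exists (`|M| + 1) => // x cx.
have H : Omega `<=` [set y : V | `|y| <= `|M| + 1].
  by move=> y Oy; apply: HM => //; rewrite (le_lt_trans (ler_norm _))// ltrDl.
have cl : closed [set y : V | `|y| <= `|M| + 1].
  have -> : [set y : V | `|y| <= `|M| + 1] = (fun y : V => `|y|) @^-1` [set s : R | s <= `|M| + 1] by [].
  by apply: closed_comp; [move=> y _; exact: norm_continuous|exact: closed_le].
by have := closure_subset H cx; rewrite -(closure_id _).1.
Qed.

Lemma closed_boundary : closed Sig.
Proof. by rewrite boundaryE setDE; apply: closedI; [exact: closed_closure|exact: open_closedC]. Qed.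

Lemma boundary_norm : exists2 M : R, 0 < M & forall x, Sig x -> `|x| <= M.
Proof.
by have [M M0 HM] := bounded_domain; exists M => // x; rewrite boundaryE => -[/HM].
Qed.

Lemma compact_boundary : compact Sig.
Proof.
have [M M0 HM] := boundary_norm.
apply: bounded_closed_compact closed_boundary.
exists M; split; first exact: num_real.
by move=> y My x /HM xM; rewrite /= (le_trans xM)// ltW.
Qed.

Definition chart_at (x : V) (r : R) (Q : 'M[R]_3) (phi : 'rV[R]_2 -> R) : Prop :=
  [/\ 0 < r, Q *m Q^T = 1%:M, class_C 1 phi &
    exists U, graph_on Sig U Q phi /\ [set q : V | `|x - q| < r] `<=` U].

Lemma charts x : Sig x -> exists r Q phi, chart_at x r Q phi.
Proof.
move=> Sx; have [U [Q [phi [Ux gr [phiC _]]]]] := surf Sx.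
have [oU QQ _] := gr; have [r r0 rU] := open_contains_ball oU Ux.
exists r, Q, phi; split => //; last by exists U.
exact: class_CW phiC.
Qed.

Section chart.
Variables (x : V) (r : R) (Q : 'M[R]_3) (phi : 'rV[R]_2 -> R).
Hypothesis ch : chart_at x r Q phi.
Let B : set V := [set q | `|x - q| < r].

Lemma chart_level q : B q -> Sig q <-> level Q phi q = 0.
Proof.
have [_ QQ _ [U [[_ _ E] BU]]] := ch => Bq.
rewrite -(range_graph phi QQ); split => [Sq|gq].
  by have := conj Sq (BU q Bq) : (Sig `&` U) q; rewrite E => -[].
by have := conj gq (BU q Bq) : (range (graph_point Q phi) `&` U) q; rewrite -E => -[].
Qed.

Let mB : measurable B. Proof. by apply: open_measurable_rV; exact: open_distance_ball. Qed.

Let B_norm q : B q -> `|q| <= `|x| + r.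
Proof.
rewrite /B /= distrC => /ltW qr; rewrite -[q](subrK x) (le_trans (ler_normD _ _))//.
by rewrite addrC lerD2l.
Qed.

(** The part of the graph in the ball has a bounded projection, on which the continuous area density
    is bounded. *)
Lemma chart_area_lty : (sigma B < +oo)%E.
Proof.
have [r0 QQ phiC [U [gr BU]]] := ch.
have [_ sE] := sigmaP; rewrite (sE U Q phi gr phiC B mB BU).
have [K K0 HK] := chart_norm Q.
pose M := K * (`|x| + r).
have [C C0 HC] := continuous_bounded M (continuous_slope phiC).
have cg := continuous_graph_point (Q := Q) phiC.
have mg : measurable (graph_point Q phi @^-1` B).
  by apply: open_measurable_rV; apply: open_comp => [y _|]; [exact: cg|exact: open_distance_ball].
have ms : measurable_fun [set: 'rV[R]_2] (fun y => (Num.sqrt (1 + dot (grad phi y) (grad phi y)))%:E).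
  apply/measurable_EFinP; apply: continuous_measurable_rV; exact: continuous_slope phiC.
have mM : measurable [set y : 'rV[R]_2 | `|y| <= M] by exact: measurable_norm_le.
have sub : graph_point Q phi @^-1` B `<=` [set y : 'rV[R]_2 | `|y| <= M].
  move=> y /B_norm gy; have := HK (graph_point Q phi y); rewrite graph_pointE pr_up// => H.
  by rewrite /= (le_trans H)// ler_wpM2l// -graph_pointE.
apply: (@le_lt_trans _ _ (\int[leb2]_(y in [set y : 'rV[R]_2 | (`|y| <= M)%R]) (C%:E))%E).
  apply: (@le_trans _ _ (\int[leb2]_(y in [set y : 'rV[R]_2 | (`|y| <= M)%R])
      (Num.sqrt (1 + dot (grad phi y) (grad phi y)))%:E)%E).
    apply: ge0_subset_integral => //; exact: measurable_funTS.
  apply: ge0_le_integral => //.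
  - exact: measurable_funTS.
  - by move=> y yM; rewrite lee_fin (le_trans (ler_norm _))// HC.
rewrite integral_cst// lte_mul_pinfty ?lee_fin//; exact: leb2_ball_lty.
Qed.

(* The translates of the graph in the direction of the height are disjoint. *)
Lemma chart_null : leb3 (Sig `&` B) = 0%E.
Proof.
have [r0 QQ phiC _] := ch.
pose S := Sig `&` B; pose v := up Q 0 1.
have mS : measurable S by apply: measurableI => //; apply: closed_measurable_rV; exact: closed_boundary.
pose M := `|x| + r + `|v|.
pose t (k : nat) : R := k.+1%:R^-1.
pose F N (k : 'I_N) := (fun q : V => q + t k *: v) @^-1` S.
have tr q (s : R) : q + s *: v = q + up Q 0 s by rewrite /v up_scale scaler0 mulr1.
have mF N (k : 'I_N) : measurable (F N k).
  have := measurable_translate (- (t k *: v)); under eq_fun do rewrite opprK.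
  by move=> /(_ measurableT S mS); rewrite setTI.
have FE N (k : 'I_N) : leb3 (F N k) = leb3 S by exact: leb3_translate.
have FM N (k : 'I_N) : F N k `<=` [set q : V | `|q| <= M].
  move=> q [_ /B_norm qM]; rewrite /= /M -[q](addrK (t k *: v)) (le_trans (ler_normB _ _))//.
  rewrite lerD// normrZ ler_piMl// normfV normr_nat invf_le1 ?ler1n// ltr0n.
have tF N : trivIset [set: 'I_N] (F N).
  move=> i j _ _ [q [[Si Bi] [Sj Bj]]].
  have := (chart_level Bi).1 Si; rewrite tr (level_vertical phi QQ)// => /eqP; rewrite addr_eq0 => /eqP E.
  have := (chart_level Bj).1 Sj; rewrite tr (level_vertical phi QQ)// E => /eqP; rewrite addrC subr_eq0 => /eqP.
  by move=> /invr_inj /eqP; rewrite eqr_nat eqSS => /eqP/val_inj.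
have le N : (\sum_(i < N) leb3 S <= leb3 [set q : V | (`|q| <= M)%R])%E.
  have mU : measurable (\big[setU/set0]_(i < N) F N i) by exact: bigsetU_measurable.
  have H := measure_semi_additive_ord leb3 (mF N) (tF N) mU.
  have -> : (\sum_(i < N) leb3 S = \sum_(i < N) leb3 (F N i))%E by apply: eq_bigr => i _; rewrite FE.
  rewrite -[leLHS]H; apply: le_measure; rewrite ?inE//; first exact: measurable_norm_le.
  by apply: (big_ind (fun A => A `<=` [set q : V | `|q| <= M])) => [q []|A A' HA HA' q [/HA|/HA']|i _].
have M0 : 0 <= M by rewrite !addr_ge0// ltW.
rewrite -/S; rewrite leb3_ballE// in le.
have Sfin : leb3 S \is a fin_num.
  have := le 1%N; rewrite big_ord1 => S1; rewrite ge0_fin_numE//.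
  by apply: le_lt_trans S1 _; exact: ltry.
rewrite -(fineK Sfin) in le *; congr (_ %:E); apply/eqP; rewrite eq_le fine_ge0// andbT leNgt.
apply/negP => s0; move: (fine (leb3 S)) s0 le => s s0 le.
have [N HN] : exists N : nat, (2 * M) ^+ 3 / s < N%:R.
  exists (Num.Def.archi_bound `|(2 * M) ^+ 3 / s|).
  exact: le_lt_trans (ler_norm _) (archi_boundP (normr_ge0 _)).
have := le N; rewrite sumEFin lee_fin sumr_const card_ord leNgt => /negP; apply.
by rewrite -[s *+ N]mulr_natl -ltr_pdivrMr.
Qed.

(** The coordinate curves of the graph supply tangent vectors; orthogonality to them forces nu to be
    a multiple of (- grad phi, 1) in the frame, and unit length fixes the multiple up to sign. *)
Lemma chart_normal q : Sig q -> B q ->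
  nu q = up_normal Q phi q \/ nu q = - up_normal Q phi q.
Proof.
have [r0 QQ phiC [U [[oU _ UE] BU]]] := ch => Sq Bq.
have [n1 nt _] := nuP Sq.
pose y := pr Q q; pose a := pr Q (nu q); pose b := ht Q (nu q).
have qE : q = graph_point Q phi y.
  have /subr0_eq H := (chart_level Bq).1 Sq.
  by rewrite graph_pointE -[phi y]H upK.
have ta k : tangent Sig q (up Q (delta_mx ord0 k) (partial k phi y)).
  exists (fun t : R => graph_point Q phi (y + t *: delta_mx ord0 k)); split.
  - by rewrite scale0r addr0 -qE.
  - have ct : (fun t : R => graph_point Q phi (y + t *: delta_mx ord0 k)) @ (0 : R) --> q.
      have c1 : (fun t : R => y + t *: (delta_mx ord0 k : 'rV[R]_2)) @ (0 : R) --> y.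
        rewrite -[X in _ --> X]addr0 -[X in _ + X](scale0r (delta_mx ord0 k)).
        by apply: cvgD; [exact: cvg_cst|apply: cvgZr_tmp; exact: cvg_id].
      by rewrite qE; exact: (cvg_comp _ _ c1 (continuous_graph_point (Q := Q) phiC (x := y))).
    have : \forall t \near (0 : R), U (graph_point Q phi (y + t *: delta_mx ord0 k)).
      by apply: ct; exact: (open_nbhs_nbhs (conj oU (BU q Bq) : open_nbhs q U)).
    apply: filterS => t Ut.
    have : (range (graph_point Q phi) `&` U) (graph_point Q phi (y + t *: delta_mx ord0 k)).
      by split => //; exists (y + t *: delta_mx ord0 k).
    by rewrite -UE => -[].
  - exact: graph_curve_is_derive.
have ak k : a ord0 k = - b * partial k phi y.
  have := nt _ (ta k); rewrite -[nu q](upK QQ) dot_up// -/a -/b => /eqP.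
  rewrite addr_eq0 mulNr => /eqP <-.
  rewrite /dot (bigD1 k)//= [delta_mx _ _ _ _]mxE !eqxx mulr1 big1 ?addr0// => l /negPf lk.
  by rewrite [delta_mx _ _ _ _]mxE lk andbF mulr0.
have nuE : nu q = b *: up Q (- grad phi y) 1.
  rewrite up_scale mulr1 -[LHS](upK QQ); congr (up _ _ _).
  by apply/rowP => k; rewrite -/a ak !mxE mulrN mulNr.
pose s := Num.sqrt (1 + dot (grad phi y) (grad phi y)).
have s0 : 0 < s by rewrite sqrtr_gt0 slope_gt0.
have s2 : s ^+ 2 = 1 + dot (grad phi y) (grad phi y) by rewrite sqr_sqrtr// ltW// slope_gt0.
have b2 : b ^+ 2 = s^-1 ^+ 2.
  move: n1; rewrite nuE; have -> : dot (b *: up Q (- grad phi y) 1) (b *: up Q (- grad phi y) 1) = b ^+ 2 * s ^+ 2.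
    rewrite up_scale dot_up// s2 /dot mulrDr mulr1 addrC; congr (_ + _); first by rewrite mulr1.
    by rewrite mulr_sumr; apply: eq_bigr => k _; rewrite !mxE; ring.
  by move=> H; apply: (mulIf (expf_neq0 2 (lt0r_neq0 s0))); rewrite H -exprMn mulVf ?expr1n// gt_eqF.
move/eqP: b2; rewrite eqf_sqr => /orP[/eqP bE|/eqP bE]; [left|right]; rewrite nuE bE ?scaleNr//.
Qed.

(** The normal is the continuous field [up_normal] up to sign, and the sign is read off from the
    side on which Omega lies, a Borel condition. *)
Lemma chart_measurable_normal i :
  measurable_fun (Sig `&` B) (fun q => nu q ord0 i : measurableTypeR R).
Proof.
have [r0 QQ phiC _] := ch.
have cn := continuous_up_normal (Q := Q) phiC.
(* Points from which small steps against [up_normal] eventually all end in Omega: on the surface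
   these are the points where nu is [up_normal]. Step lengths 1/(k+1) keep the set a countable
   combination of open sets. *)
pose E := \bigcup_K \bigcap_(k in [set k | (K <= k)%N])
  [set q | Omega (q - k.+1%:R^-1 *: up_normal Q phi q)].
have mE : measurable E.
  apply: bigcupT_measurable => K; apply: bigcap_measurableType => k _.
  apply: open_measurable_rV.
  have -> : [set q | Omega (q - k.+1%:R^-1 *: up_normal Q phi q)] =
    (fun q => q - k.+1%:R^-1 *: up_normal Q phi q) @^-1` Omega by [].
  apply: open_comp => // q _.
  apply: continuous_subr; first by move=> z; exact: cvg_id.
  apply: continuous_to_rV => j; under eq_fun do rewrite mxE.
  by apply: contM; [exact: cst_continuous|exact: cont_coord].
apply: (@eq_measurable_fun _ _ _ _ _ (fun q => (2 * \1_E q - 1) * up_normal Q phi q ord0 i)).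
  move=> q; rewrite inE => -[Sq Bq].
  have ev (P : V -> Prop) n : (\forall t \near (0 : R)^'+, P (q - t *: n)) ->
      exists K, forall k, (K <= k)%N -> P (q - k.+1%:R^-1 *: n).
    move=> H; have /nbhs_ballP[e /= e0 He] : nbhs (0 : R) [set t : R | 0 < t -> P (q - t *: n)] := H.
    exists (Num.Def.archi_bound e^-1) => k Kk; apply: He; last by rewrite invr_gt0.
    rewrite -ball_normE /= sub0r normrN gtr0_norm ?invr_gt0// invf_plt ?posrE//.
    apply: lt_le_trans (archi_boundP _) _; first by rewrite invr_ge0 ltW.
    by rewrite ler_nat leqW.
  have [_ _ side] := nuP Sq.
  have [nE|nE] := chart_normal Sq Bq.
    have [K HK] : exists K, forall k, (K <= k)%N -> Omega (q - k.+1%:R^-1 *: up_normal Q phi q).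
      by apply: ev; apply: filterS side => t []; rewrite nE.
    have Eq : E q by exists K.
    by rewrite nE indicE mem_set// mulr1 -[2]/(1 + 1) addrK mul1r.
  have [K HK] : exists K, forall k, (K <= k)%N -> ~ Omega (q - k.+1%:R^-1 *: up_normal Q phi q).
    by apply: (ev (fun z => ~ Omega z)); apply: filterS side => t []; rewrite nE scalerN.
  have Eq : ~ E q.
    move=> [K' _ HK']; apply: (HK (maxn K K')); first exact: leq_maxl.
    by apply: HK'; rewrite /= leq_maxr.
  by rewrite nE indicE memNset// mulr0 sub0r mulN1r [RHS]mxE.
apply: measurable_funTS; apply: measurable_funM.
  by apply: measurable_funB => //; apply: measurable_funM => //; exact: measurable_indic.
by apply: continuous_measurable_rV; exact: cont_coord.
Qed.

End chart.

Lemma boundary_regular : [/\ (sigma Sig < +oo)%E, leb3 Sig = 0%E &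
  forall i, measurable_fun Sig (fun q => nu q ord0 i : measurableTypeR R)].
Proof.
have mS : measurable Sig by apply: closed_measurable_rV; exact: closed_boundary.
pose P (A : set V) := [/\ measurable A, (sigma A < +oo)%E, leb3 (Sig `&` A) = 0%E &
  forall i, measurable_fun (Sig `&` A) (fun q => nu q ord0 i : measurableTypeR R)].
have [||x Sx|A [mA sA lA nA] SA] := @compact_local R Sig P compact_boundary.
- by split; rewrite ?measure0 ?setI0 ?measure0// => i; exact: measurable_fun_set0.
- move=> A B [mA sA lA nA] [mB sB lB nB]; split.
  + exact: measurableU.
  + by apply: (le_lt_trans (measureU2 sigma mA mB)); exact: lte_add_pinfty.
  + rewrite setIUr; apply/eqP; rewrite eq_le measure_ge0 andbT.
    have H : (leb3 ((Sig `&` A) `|` (Sig `&` B)) <= leb3 (Sig `&` A) + leb3 (Sig `&` B))%E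
      := measureU2 leb3 (measurableI _ _ mS mA) (measurableI _ _ mS mB).
    by apply: (le_trans H); rewrite lA lB adde0.
  + by move=> i; rewrite setIUr; apply/measurable_funU; [exact: measurableI|exact: measurableI|split].
- have [r [Q [phi ch]]] := charts Sx; exists r; first by case: ch.
  split.
  + by apply: open_measurable_rV; exact: open_distance_ball.
  + exact: chart_area_lty ch.
  + exact: chart_null ch.
  + by move=> i; exact: chart_measurable_normal ch i.
have E : Sig `&` A = Sig by apply/setIidPl.
rewrite E in lA nA; split => //.
by apply: le_lt_trans sA; apply: le_measure; rewrite ?inE.
Qed.

End graph_surface.

(** * Continuation to the exterior domain *)

Section exterior_continuation.
Context {R : realType}.
Notation V := 'rV[R]_3.

Lemma segment_dichotomy (A B : set V) (g : R -> V) : open A -> open B -> A `&` B = set0 ->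
  continuous g -> (forall t, 0 <= t <= 1 -> (A `|` B) (g t)) -> A (g 0) -> A (g 1).
Proof.
move=> oA oB AB cg ABg A0.
have H : `[0, 1]%classic `&` g @^-1` A = `[0, 1]%classic.
  apply: segment_connected.
  - by exists 0; split => //=; rewrite in_itv/= lexx ler01.
  - by exists (g @^-1` A) => //; apply: open_comp => // x _; exact: cg.
  - exists (~` (g @^-1` B)); first by apply: open_closedC; apply: open_comp => // x _; exact: cg.
    apply/seteqP; split => t [t01 Pt]; split => //.
      by move=> Bt; have : (A `&` B) (g t) by []; rewrite AB.
    by move: t01; rewrite /= in_itv/= => /ABg[].
have : (`[0, 1]%classic : set R) 1 by rewrite /= in_itv/= ler01 lexx.
by rewrite -H => -[].
Qed.

Variables (Omega : set V) (theta : R).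
Hypotheses (oO : open Omega) (bO : bounded_set Omega) (connC : connected (~` Omega))
  (surf : C2_holder_surface theta (boundary Omega)).

Let Sig := boundary Omega.
Let ext := ~` closure Omega.

Let oext : open ext. Proof. by apply: closed_openC; exact: closed_closure. Qed.

Let trichotomy x : [\/ Omega x, Sig x | ext x].
Proof.
have [cx|] := pselect (closure Omega x); last by move=> ?; apply: Or33.
have [Ox|nO] := pselect (Omega x); first exact: Or31.
by apply: Or32; rewrite /Sig boundaryE.
Qed.

Let sub_closureO : Omega `<=` closure Omega. Proof. exact: subset_closure. Qed.
Let SigO x : Sig x -> ~ Omega x. Proof. by rewrite /Sig boundaryE// => -[]. Qed.
Let Sigext x : Sig x -> ~ ext x. Proof. by rewrite /Sig boundaryE// => -[cx _]; apply. Qed.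

Variables (U : V -> R) (K R1 : R).
Hypotheses (K_gt0 : 0 < K) (far : forall x, R1 < `|x| -> U x = 0)
  (step : forall x r, 0 < r -> (forall y, Sig y -> r <= `|x - y|) ->
    (\forall z \near x, U z = 0) -> forall h, K * `|h| <= r -> U (x + h) = 0).

(** Exterior points near which U vanishes. The exterior will be exhausted by showing that the
    closure of this set contains the complement of Omega. *)
Let S := ext `&` interior [set z | U z = 0].
Let oS : open S. Proof. by apply: openI => //; exact: open_interior. Qed.

(** Near an exterior point x the distance to the boundary is bounded below, so the continuation from
    a point of S close enough to x reaches past x. *)
Let S_closed x : ext x -> closure S x -> S x.
Proof.
move=> ex cx; split => //.
have [r r0 rext] := open_contains_ball oext ex.
(* A point x1 of S within d of x is at distance at least r / 2 from the boundary, so U vanishes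
   within r / (2 K) >= 2 d of x1, hence within d of x. *)
pose d := Num.min (r / 2) (r / 2 / (2 * K)).
have d0 : 0 < d by rewrite lt_min !divr_gt0// mulr_gt0.
have nb : nbhs x [set q : V | `|x - q| < d].
  by apply: open_nbhs_nbhs; split; [exact: open_distance_ball|rewrite /= subrr normr0].
have [x1 [[ex1 Sx1] xx1]] := cx _ nb.
apply: filterS nb => z /= zd.
have dr : d <= r / 2 by rewrite ge_min lexx.
have dK : K * (2 * d) <= r / 2.
  have : d <= r / 2 / (2 * K) by rewrite ge_min lexx orbT.
  by rewrite ler_pdivlMr ?mulr_gt0//; have -> : K * (2 * d) = d * (2 * K) by ring.
rewrite -[z](subrK x1) addrC; apply: (@step x1 (r / 2) _ _ Sx1).
- by rewrite divr_gt0.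
- move=> y Sy; rewrite leNgt; apply/negP => yr; apply: (Sigext Sy); apply: rext => /=.
  rewrite -[x - y](subrKA x1) (le_lt_trans (ler_normD _ _))//.
  move: xx1 yr dr; rewrite /=; move: (`|x - x1|) (`|x1 - y|) => a b *; lra.
- apply: le_trans dK; rewrite ler_wpM2l ?(ltW K_gt0)//.
  rewrite -(subrKA x) (le_trans (ler_normD _ _))// [`|z - x|]distrC.
  move: xx1 zd; rewrite /=; move: (`|x - x1|) (`|x - z|) => a b *; lra.
Qed.

Section crossing.
Variables (x : V) (r : R) (Q : 'M[R]_3) (phi : 'rV[R]_2 -> R).
Hypotheses (ch : chart_at Omega x r Q phi) (Sx : Sig x).

Let QQ : Q *m Q^T = 1%:M. Proof. by case: ch. Qed.
Let phiC : class_C 1 phi. Proof. by case: ch. Qed.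
Let lev := level Q phi.

(** Coordinates flattening the surface: s is the height above the graph. *)
Let param (y : 'rV[R]_2) (s : R) : V := up Q y (phi y + s).

Let paramK q : param (pr Q q) (lev q) = q.
Proof. by rewrite /param /lev /level addrC subrK upK. Qed.

Let lev_param y s : lev (param y s) = s.
Proof. by rewrite /lev /level /param ht_up// pr_up// addrAC subrr add0r. Qed.

Let pr_param y s : pr Q (param y s) = y. Proof. by rewrite /param pr_up. Qed.

Lemma crossing_neighborhood : exists d, [/\ 0 < d,
  forall y s, `|pr Q x - y| < d -> `|s| < d -> `|x - param y s| < r &
  open [set q | `|pr Q x - pr Q q| < d /\ `|lev q| < d]].
Proof.
have lx : lev x = 0 by apply/(chart_level ch) => //; rewrite /= subrr normr0; case: ch.
have C : (fun p : 'rV[R]_2 * R => param p.1 p.2) @ (pr Q x, 0 : R) --> x.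
  rewrite -[X in _ --> X]paramK lx; apply: cvg_up; first exact: cvg_fst.
  apply: cvgD; last exact: cvg_snd.
  by apply: (cvg_comp _ _ cvg_fst); exact: (class_C_cont phiC).
have r0 : 0 < r by case: ch.
move/cvgrPdist_lt : C => /(_ r r0) /nbhs_ballP[d /= d0 dH].
exists d; split => // [y s yd sd|].
  apply: (dH (y, s)); split => /=; rewrite -ball_normE//=.
  by rewrite sub0r normrN.
have -> : [set q | `|pr Q x - pr Q q| < d /\ `|lev q| < d] =
  ((fun q => `|pr Q x - pr Q q|) @^-1` [set s : R | s < d]) `&` ((fun q => `|lev q|) @^-1` [set s : R | s < d]) by [].
apply: openI; apply: open_comp; try exact: open_lt; move=> q _.
  have H : continuous (fun q : V => pr Q x - pr Q q).
    by apply: continuous_subr; [exact: cst_continuous|exact: continuous_pr].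
  exact: (cvg_comp _ _ (H q) (@norm_continuous _ _ (pr Q x - pr Q q))).
exact: (cvg_comp _ _ (continuous_level (Q := Q) phiC (x := q)) (@norm_continuous _ _ (lev q))).
Qed.

(** The graph divides N into two sides. A side that meets S lies in S, because S is both open and
    closed off Omega and the surface; points of Omega near x must then be on the other side, which
    lies in Omega. Points of the graph itself are limits of the side in S. *)
Lemma crossing : closure S x -> nbhs x (Omega `|` closure S).
Proof.
move=> cSx; have [d [d0 dB oN]] := crossing_neighborhood.
set N := [set q | _] in oN.
have lx : lev x = 0 by apply/(chart_level ch) => //; rewrite /= subrr normr0; case: ch.
have Nx : nbhs x N by apply: open_nbhs_nbhs; split => //; rewrite /N /= subrr normr0 lx normr0.
have NB q : N q -> `|x - q| < r by move=> [q1 q2]; rewrite -[q]paramK; exact: dB.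
have NSig q : N q -> Sig q <-> lev q = 0 by move=> /NB; exact: (chart_level ch).
(* Two points of N on the same side of the graph are joined inside that side. *)
have side (A B : set V) (s : R) z q : open A -> open B -> A `&` B = set0 ->
    (forall p, ~ Sig p -> (A `|` B) p) -> N z -> N q -> A z ->
    0 < s * lev z -> 0 < s * lev q -> A q.
  move=> oA oB AB cov [z1 z2] [q1 q2] Az sz sq.
  pose g (t : R) := param (pr Q z + t *: (pr Q q - pr Q z)) (lev z + t * (lev q - lev z)).
  have g0 : g 0 = z by rewrite /g scale0r mul0r !addr0 paramK.
  have g1 : g 1 = q by rewrite /g scale1r mul1r [pr Q z + _]addrC subrK [lev z + _]addrC subrK paramK.
  rewrite -g1; apply: (segment_dichotomy oA oB AB); last by rewrite g0.
    move=> t.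
    have c1 : (fun t : R => pr Q z + t *: (pr Q q - pr Q z)) @ t --> pr Q z + t *: (pr Q q - pr Q z).
      by apply: cvgD; [exact: cvg_cst|apply: cvgZr_tmp; exact: cvg_id].
    apply: (cvg_up c1); apply: cvgD; first exact: (cvg_comp _ _ c1 (class_C_cont phiC (x := _))).
    by apply: cvgD; [exact: cvg_cst|apply: cvgMr_tmp; exact: cvg_id].
  move=> t /andP[t0 t1]; apply: cov.
  have t1' : 0 <= 1 - t by rewrite subr_ge0.
  have conv (a b : R) : 0 < a -> 0 < b -> 0 < a + t * (b - a).
    move=> a0 b0; have -> : a + t * (b - a) = (1 - t) * a + t * b by ring.
    have [->|tn] := eqVneq t 0; first by rewrite subr0 mul1r mul0r addr0.
    by rewrite ltr_wpDl ?mulr_ge0 ?(ltW a0)// mulr_gt0// lt_neqAle eq_sym tn.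
  have Ng : N (g t).
    split; rewrite /g ?pr_param ?lev_param.
      have -> : pr Q x - (pr Q z + t *: (pr Q q - pr Q z)) = (1 - t) *: (pr Q x - pr Q z) + t *: (pr Q x - pr Q q).
        by apply/rowP => i; rewrite !mxE; ring.
      rewrite (le_lt_trans (ler_normD _ _))// !normrZ (ger0_norm t0) (ger0_norm t1').
      have := conv (d - `|pr Q x - pr Q z|) (d - `|pr Q x - pr Q q|).
      rewrite !subr_gt0 => /(_ z1 q1).
      move: (`|pr Q x - pr Q z|) (`|pr Q x - pr Q q|) => a b H; rewrite -subr_gt0.
      by have -> : d - ((1 - t) * a + t * b) = d - a + t * (d - b - (d - a)) by ring.
    have -> : lev z + t * (lev q - lev z) = (1 - t) * lev z + t * lev q by ring.
    rewrite (le_lt_trans (ler_normD _ _))// !normrM (ger0_norm t0) (ger0_norm t1').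
    have := conv (d - `|lev z|) (d - `|lev q|).
    rewrite !subr_gt0 => /(_ z2 q2).
    move: (`|lev z|) (`|lev q|) => a b H; rewrite -subr_gt0.
    by have -> : d - ((1 - t) * a + t * b) = d - a + t * (d - b - (d - a)) by ring.
  move=> /(NSig _ Ng).1; rewrite /g lev_param => E.
  have := conv _ _ sz sq; rewrite (_ : s * lev z + t * (s * lev q - s * lev z) =
    s * (lev z + t * (lev q - lev z))); last by ring.
  by rewrite E mulr0 ltxx.
have [z [Sz Nz]] := cSx _ Nx.
have lz : lev z != 0 by apply/eqP => /(NSig z Nz).2 /Sigext; apply; case: Sz.
pose s := lev z.
have sz : 0 < s * lev z by rewrite -expr2 exprn_even_gt0.
(* The remaining points off the surface, those of Omega and the exterior points outside the closure
   of S, form an open set disjoint from S. *)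
have inS q : N q -> 0 < s * lev q -> S q.
  move=> Nq; apply: (side S (Omega `|` (ext `&` ~` closure S)) s z q) => //.
  - by apply: openU => //; apply: openI => //; apply: closed_openC; exact: closed_closure.
  - rewrite -subset0 => p [[ep Sp] [Op|[_ nS]]]; first exact/ep/sub_closureO.
    by apply: nS; exact: subset_closure.
  - move=> p nSp; have [Op|//|ep] := trichotomy p; first by right; left.
    have [cp|ncp] := pselect (closure S p); first by left; exact: S_closed.
    by right; right.
have [z' [Oz' Nz']] : Omega `&` N !=set0.
  by move: Sx; rewrite /Sig boundaryE// => -[cx _]; exact: cx.
(* The point z' of Omega cannot lie on the side of S, which consists of exterior points. *)
have inO q : N q -> s * lev q < 0 -> Omega q.
  have lz' : lev z' != 0 by apply/eqP => /(NSig z' Nz').2 /SigO; exact.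
  have s0 : s != 0 by [].
  have sz' : s * lev z' < 0.
    rewrite lt_neqAle mulf_neq0//= leNgt; apply/negP => /(inS z' Nz')[ez' _].
    exact/ez'/sub_closureO.
  move=> Nq sq; apply: (side Omega ext (- s) z' q) => //.
  - by rewrite -subset0 => p [Op ep]; exact/ep/sub_closureO.
  - by move=> p nSp; have [Op|//|ep] := trichotomy p; [left|right].
  - by rewrite mulNr oppr_gt0.
  - by rewrite mulNr oppr_gt0.
apply: filterS Nx => q Nq.
have [sq|sq|sq] := ltgtP (s * lev q) 0; first by left; exact: inO.
  by right; apply: subset_closure; exact: inS.
(* A point of the graph is approached by moving it vertically by t s, towards the side of S. *)
right=> W Wq.
have /nbhs_ballP[e /= e0 eH] : nbhs q (W `&` N) by apply: filterI => //; exact: (open_nbhs_nbhs (conj oN Nq : open_nbhs q N)).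
pose v := up Q 0 1.
have v1 : 0 < `|s| * (`|v| + 1) by rewrite mulr_gt0 ?normr_gt0 ?ltr_pwDr.
pose t := e / 2 / (`|s| * (`|v| + 1)).
have t0 : 0 < t by rewrite !divr_gt0.
have qv : (W `&` N) (q + up Q 0 (t * s)).
  apply: eH; rewrite -ball_normE /= opprD addrA subrr add0r normrN.
  have -> : up Q 0 (t * s) = (t * s) *: v by rewrite /v up_scale scaler0 mulr1.
  rewrite normrZ normrM (gtr0_norm t0) -mulrA.
  have : t * (`|s| * `|v|) <= t * (`|s| * (`|v| + 1)).
    by rewrite ler_wpM2l ?(ltW t0)// ler_wpM2l// lerDl.
  move/le_lt_trans; apply; by rewrite /t divfK ?gt_eqF// ltr_pdivrMr// ltr_pMr// ltr1n.
exists (q + up Q 0 (t * s)); split; last by case: qv.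
apply: inS; first by case: qv.
by rewrite /lev level_vertical// mulrDr -/lev sq add0r mulrCA mulr_gt0//.
Qed.

End crossing.

(** Within the complement of Omega the closure of S is nonempty because U vanishes far away,
    relatively open by [S_closed] and [crossing], and closed. *)
Lemma exterior_vanishing x : ext x -> U x = 0.
Proof.
have [M M0 HM] := bounded_domain bO.
have P : ~` Omega `&` closure S = ~` Omega.
  apply: connC.
  (* A constant vector of norm at least m lies beyond R1 and beyond the closure of Omega. *)
  - pose m := `|R1| + M + 1.
    have m0 : 0 <= m by rewrite !addr_ge0// ltW.
    have nm : m <= `|const_mx m : V|.
      by rewrite -[leLHS](ger0_norm m0); have := coord_le_norm (const_mx m : V) 0; rewrite mxE.
    have big (a : R) : a <= `|R1| + M -> a < `|const_mx m : V|.
      by move=> am; apply: (le_lt_trans am); apply: lt_le_trans nm; rewrite /m ltrDl.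
    have em : ext (const_mx m).
      by move=> /HM; apply/negP; rewrite -ltNge big// lerDr.
    exists (const_mx m); split; first by move=> /sub_closureO.
    have o1 : open [set q : V | R1 < `|q|].
      have -> : [set q : V | R1 < `|q|] = (fun q : V => `|q|) @^-1` [set s : R | R1 < s] by [].
      by apply: open_comp; [move=> q _; exact: norm_continuous|exact: open_gt].
    have b1 : [set q : V | R1 < `|q|] (const_mx m).
      by rewrite /= big// (le_trans (ler_norm _))// lerDl ltW.
    apply: subset_closure; split => //.
    by apply: filterS (open_nbhs_nbhs (conj o1 b1 : open_nbhs (const_mx m : V) _)) => q; exact: far.
  - exists (interior (Omega `|` closure S)); first exact: open_interior.
    apply/seteqP; split=> q [nO].
      move=> cq; split => //; have [//|Sq|eq] := trichotomy q.
        have [r [Q [phi ch]]] := charts surf Sq; exact: (crossing ch Sq cq).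
      apply: filterS (open_nbhs_nbhs (conj oS (S_closed eq cq) : open_nbhs q S)) => z Sz.
      by right; exact: subset_closure.
    by move=> /interior_subset [|].
  - by exists (closure S) => //; exact: closed_closure.
move=> ex; have nO : (~` Omega) x by move=> /sub_closureO.
have [_ /(S_closed ex)[_ /interior_subset]] : (~` Omega `&` closure S) x by rewrite P.
exact.
Qed.

End exterior_continuation.

(** * Potentials of boundary densities *)

Section potential_fubini.
Context {R : realType}.
Notation V := 'rV[R]_3.
Variable s : {finite_measure set V -> \bar R}.
Variables (m k g : V -> R) (N : set V) (R0 M C G : R).
Hypotheses (im : s.-integrable [set: V] (EFin \o m)) (mk_ : measurable_fun [set: V] k)
  (mg : measurable_fun [set: V] g) (mN : measurable N) (N0 : leb3 N = 0%E)
  (R0_ge0 : 0 <= R0) (M_ge0 : 0 <= M) (C_ge0 : 0 <= C)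
  (mR : forall y, m y != 0 -> `|y| <= R0)
  (kC : forall z, `|k z| <= C * (1 + qe 0 z ^+ 2))
  (gG : forall x, `|g x| <= G) (gM : forall x, M < `|x| -> g x = 0)
  (iN : forall x, ~ N x -> s.-integrable [set: V] (EFin \o (fun y => m y * k (x - y)))).

Let mm : measurable_fun [set: V] m.
Proof. by apply/measurable_EFinP; exact: measurable_int im. Qed.

Let M1 := M + R0 + 1.
Let M1_ge1 : 1 <= M1. Proof. by rewrite /M1 lerDr addr_ge0. Qed.
Let G_ge0 : 0 <= G. Proof. exact: le_trans (normr_ge0 _) (gG 0). Qed.

(** An integrable majorant depending on x - y only. The radius M + R0 + 1 makes the cut-off 1 at x -
    y for all x in the support of g and y in that of m. *)
Let h (z : V) : R := C * G * (cutf M1 z ^+ 2 + qe 0 z ^+ 2 * cutf M1 z ^+ 2).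

Let ih : leb3.-integrable [set: V] (EFin \o h).
Proof.
have cc : continuous (fun z : V => cutf M1 z ^+ 2).
  exact: (class_C_cont (class_CX 2 (class_C_cut _ M1))).
have i1 : leb3.-integrable [set: V] (EFin \o (fun z : V => cutf M1 z ^+ 2)).
  apply: (continuous_support_integrable (M := M1 + 4) cc) => x xM.
  by rewrite cut0 ?expr0n// (le_trans ler01).
exact: (integrableZl measurableT (C * G) (integrableD measurableT i1 (integrable_cut_qe2 M1_ge1))).
Qed.

Let mh : measurable_fun [set: V] h.
Proof. by apply/measurable_EFinP; exact: measurable_int ih. Qed.

Let h_ge0 z : 0 <= h z.
Proof.
have c0 : 0 <= cutf M1 z ^+ 2 by exact: sqr_ge0.
have q0 : 0 <= qe 0 z ^+ 2 by exact: sqr_ge0.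
exact: mulr_ge0 (mulr_ge0 C_ge0 G_ge0) (addr_ge0 c0 (mulr_ge0 q0 c0)).
Qed.

Let kgh x y : `|y| <= R0 -> `|k (x - y) * g x| <= h (x - y).
Proof.
move=> yR; have [xM|/gM ->] := leP `|x| M; last by rewrite mulr0 normr0 h_ge0.
have c1 : cutf M1 (x - y) = 1.
  by apply: cut1; rewrite (le_trans (ler_normB _ _))// /M1 -addrA lerD// (le_trans yR)// lerDl.
rewrite /h c1 expr1n mulr1 normrM mulrAC; apply: ler_pM => //.
Qed.

Let F (xy : V * V) : R := m xy.2 * k (xy.1 - xy.2) * g xy.1.

Let mF : measurable_fun [set: V * V] F.
Proof.
have md : measurable_fun [set: V * V] (fun xy : V * V => xy.1 - xy.2).
  apply: measurable_to_rV => i; under eq_fun do rewrite !mxE.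
  apply: measurable_funB; exact: (measurableT_comp (measurable_coord i)).
apply: measurable_funM; last exact: (measurableT_comp mg measurable_fst).
apply: measurable_funM; first exact: (measurableT_comp mm measurable_snd).
exact: (measurableT_comp mk_ md).
Qed.

Let D := \int[leb3]_z h z.

(** By translation invariance the integral in x of the majorant is the same for all y, so the
    iterated integral is at most D times the integral of |m|. *)
Let iF : (leb3 \x s)%E.-integrable [set: V * V] (EFin \o F).
Proof.
apply/integrable21ltyP; first by apply/measurable_EFinP; exact: mF.
have le y : (\int[leb3]_x `|(F (x, y))%:E| <= (D * `|m y|)%:E)%E.
  have it := integrable_translate y mh ih.
  have iz : leb3.-integrable [set: V] (EFin \o (fun x => `|m y| * h (x - y))).
    exact: (integrableZl measurableT `|m y| it.1).
  have -> : (D * `|m y|)%:E = (\int[leb3]_x (`|m y| * h (x - y))%:E)%E.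
    rewrite -[RHS](fineK (integrable_fin_num measurableT iz)); congr EFin.
    have H := RintegralZl `|m y| measurableT it.1.
    by apply: (etrans _ (esym H)); rewrite it.2 mulrC.
  apply: ge0_le_integral => //.
  - have mFy : measurable_fun [set: V] (fun x => F (x, y)).
      exact: (measurableT_comp mF (measurable_pair2 y)).
    by apply: (measurableT_comp (f := abse)) => //; apply/measurable_EFinP; exact: mFy.
  - exact: measurable_int iz.
  - move=> x _; rewrite lee_fin /F /= -mulrA normrM.
    have [->|my] := eqVneq (m y) 0; first by rewrite normr0 !mul0r.
    by rewrite ler_wpM2l// kgh// mR.
apply: (@le_lt_trans _ _ (\int[s]_y (D * `|m y|)%:E)%E).
  apply: ge0_le_integral => //.
  - by move=> y _; exact: integral_ge0.
  - have mA : measurable_fun [set: V * V] (abse \o (EFin \o F)).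
      by apply: (measurableT_comp (f := abse)) => //; apply/measurable_EFinP; exact: mF.
    have A0 (xy : V * V) : (0 <= (abse \o (EFin \o F)) xy)%E by exact: abse_ge0.
    have Hm : measurable_fun [set: V] (fubini_G (@leb3 R) (abse \o (EFin \o F))).
      by apply: measurable_fun_fubini_tonelli_G; [exact: mA|exact: A0].
    exact: Hm.
  - by apply/measurable_EFinP; apply: measurable_funM => //; exact: measurableT_comp.
  - by move=> y _; exact: le.
have im' : s.-integrable [set: V] (EFin \o (fun y => D * `|m y|)).
  exact: (integrableZl measurableT D (integrable_norm im)).
by have := integrable_fin_num measurableT im'; rewrite fin_numElt => /andP[_]; exact.
Qed.

Let H : V -> R := (fun x => (\int[s]_y (m y * k (x - y))) * g x) \_ (~` N).

(** Off N the inner integral converges absolutely, so its real value agrees with the extended one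
    used by Fubini's theorem; on N both sides are set to 0. *)
Let HE : EFin \o H = (fubini_F s (EFin \o F)) \_ (~` N).
Proof.
apply/funext => x; rewrite /H /= !patchE; case: ifPn => // /set_mem Nx.
rewrite /fubini_F /=; have ix := iN Nx.
have ixg : s.-integrable [set: V] (EFin \o (fun y => m y * k (x - y) * g x)).
  exact: (integrableZr measurableT (g x) ix).
rewrite -[RHS](fineK (integrable_fin_num measurableT ixg)); congr EFin.
by apply/esym; exact: (RintegralZr (g x) measurableT ix).
Qed.

Lemma potential_integrable : leb3.-integrable [set: V] (EFin \o H).
Proof.
rewrite HE; apply: (integrable_mkcond _ (measurableC mN)).1.
exact: (integrableS measurableT (measurableC mN) (@subsetT _ _) (integrable_fubini_F iF)).
Qed.

Let mkg y : measurable_fun [set: V] (fun x => k (x - y) * g x).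
Proof. by apply: measurable_funM => //; apply: (measurableT_comp mk_); exact: measurable_translate. Qed.

Let ikg y : m y != 0 -> leb3.-integrable [set: V] (EFin \o (fun x => k (x - y) * g x)).
Proof.
move=> my; have it := integrable_translate y mh ih.
by apply: (integrable_le (mkg y) it.1) => x; apply: kgh; exact: mR.
Qed.

Let GE y : fubini_G (@leb3 R) (EFin \o F) y = (m y * \int[leb3]_x (k (x - y) * g x))%:E.
Proof.
rewrite /fubini_G; have [my|my] := eqVneq (m y) 0.
  by rewrite my mul0r integral0_eq// => x _; rewrite /F /= my !mul0r.
have izg : leb3.-integrable [set: V] (EFin \o (fun x => m y * (k (x - y) * g x))).
  exact: (integrableZl measurableT (m y) (ikg my)).
have -> : (\int[leb3]_x (EFin \o F) (x, y) = \int[leb3]_x (m y * (k (x - y) * g x))%:E)%E.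
  by apply: eq_integral => x _; rewrite /F /= mulrA.
rewrite -[LHS](fineK (integrable_fin_num measurableT izg)); congr EFin.
exact: (RintegralZl (m y) measurableT (ikg my)).
Qed.

Lemma potential_dual_integrable :
  s.-integrable [set: V] (EFin \o (fun y => m y * \int[leb3]_x (k (x - y) * g x))).
Proof.
have im' : s.-integrable [set: V] (EFin \o (fun y => D * `|m y|)).
  exact: (integrableZl measurableT D (integrable_norm im)).
apply: integrable_le im' _.
  apply/measurable_EFinP; have := measurable_fubini_G iF.
  by apply: eq_measurable_fun => y _; rewrite GE.
move=> y; rewrite normrM mulrC; have [->|my] := eqVneq (m y) 0; first by rewrite normr0 !mulr0.
rewrite ler_wpM2r//; have it := integrable_translate y mh ih.
apply: (le_trans (le_normr_Rintegral measurableT (ikg my))).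
rewrite /D -it.2; apply: le_Rintegral => //; first exact: (integrable_norm (ikg my)).
  exact: it.1.
by move=> x _; apply: kgh; exact: mR.
Qed.

(** Discarding the null set N does not change the outer integral; the rest is the exchange of
    integrations. *)
Lemma potential_fubini : \int[leb3]_x H x = \int[s]_y (m y * \int[leb3]_x (k (x - y) * g x)).
Proof.
have -> : \int[leb3]_x H x = fine (\int[leb3]_x fubini_F s (EFin \o F) x)%E.
  congr fine; have -> : (\int[leb3]_x (H x)%:E = \int[leb3]_x (fubini_F s (EFin \o F) \_ (~` N)) x)%E.
    by apply: eq_integral => x _; exact: (congr1 (@^~ x) HE).
  rewrite -integral_mkcond.
  have := negligible_integral mN measurableT (integrable_fubini_F iF) N0.
  by rewrite setTD => ->.
congr fine; rewrite (Fubini iF).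
by apply: eq_integral => y _; exact: GE.
Qed.

End potential_fubini.

Section boundary_densities.
Context {R : realType}.
Notation V := 'rV[R]_3.
Implicit Types (w : V -> V) (j k : 'I_3).

Lemma layer_kernel_bound (c : R) i b (z : V) :
  `|layer_kernel c i b z| <= 5 * (`|2 - c| + 1 + `|c|) * (1 + qe 0 z ^+ 2).
Proof.
have c1 : 0 <= `|2 - c| by []; have c2 : 0 <= `|c| by [].
have q0 : 0 <= qe 0 z by exact: qe_ge0.
case: b => j [k|]; rewrite /layer_kernel /=.
  apply: (le_trans (dGam_bound c 0 k j i z)); apply: ler_pM; rewrite ?sqr_ge0 ?lerDr//.
  by move: (`|2 - c|) (`|c|) c1 c2 => a b *; lra.
apply: (le_trans (Gam_bound c 0 j i z)); apply: ler_pM; rewrite ?addr_ge0//.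
  by move: (`|2 - c|) (`|c|) c1 c2 => a b *; lra.
move: (qe 0 z) => q; rewrite -subr_ge0.
(* Completing the square gives q <= 1 + q^2, which bounds the single layer kernel by the same
   majorant as the double layer kernel. *)
have -> : 1 + q ^+ 2 - q = (q - 2^-1) ^+ 2 + 3 / 4 by field.
by rewrite addr_ge0 ?sqr_ge0.
Qed.

(** The cyclic indices of [cross] and [curl] are expanded into an antisymmetric bilinear form, D k i
    standing for the k-th derivative of the i-th component. *)
Lemma cross_curl (a n : V) (D : 'I_3 -> 'I_3 -> R) :
  \sum_(i < 3) a ord0 i * (n ord0 (i + 1) * (D (i + 2 + 1) (i + 2 + 2) - D (i + 2 + 2) (i + 2 + 1))
    - n ord0 (i + 2) * (D (i + 1 + 1) (i + 1 + 2) - D (i + 1 + 2) (i + 1 + 1))) =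
  \sum_(i < 3) \sum_(k < 3) (a ord0 k * n ord0 i - a ord0 i * n ord0 k) * D k i.
Proof.
have e1 : 0 + 1 = 1 :> 'I_3 by exact: val_inj.
have e2 : 0 + 2 = 2 :> 'I_3 by exact: val_inj.
have e3 : 1 + 1 = 2 :> 'I_3 by exact: val_inj.
have e4 : 1 + 2 = 0 :> 'I_3 by exact: val_inj.
have e5 : 2 + 1 = 0 :> 'I_3 by exact: val_inj.
have e6 : 2 + 2 = 1 :> 'I_3 by exact: val_inj.
rewrite !sum_ord3 !(e1, e2, e3, e4, e5, e6).
move: (a ord0 0) (a ord0 1) (a ord0 2) (n ord0 0) (n ord0 1) (n ord0 2) => a0 a1 a2 n0 n1 n2.
move: (D 0 0) (D 0 1) (D 0 2) (D 1 0) (D 1 1) (D 1 2) (D 2 0) (D 2 1) (D 2 2) => *.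
by ring.
Qed.

Variables (lambda mu : R).

(* The coefficient of [partial k (component w j)] in [dot a (T w)], where T is
   the stress operator for the normal n. *)
Definition stress_coef (a n : V) j k : R :=
  mu * (a ord0 j * n ord0 k + a ord0 k * n ord0 j) + lambda * (j == k)%:R * dot a n.

(** The term 2 a_j n_k d_k w_j from the normal derivative and the term (a_k n_j - a_j n_k) d_k w_j
    from nu x curl w add up to the symmetric expression a_j n_k + a_k n_j. *)
Lemma dot_stress (nu : V -> V) w x (a : V) : (forall i, class_C 1 (component w i)) ->
  dot a (stress lambda mu nu w x) =
  \sum_j \sum_k stress_coef a (nu x) j k * partial k (component w j) x.
Proof.
move=> wC; set n := nu x; pose D k j := partial k (component w j) x.
have -> : dot a (stress lambda mu nu w x) = \sum_j (a ord0 j * (2 * mu * (\sum_k n ord0 k * D k j)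
    + lambda * divergence w x * n ord0 j) + mu * (a ord0 j * cross n (curl w x) ord0 j)).
  apply: eq_bigr => j _; rewrite /stress !mxE derive_component// mulrDr [a ord0 j * (mu * _)]mulrCA.
  by congr (_ + _ * (_ * _)); rewrite mxE.
rewrite big_split/= -mulr_sumr.
have -> : \sum_j a ord0 j * cross n (curl w x) ord0 j =
    \sum_(i < 3) \sum_(k < 3) (a ord0 k * n ord0 i - a ord0 i * n ord0 k) * D k i.
  by rewrite -cross_curl; apply: eq_bigr => j _; rewrite !mxE.
rewrite /D /divergence /stress_coef /dot !sum_ord3 /=.
have e01 : (0 == 1 :> 'I_3) = false by [].
have e02 : (0 == 2 :> 'I_3) = false by [].
have e12 : (1 == 2 :> 'I_3) = false by [].
have e10 : (1 == 0 :> 'I_3) = false by [].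
have e20 : (2 == 0 :> 'I_3) = false by [].
have e21 : (2 == 1 :> 'I_3) = false by [].
rewrite ?eqxx ?e01 ?e02 ?e12 ?e10 ?e20 ?e21 /= ?mulr1n ?mulr0n.
move: (a ord0 0) (a ord0 1) (a ord0 2) (n ord0 0) (n ord0 1) (n ord0 2) => a0 a1 a2 n0 n1 n2.
move: (partial 0 (component w 0) x) (partial 1 (component w 0) x) (partial 2 (component w 0) x)
  (partial 0 (component w 1) x) (partial 1 (component w 1) x) (partial 2 (component w 1) x)
  (partial 0 (component w 2) x) (partial 1 (component w 2) x) (partial 2 (component w 2) x) => *.
by ring.
Qed.

Variables (Sig : set V) (sigma : {measure set V -> \bar R}) (nu alpha beta : V -> V) (p R0 : R).
Hypotheses (mSig : measurable Sig) (sSig : (sigma Sig < +oo)%E) (sC : sigma (~` Sig) = 0%E)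
  (nu1 : forall x, Sig x -> dot (nu x) (nu x) = 1)
  (mnu : forall i, measurable_fun Sig (fun q => nu q ord0 i : measurableTypeR R))
  (p_gt1 : 1 < p) (aL : Lp_field sigma Sig p alpha) (bL : Lp_field sigma Sig p beta)
  (SigR : forall x, Sig x -> `|x| <= R0).

Lemma total_mass : (sigma [set: V] < +oo)%E.
Proof.
have H : (sigma (Sig `|` ~` Sig) <= sigma Sig + sigma (~` Sig))%E := measureU2 sigma mSig (measurableC mSig).
by move: H; rewrite setUv sC adde0 => /le_lt_trans; apply.
Qed.

(** The surface has finite measure, so L^p is contained in L^1. *)
Lemma Lp_component (f : V -> V) i : Lp_field sigma Sig p f ->
  sigma.-integrable [set: V] (EFin \o (component f i \_ Sig)).
Proof.
move=> fL; apply/Lfun1_integrable.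
have p1 : (1 <= p%:E)%E by rewrite lee_fin ltW.
apply: (Lfun_subset (lexx _) p1 _ p1) (fL i).
by rewrite ge0_fin_numE// total_mass.
Qed.

Let n_ i : V -> R := (fun q => nu q ord0 i) \_ Sig.

Let mn i : measurable_fun [set: V] (n_ i).
Proof. exact: (measurable_restrictT _ mSig).1 (mnu i). Qed.

Let n_bound i y : `|n_ i y| <= 1.
Proof.
rewrite /n_ patchE; case: ifPn => [/set_mem Sy|_]; last by rewrite normr0.
rewrite -sqrtr_sqr -[1]sqrtr1 ler_wsqrtr// -(nu1 Sy); exact: dot_coord.
Qed.

(** The double layer densities carry a minus sign because the y-derivative of a kernel in x - y is
    minus its own derivative. Extension by 0 turns integrals over the surface into integrals over
    the whole space. *)
Definition layer_density (b : 'I_3 * option 'I_3) : V -> R :=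
  if b.2 is Some k then (fun y => - stress_coef (alpha y) (nu y) b.1 k) \_ Sig
  else (fun y => - component beta b.1 y) \_ Sig.

Lemma integrable_layer_density b : sigma.-integrable [set: V] (EFin \o layer_density b).
Proof.
have ia i := Lp_component i aL.
have ian i l : sigma.-integrable [set: V] (EFin \o (fun y => (component alpha i \_ Sig) y * n_ l y)).
  by apply: (integrable_mul_bounded (ia i) (mn l) (B := 1) _).1.
case: b => j [k|] /=; last first.
  have E : layer_density (j, None) = (fun y => (-1) * (component beta j \_ Sig) y).
    by apply/funext => y; rewrite /layer_density /= !patchE; case: ifP => _; rewrite ?mulN1r ?oppr0.
  rewrite E; exact: (integrableZl measurableT (-1) (Lp_component j bL)).
have E : layer_density (j, Some k) = (fun y =>
   (- mu) * ((component alpha j \_ Sig) y * n_ k y + (component alpha k \_ Sig) y * n_ j y)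
   + (- (lambda * (j == k)%:R)) * ((component alpha 0 \_ Sig) y * n_ 0 y + (component alpha 1 \_ Sig) y * n_ 1 y
      + (component alpha 2 \_ Sig) y * n_ 2 y)).
  apply/funext => y; rewrite /layer_density /n_ /= !patchE; case: ifP => _ /=; last first.
    by rewrite !(mul0r, addr0, mulr0).
  by rewrite /stress_coef /dot sum_ord3 /component; ring.
rewrite E.
have i1 := integrableZl measurableT (- mu) (integrableD measurableT (ian j k) (ian k j)).
have i2 := integrableZl measurableT (- (lambda * (j == k)%:R))
  (integrableD measurableT (integrableD measurableT (ian 0 0) (ian 1 1)) (ian 2 2)).
exact: (integrableD measurableT i1 i2).
Qed.

Lemma layer_density_support b y : layer_density b y != 0 -> Sig y.
Proof.
move=> H; apply: contrapT => nS; move: H; rewrite /layer_density; case: b => j [k|] /=;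
  by rewrite patchE memNset// eqxx.
Qed.

(** The boundary integral of the theorem as a functional of w. For a kernel w(y) = k(x - y) the
    minus sign cancels and the sum of layer potentials at x results. *)
Definition layer_form (w : 'I_3 -> V -> R) : R :=
  \sum_j (\int[sigma]_y (layer_density (j, None) y * w j y) -
     \sum_k \int[sigma]_y (layer_density (j, Some k) y * partial k (w j) y)).

Lemma integrable_density_mul b (f : V -> R) : continuous f ->
  sigma.-integrable [set: V] (EFin \o (fun y => layer_density b y * f y)).
Proof.
move=> cf; have [C C0 HC] := continuous_bounded R0 cf.
apply: (integrable_mul_bounded (integrable_layer_density b) (continuous_measurable_rV cf) (B := C) _).1.
by move=> y /layer_density_support Sy; apply: HC; exact: SigR.
Qed.

Lemma layer_formE w : (forall i, class_C 1 (component w i)) ->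
  (\int[sigma]_(x in Sig) (dot (alpha x) (stress lambda mu nu w x) - dot (beta x) (w x))%:E)%E
  = (layer_form (component w))%:E.
Proof.
move=> wC.
have ib j := integrable_density_mul (j, None) (class_C_cont (wC j)).
have ik j k := integrable_density_mul (j, Some k) (class_C_cont (class_C_partial k (wC j))).
have ik' j := Rintegral_sum (index_enum _) (ik j).
pose f j y := layer_density (j, None) y * component w j y -
  \sum_k layer_density (j, Some k) y * partial k (component w j) y.
have ij j : sigma.-integrable [set: V] (EFin \o f j) := integrableB measurableT (ib j) (ik' j).1.
have fE := Rintegral_sum (index_enum _) ij.
have -> : layer_form (component w) = \int[sigma]_y \sum_j f j y.
  rewrite fE.2; apply: eq_bigr => j _; rewrite /f RintegralB//; last exact: (ik' j).1.
  by rewrite (ik' j).2.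
rewrite /Rintegral fineK; last exact: (integrable_fin_num measurableT fE.1).
rewrite [LHS]integral_mkcond; apply: eq_integral => y _; rewrite patchE.
case: ifPn => yS; last first.
  rewrite big1// => j _; rewrite /f /layer_density /= !patchE (negPf yS) mul0r big1 ?subr0// => k _.
  by rewrite patchE (negPf yS) mul0r.
congr EFin; rewrite dot_stress// /dot -sumrB; apply: eq_bigr => j _.
rewrite /f /layer_density /= patchE yS mulNr addrC -sumrN; congr (_ + _).
by apply: eq_bigr => k _; rewrite patchE yS mulNr opprK.
Qed.

Lemma layer_form_sum (I : finType) (d : I -> R) (w : I -> 'I_3 -> V -> R) :
  (forall b i, class_C 1 (w b i)) ->
  layer_form (fun j y => \sum_b d b * w b j y) = \sum_b d b * layer_form (w b).
Proof.
move=> wC.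
have S bb (f : I -> V -> R) : (forall b, continuous (f b)) ->
    \int[sigma]_y (layer_density bb y * \sum_b d b * f b y) = \sum_b d b * \int[sigma]_y (layer_density bb y * f b y).
  move=> cf.
  have i0 b := integrable_density_mul bb (cf b).
  have i1 b : sigma.-integrable [set: V] (EFin \o (fun y => d b * (layer_density bb y * f b y))).
    exact: (integrableZl measurableT (d b) (i0 b)).
  transitivity (\int[sigma]_y \sum_b d b * (layer_density bb y * f b y)).
    congr (Rintegral _ _); apply/funext => y; rewrite mulr_sumr; apply: eq_bigr => b _; exact: mulrCA.
  rewrite (Rintegral_sum _ i1).2; apply: eq_bigr => b _; exact: (RintegralZl (d b) measurableT (i0 b)).
rewrite /layer_form; under [RHS]eq_bigr do rewrite mulr_sumr.
rewrite exchange_big/=; apply: eq_bigr => j _.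
rewrite S; last by move=> b; exact: class_C_cont (wC b j).
under [RHS]eq_bigr do rewrite mulrBr mulr_sumr.
rewrite sumrB; congr (_ - _); rewrite exchange_big/=; apply: eq_bigr => k _.
rewrite -S; last by move=> b; exact: class_C_cont (class_C_partial k (wC b j)).
congr (Rintegral _ _); apply/funext => y; congr (_ * _).
rewrite partial_sum; last by move=> b; exact: class_CZ (wC b j).
by apply: eq_bigr => b _; rewrite (partialZ _ _ (wC b j)).
Qed.

End boundary_densities.

(** * Construction of the solution *)

Section sufficiency.
Context {R : realType}.
Notation V := 'rV[R]_3.

(** Fubini's theorem asks for a measure carrying the finiteness structure; restricting to the whole
    space provides one with the same values. *)
Lemma finite_measure_of (sigma : {measure set V -> \bar R}) : (sigma [set: V] < +oo)%E ->
  exists s : {finite_measure set V -> \bar R}, (s : set V -> \bar R) = sigma.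
Proof.
move=> soo; exists (mfrestr measurableT soo).
by apply/funext => A; transitivity (sigma (A `&` [set: V])) => //; rewrite setIT.
Qed.

Variables (Omega : set V) (theta lambda mu : R) (nu : V -> V) (sigma : {measure set V -> \bar R})
  (p : R) (alpha beta : V -> V).
Hypotheses (oO : open Omega) (bO : bounded_set Omega) (connC : connected (~` Omega))
  (surf : C2_holder_surface theta (boundary Omega)) (nuP : outward_unit_normal Omega nu)
  (sigmaP : surface_measure (boundary Omega) sigma)
  (mu_gt0 : 0 < mu) (lame : 0 < 3 * lambda + 2 * mu) (p_gt1 : 1 < p)
  (aL : Lp_field sigma (boundary Omega) p alpha) (bL : Lp_field sigma (boundary Omega) p beta).

Let Sig := boundary Omega.
Local Notation c := ((lambda + mu) / (lambda + 2 * mu)).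

Let mSig : measurable Sig. Proof. by apply: closed_measurable_rV; exact: closed_boundary. Qed.
Let sSig : (sigma Sig < +oo)%E. Proof. by have [] := boundary_regular oO bO surf nuP sigmaP. Qed.
Let nSig : leb3 Sig = 0%E. Proof. by have [] := boundary_regular oO bO surf nuP sigmaP. Qed.
Let mnu : forall i, measurable_fun Sig (fun q => nu q ord0 i : measurableTypeR R).
Proof. by have [] := boundary_regular oO bO surf nuP sigmaP. Qed.
Let sC : sigma (~` Sig) = 0%E. Proof. by have [] := sigmaP. Qed.
Let nu1 x : Sig x -> dot (nu x) (nu x) = 1. Proof. by move=> /nuP[]. Qed.

Let m := layer_density lambda mu Sig nu alpha beta.

Lemma boundary_form : exists2 R0 : R, 0 < R0 &
  [/\ forall x, closure Omega x -> `|x| <= R0,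
      forall b, sigma.-integrable [set: V] (EFin \o m b),
      forall w, (forall i, class_C 1 (component w i)) ->
        boundary_integral Omega sigma lambda mu nu alpha beta w =
          (layer_form lambda mu Sig sigma nu alpha beta (component w))%:E,
      forall b f, continuous f -> sigma.-integrable [set: V] (EFin \o (fun y => m b y * f y)) &
      forall (I : finType) (d : I -> R) (w : I -> 'I_3 -> V -> R), (forall b i, class_C 1 (w b i)) ->
        layer_form lambda mu Sig sigma nu alpha beta (fun j y => \sum_b d b * w b j y) =
        \sum_b d b * layer_form lambda mu Sig sigma nu alpha beta (w b)].
Proof.
have [R0 R00 HR] := bounded_domain bO; exists R0 => //.
have SR x : Sig x -> `|x| <= R0 by rewrite /Sig boundaryE// => -[/HR].
split => //.
- exact: (integrable_layer_density lambda mu mSig sSig sC nu1 mnu p_gt1 aL bL).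
- move=> w wC; exact: (layer_formE lambda mu mSig sSig sC nu1 mnu p_gt1 aL bL SR wC).
- move=> b f cf; exact: (integrable_density_mul lambda mu mSig sSig sC nu1 mnu p_gt1 aL bL SR b cf).
- move=> I d w wC; exact: (layer_form_sum lambda mu mSig sSig sC nu1 mnu p_gt1 aL bL SR d wC).
Qed.

Variable omega : forall k : nat, 'I_(k.*2.+1) -> V -> R.
Hypothesis omega_basis : forall k, harmonic_basis (@omega k).

Lemma poly_solution_smooth (a : pindex) : smooth_field (poly_solution lambda mu (@omega) a).
Proof.
case: a => k [s j] i n; have [H _ _] := omega_basis k.
exact: (kelvin_smooth lambda mu j (homogeneous_hpoly (H s).1) n i).
Qed.

Lemma poly_solution_elasticity (a : pindex) x :
  elasticity lambda mu (poly_solution lambda mu (@omega) a) x = 0.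
Proof.
case: a => k [s j]; have [H _ _] := omega_basis k.
exact: (kelvin_elasticity mu_gt0 lame j (homogeneous_hpoly (H s).1) (H s).2 x).
Qed.

Hypothesis orth : forall a, boundary_integral Omega sigma lambda mu nu alpha beta
  (poly_solution lambda mu (@omega) a) = 0%E.

(** Orthogonality to the system extends by linearity to every homogeneous polynomial solution,
    through [polynomial_solution_comb]. *)
Lemma layer_form_polynomial n (P : 'I_3 -> V -> R) : (forall j, hpoly n (P j)) ->
  (forall y, elasticity lambda mu (fun y => \row_j P j y) y = 0) ->
  layer_form lambda mu Sig sigma nu alpha beta P = 0.
Proof.
move=> Pn EP; have [R0 R00 [_ _ LE _ LS]] := boundary_form.
have [d dP] := polynomial_solution_comb mu_gt0 lame Pn EP (omega_basis n).
have smooth b i := poly_solution_smooth b i 1.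
have -> : P = (fun j y => \sum_(b : 'I_(n.*2.+1) * 'I_3) d b.1 b.2 *
    component (poly_solution lambda mu (@omega) (existT _ n (b.1, b.2))) j y).
  apply/funext => j; apply/funext => y; have := congr1 (fun M : V => M ord0 j) (dP y).
  rewrite mxE => ->; rewrite summxE; under eq_bigr do rewrite summxE.
  by rewrite pair_big/=; apply: eq_bigr => -[s l] _; rewrite mxE.
rewrite LS; last by move=> b i; exact: smooth.
rewrite big1// => -[s l] _.
have := orth (existT _ n (s, l)); rewrite LE; last by move=> i; exact: smooth.
by move=> [->]; rewrite mulr0.
Qed.

Let U i x := \sum_b \int[sigma]_y (m b y * layer_kernel c i b (x - y)).

(** The constant 48 * 11 in both radii is 48 (N + 3) for the common kernel size N = 8. *)
Lemma potential_exterior i x : (~` closure Omega) x -> U i x = 0.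
Proof.
have [R0 R00 [HR im _ _ _]] := boundary_form.
have mS b y : m b y != 0 -> Sig y by exact: layer_density_support.
have SR y : Sig y -> `|y| <= R0 by rewrite /Sig boundaryE// => -[/HR].
apply: (exterior_vanishing oO bO connC surf (U := U i) (K := 48 * 11) (R1 := 48 * 11 * R0)).
- by rewrite mulr_gt0.
- move=> z zR; apply: (layer_potential_far mu_gt0 lame im (ltW R00)).
  + by move=> b y /mS/SR.
  + exact: layer_form_polynomial.
  + by apply: le_lt_trans zR; rewrite !mulr_ge0// ltW.
  + exact: ltW.
- move=> z r r0 zr zU h hr.
  apply: (potential_continuation (kern_layer c i) im r0 _ zU hr) => b y /mS.
  exact: zr.
Qed.

(** A point off the closed surface has positive distance to it, so the kernel is bounded on the
    support of the density. *)
Lemma potential_off_boundary i b x : ~ Sig x ->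
  sigma.-integrable [set: V] (EFin \o (fun y => m b y * layer_kernel c i b (x - y))).
Proof.
move=> nS; have [R0 R00 [HR im _ _ _]] := boundary_form.
have [r r0 rS] := open_contains_ball (closed_openC (closed_boundary oO)) nS.
have mr := measurable_reflect x (kern_measurable (kern_layer c i b)).
pose C := 5 * (`|2 - c| + 1 + `|c|) * (1 + r^-1 ^+ 2).
apply: (integrable_mul_bounded (im b) mr (B := C) _).1 => y /layer_density_support Sy.
have ry : r <= `|x - y| by rewrite leNgt; apply/negP => /rS.
apply: (le_trans (layer_kernel_bound c i b (x - y))).
rewrite ler_wpM2l ?mulr_ge0 ?addr_ge0// lerD2l.
by apply: lerXn2r (qe0_norm_le r0 ry); rewrite ?nnegrE ?qe_ge0// invr_ge0 ltW.
Qed.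

Section fubini.
Variables (g : V -> R) (G M : R).
Hypotheses (mg : measurable_fun [set: V] g) (gG : forall x, `|g x| <= G) (M_ge0 : 0 <= M)
  (gM : forall x, M < `|x| -> g x = 0).

Lemma layer_fubini i b :
  leb3.-integrable [set: V] (EFin \o
    ((fun x => (\int[sigma]_y (m b y * layer_kernel c i b (x - y))) * g x) \_ (~` Sig))) /\
  \int[leb3]_x ((fun x => (\int[sigma]_y (m b y * layer_kernel c i b (x - y))) * g x) \_ (~` Sig)) x =
  \int[sigma]_y (m b y * \int[leb3]_x (layer_kernel c i b (x - y) * g x)) /\
  sigma.-integrable [set: V] (EFin \o (fun y => m b y * \int[leb3]_x (layer_kernel c i b (x - y) * g x))).
Proof.
have [R0 R00 [HR im _ _ _]] := boundary_form.
have [s sE] := finite_measure_of (total_mass mSig sSig sC).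
have sI (f : V -> R) : \int[s]_y f y = \int[sigma]_y f y by exact: (congr1 (fun mu' : set V -> \bar R => fine (\int[mu']_y (f y)%:E)%E) sE).
have sint (f : V -> R) : sigma.-integrable [set: V] (EFin \o f) -> s.-integrable [set: V] (EFin \o f).
  move=> /integrableP[mf fi]; apply/integrableP; split => //.
  have E : (\int[s]_y `|(EFin \o f) y| = \int[sigma]_y `|(EFin \o f) y|)%E.
    exact: (congr1 (fun mu' : set V -> \bar R => \int[mu']_y `|(EFin \o f) y|)%E sE).
  by rewrite E.
have sint' (f : V -> R) : s.-integrable [set: V] (EFin \o f) -> sigma.-integrable [set: V] (EFin \o f).
  move=> /integrableP[mf fi]; apply/integrableP; split => //.
  have E : (\int[s]_y `|(EFin \o f) y| = \int[sigma]_y `|(EFin \o f) y|)%E.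
    exact: (congr1 (fun mu' : set V -> \bar R => \int[mu']_y `|(EFin \o f) y|)%E sE).
  by rewrite -E.
have mR0 y : m b y != 0 -> `|y| <= R0.
  by move=> /layer_density_support; rewrite /Sig boundaryE// => -[/HR].
have C0 : 0 <= 5 * (`|2 - c| + 1 + `|c|) by rewrite mulr_ge0 ?addr_ge0.
have mk := kern_measurable (kern_layer c i b).
have iN x : ~ Sig x -> s.-integrable [set: V] (EFin \o (fun y => m b y * layer_kernel c i b (x - y))).
  by move=> nS; apply: sint; exact: potential_off_boundary.
have kC z := layer_kernel_bound c i b z.
have I1 := potential_integrable (sint _ (im b)) mk mg mSig (ltW R00) M_ge0 C0 mR0 kC gG gM iN.
have I2 := potential_fubini (sint _ (im b)) mk mg mSig nSig (ltW R00) M_ge0 C0 mR0 kC gG gM iN.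
rewrite sI in I2.
have I3 := sint' _ (potential_dual_integrable (sint _ (im b)) mk mg (ltW R00) M_ge0 C0 mR0 kC gG gM).
have E : (fun x => (\int[s]_y (m b y * layer_kernel c i b (x - y))) * g x) =
  (fun x => (\int[sigma]_y (m b y * layer_kernel c i b (x - y))) * g x).
  by apply/funext => x; rewrite sI.
by rewrite E in I1 I2.
Qed.

Lemma potential_mul_integrable i :
  leb3.-integrable [set: V] (EFin \o ((fun x => U i x * g x) \_ (~` Sig))) /\
  \int[leb3]_x ((fun x => U i x * g x) \_ (~` Sig)) x =
  \sum_b \int[sigma]_y (m b y * \int[leb3]_x (layer_kernel c i b (x - y) * g x)).
Proof.
have S := Rintegral_sum (index_enum _) (fun b => (layer_fubini i b).1).
have -> : (fun x => U i x * g x) \_ (~` Sig) = (fun x => \sum_b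
    ((fun x => (\int[sigma]_y (m b y * layer_kernel c i b (x - y))) * g x) \_ (~` Sig)) x).
  apply/funext => x; rewrite patchE; case: ifPn => xS.
    by rewrite mulr_suml; apply: eq_bigr => b _; rewrite patchE xS.
  by rewrite big1// => b _; rewrite patchE (negPf xS).
by split; [exact: S.1|rewrite S.2; apply: eq_bigr => b _; rewrite (layer_fubini i b).2.1].
Qed.

End fubini.

Lemma partial_eq_open (O : set V) (f h : V -> R) k : open O -> (forall x, O x -> f x = h x) ->
  forall x, O x -> partial k f x = partial k h x.
Proof.
move=> oO' fh x Ox; apply: near_eq_derive.
by apply: filterS (open_nbhs_nbhs (conj oO' Ox : open_nbhs x O)) => y /fh.
Qed.

Lemma navier_eq_open (O : set V) (v w : 'I_3 -> V -> R) i : open O ->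
  (forall i x, O x -> v i x = w i x) ->
  forall x, O x -> navier lambda mu v i x = navier lambda mu w i x.
Proof.
move=> oO' vw x Ox.
have d1 k l y : O y -> partial k (v l) y = partial k (w l) y by exact: partial_eq_open (vw l) y.
have e1 : laplacian (v i) x = laplacian (w i) x.
  by apply: eq_bigr => k _; apply: (partial_eq_open k oO') => // y; exact: d1.
have e2 : partial i (fun x => \sum_k partial k (v k) x) x = partial i (fun x => \sum_k partial k (w k) x) x.
  by apply: (partial_eq_open i oO') => // y Oy; apply: eq_bigr => k _; exact: d1.
exact: (congr2 (fun a b => mu * a + (lambda + mu) * b) e1 e2).
Qed.

Lemma solvable : exists u, class_A Omega sigma lambda mu nu p u /\
  betti_identity Omega sigma lambda mu nu u alpha beta.
Proof.
have [kappa k0 rep] := kelvin_representation mu_gt0 lame.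
have [R0 R00 [HR im LE ID _]] := boundary_form.
(* The factor undoes the constant - kappa of the representation formula. *)
pose u (x : V) : V := \row_i (- kappa^-1 * U i x).
have mO : measurable Omega by exact: open_measurable_rV.
have OS x : Omega x -> (~` Sig) x by move=> Ox; rewrite /Sig boundaryE// => -[].
have uB : betti_identity Omega sigma lambda mu nu u alpha beta.
  move=> w wS.
  (* The test field is cut off outside a ball containing the closure of Omega in its interior, so
     neither E w on Omega nor w and its derivatives on the surface change. *)
  pose w' i x := cutf (R0 + 1) x * component w i x.
  have R1 : 0 <= R0 + 1 by rewrite addr_ge0// ltW.
  have w'C i : class_C 3 (w' i) by exact: class_CM (class_C_cut 2 (R0 + 1)) (wS i 3).
  have R5 : 0 <= R0 + 1 + 4 by rewrite addr_ge0.
  have w'0 i x : R0 + 1 + 4 < `|x| -> w' i x = 0 by move=> xR; rewrite /w' cut0// mul0r.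
  pose O := [set x : V | `|0 - x| < R0 + 1].
  have oO' : open O by exact: open_distance_ball.
  have w'w i x : O x -> w' i x = component w i x.
    by rewrite /O /= sub0r normrN => xR; rewrite /w' cut1 ?mul1r// ltW.
  have clO x : closure Omega x -> O x.
    by move=> /HR xR; rewrite /O /= sub0r normrN (le_lt_trans xR)// ltrDl.
  pose g := navier lambda mu w'.
  have gC i : class_C 1 (g i) by exact: class_C_navier.
  have g0 i x : R0 + 1 + 4 < `|x| -> g i x = 0 by exact: navier_support.
  have mg i : measurable_fun [set: V] (g i) := continuous_measurable_rV (class_C_cont (gC i)).
  have [G gG] : {G : 'I_3 -> R & forall i x, `|g i x| <= G i}.
    apply: (@choice _ _ (fun i G => forall x, `|g i x| <= G)) => i.
    have [C C0 HC] := continuous_bounded (R0 + 1 + 4) (class_C_cont (gC i)).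
    exists C => x; have [xR|/g0 ->] := leP `|x| (R0 + 1 + 4); first exact: HC.
    by rewrite normr0.
  have PI i := potential_mul_integrable (mg i) (gG i) R5 (g0 i) i.
  have LF i b := (layer_fubini (mg i) (gG i) R5 (g0 i) i b).2.2.
  (* After Fubini's theorem the inner integrals are those of the representation formula at points y
     of the surface: they give - kappa w_j for the single layer and kappa d_k w_j for the double
     layer, which is - kappa times the boundary form. *)
  have total : \sum_i \int[leb3]_x ((fun x => U i x * g i x) \_ (~` Sig)) x =
      - kappa * layer_form lambda mu Sig sigma nu alpha beta (component w).
    transitivity (\sum_b \int[sigma]_y (m b y * \sum_i \int[leb3]_x (layer_kernel c i b (x - y) * g i x))).
      under eq_bigr do rewrite (PI _).2.
      rewrite exchange_big/=; apply: eq_bigr => b _.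
      rewrite -(Rintegral_sum _ (fun i => LF i b)).2.
      by congr (Rintegral _ _); apply/funext => y; rewrite mulr_sumr.
    have LFs b : sigma.-integrable [set: V] (EFin \o (fun y => m b y * \sum_i \int[leb3]_x (layer_kernel c i b (x - y) * g i x))).
      have := (Rintegral_sum (index_enum _) (fun i => LF i b)).1.
      by congr (integrable _ _ (EFin \o _)); apply/funext => y; rewrite mulr_sumr.
    have cw i : class_C 1 (component w i) by exact: wS.
    have SO y : Sig y -> O y by rewrite /Sig boundaryE// => -[cy _]; exact: clO.
    rewrite sum_pair_option /layer_form mulr_sumr; apply: eq_bigr => j _.
    rewrite mulrBr mulr_sumr -sumrN; congr (_ + _).
      transitivity (\int[sigma]_y (- kappa * (m (j, None) y * component w j y))); last first.
        apply: RintegralZl => //.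
        exact: ID (class_C_cont (cw j)).
      congr (Rintegral _ _); apply/funext => y.
      have [->|my] := eqVneq (m (j, None) y) 0; first by rewrite !mul0r mulr0.
      have Sy := layer_density_support my.
      rewrite mulrCA; congr (_ * _).
      have [H _] := rep w' (R0 + 1 + 4) R5 w'C w'0 y j.
      rewrite -(w'w j y (SO y Sy)) -H; apply: eq_bigr => i _.
      by congr (Rintegral _ _); apply/funext => x; rewrite /layer_kernel /= Gam_sym.
    apply: eq_bigr => k _; rewrite mulNr opprK.
    transitivity (\int[sigma]_y (kappa * (m (j, Some k) y * partial k (component w j) y))); last first.
      apply: RintegralZl => //.
      exact: ID (class_C_cont (class_C_partial k (cw j))).
    congr (Rintegral _ _); apply/funext => y.
    have [->|my] := eqVneq (m (j, Some k) y) 0; first by rewrite !mul0r mulr0.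
    have Sy := layer_density_support my.
    rewrite mulrCA; congr (_ * _).
    have [_ H] := rep w' (R0 + 1 + 4) R5 w'C w'0 y j.
    rewrite -(partial_eq_open k oO' (w'w j) (SO y Sy)) -H; apply: eq_bigr => i _.
    by congr (Rintegral _ _); apply/funext => x; rewrite /layer_kernel /= dGam_sym.
  have IT := Rintegral_sum (index_enum _) (fun i => (PI i).1).
  pose T x := \sum_i ((fun x => U i x * g i x) \_ (~` Sig)) x.
  rewrite LE; last by move=> i; exact: wS.
  rewrite integral_mkcond.
  (* Off Omega and the surface the integrand is 0 because U vanishes on the exterior; on Omega, E w
     and E w' agree. *)
  have -> : (\int[leb3]_x ((fun x => (dot (u x) (elasticity lambda mu w x))%:E) \_ Omega) x =
      \int[leb3]_x (- kappa^-1 * T x)%:E)%E.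
    apply: eq_integral => x _; rewrite patchE /T; case: ifPn => [/set_mem Ox|/negP nO].
      congr EFin; rewrite /dot mulr_sumr; apply: eq_bigr => i _.
      rewrite patchE mem_set; last exact: OS.
      rewrite mxE -mulrA; congr (_ * (_ * _)).
      rewrite elasticityE; apply/esym.
      exact: (navier_eq_open i oO' w'w (clO _ (subset_closure Ox))).
    rewrite big1 ?mulr0// => i _; rewrite patchE; case: ifPn => // /set_mem nS.
    rewrite potential_exterior ?mul0r// => cx; apply: nS; rewrite /Sig boundaryE//; split => //.
    by move=> Ox; apply: nO; rewrite inE.
  have iT : leb3.-integrable [set: V] (EFin \o (fun x => - kappa^-1 * T x)).
    exact: (integrableZl measurableT (- kappa^-1) IT.1).
  rewrite -[LHS](fineK (integrable_fin_num measurableT iT)); congr EFin.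
  apply: (etrans (RintegralZl (- kappa^-1) measurableT IT.1)).
  by rewrite IT.2 total mulrA mulrNN mulVf ?mul1r// gt_eqF.
exists u; split => //; split; last by exists alpha, beta.
move=> i; apply/Lfun1_integrable.
(* Integrability of u on Omega: the same Fubini argument, with E w replaced by the indicator of a
   ball containing Omega. *)
pose g : V -> R := \1_[set x : V | `|x| <= R0].
have mg : measurable_fun [set: V] g by apply: measurable_indic; exact: measurable_norm_le.
have gG x : `|g x| <= 1 by rewrite /g indicE; case: (_ \in _); rewrite ?normr1 ?normr0.
have g0 x : R0 < `|x| -> g x = 0.
  by move=> xR; rewrite /g indicE memNset//= => /le_lt_trans /(_ xR); rewrite ltxx.
have [I _] := potential_mul_integrable mg gG (ltW R00) g0 i.
have E : component u i \_ Omega = (fun x => - kappa^-1 * (((fun x => U i x * g x) \_ (~` Sig)) \_ Omega) x).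
  apply/funext => x; rewrite !patchE; case: ifPn => [/set_mem Ox|_]; last by rewrite mulr0.
  rewrite mem_set; last exact: OS.
  rewrite /component mxE /g indicE mem_set ?mulr1//.
  by apply: HR; exact: subset_closure.
have I2 : leb3.-integrable [set: V] (EFin \o (((fun x => U i x * g x) \_ (~` Sig)) \_ Omega)).
  have := (integrable_mkcond _ mO).1 (integrableS measurableT mO (@subsetT _ _) I).
  by congr (integrable _ _ _); apply/funext => x; rewrite /= !patchE; case: ifP.
by rewrite E; exact: (integrableZl measurableT (- kappa^-1) I2).
Qed.

End sufficiency.

Theorem theorem12 (R : realType)
  (Omega : set 'rV[R]_3) (theta lambda mu : R)
  (nu : 'rV[R]_3 -> 'rV[R]_3) (sigma : {measure set 'rV[R]_3 -> \bar R})
  (omega : forall k : nat, 'I_(k.*2.+1) -> 'rV[R]_3 -> R)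
  (enum : nat -> pindex)
  (p : R) (alpha beta : 'rV[R]_3 -> 'rV[R]_3)
  (Omega_nonempty : Omega !=set0) (Omega_open : open Omega)
  (Omega_connected : connected Omega) (Omega_bounded : bounded_set Omega)
  (OmegaC_connected : connected (~` Omega))
  (theta_gt0 : 0 < theta) (theta_le1 : theta <= 1)
  (Sigma_C2theta : C2_holder_surface theta (boundary Omega))
  (nu_normal : outward_unit_normal Omega nu)
  (sigma_surface : surface_measure (boundary Omega) sigma)
  (mu_gt0 : 0 < mu) (lame : 0 < 3 * lambda + 2 * mu)
  (omega_basis : forall k, harmonic_basis (omega k))
  (enum_bij : bijective enum)
  (p_gt1 : 1 < p)
  (alpha_Lp : Lp_field sigma (boundary Omega) p alpha)
  (beta_Lp : Lp_field sigma (boundary Omega) p beta) :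
  (exists u : 'rV[R]_3 -> 'rV[R]_3,
     class_A Omega sigma lambda mu nu p u /\
     betti_identity Omega sigma lambda mu nu u alpha beta)
  <->
  (forall k : nat,
     boundary_integral Omega sigma lambda mu nu alpha beta
       (poly_solution lambda mu omega (enum k)) = 0%E).
Proof.
have smooth := poly_solution_smooth lambda mu omega_basis.
have null := poly_solution_elasticity mu_gt0 lame omega_basis.
split=> [[u [_ uB]] k|orth].
  rewrite -(uB _ (smooth (enum k))); apply: integral0_eq => x _.
  by rewrite null /dot big1// => i _; rewrite mxE mulr0.
apply: (solvable Omega_open Omega_bounded OmegaC_connected Sigma_C2theta nu_normal sigma_surface
  mu_gt0 lame p_gt1 alpha_Lp beta_Lp omega_basis) => a.
by have [inv _ enumK] := enum_bij; rewrite -(enumK a).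
Qed.
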